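(* Let $1\le q<p\le+\infty$ and suppose $q\le2\le p$. Then there exists $\Omega^\star\in\mathcal{A}^2_{convex}$ such that $$\mathcal{F}_{p,q}(\Omega^\star)=\min\{\mathcal{F}_{p,q}(\Omega)\ :\ \Omega\in\mathcal{A}^2_{convex}\}.$$
   Context: For an open set $\Omega\subset\mathbb{R}^d$ with $0<|\Omega|<+\infty$ ($|\cdot|$ is Lebesgue measure) and $1<p<+\infty$, let $$\lambda_p(\Omega)=\inf\left\{\frac{\int_\Omega|\nabla u|^p\,dx}{\int_\Omega|u|^p\,dx}\ :\ u\in C^1_c(\Omega),\ u\not\equiv0\right\}.$$ For the extreme exponents, $\lambda_1^{1/1}(\Omega)=\lambda_1(\Omega):=h(\Omega)$, where $h(\Omega)=\inf\{P(E)/|E| : \overline E\subset\Omega \text{ compact},\ |E|>0\}$ is the Cheeger constant ($P$ is the De Giorgi perimeter), equivalently $h(\Omega)=\inf\{\int_\Omega|\nabla u|\,dx/\int_\Omega|u|\,dx : u\in C^1_c(\Omega),\ u\not\equiv0\}$; and $\lambda_p^{1/p}(\Omega):=\rho(\Omega)^{-1}$ when $p=+\infty$, where $\rho(\Omega)$ is the inradius, i.e. the supremum of the radii of balls contained in $\Omega$. Set $\mathcal{F}_{p,q}(\Omega)=\lambda_p^{1/p}(\Omega)/\lambda_q^{1/q}(\Omega)$, and let $\mathcal{A}^2_{convex}$ be the class of open convex sets $\Omega\subset\mathbb{R}^2$ with $0<|\Omega|<+\infty$. *)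

(* Defs.v *)
From HB Require Import structures.
From mathcomp Require Import all_boot all_order all_algebra.
From mathcomp Require Import all_classical all_reals all_analysis.

Set Implicit Arguments.
Unset Strict Implicit.
Unset Printing Implicit Defensive.
Import Order.TTheory GRing.Theory Num.Theory.
Import numFieldNormedType.Exports.
Local Open Scope classical_set_scope.
Local Open Scope ring_scope.

(* The plane is [R * R]. Its library norm and balls are those of the sup norm;
   they are used only for the topology and for differentiability, which do not
   depend on the choice of a norm. Every metric quantity below goes through the
   Euclidean norm [enorm]. *)

Notation lebesgue2 R :=
  (@lebesgue_measure R \x @lebesgue_measure R)%E (only parsing).

Section plane.
Context {R : realType}.
Implicit Types (x y : R * R) (E Omega : set (R * R)).

Definition enorm x : R := Num.sqrt (x.1 ^+ 2 + x.2 ^+ 2).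

Definition eball x (r : R) : set (R * R) := [set y | enorm (y - x) < r].

Definition gradient (u : R * R -> R) x : R * R :=
  ('D_(1, 0) u x, 'D_(0, 1) u x).

Definition divergence (phi : R * R -> R * R) x : R :=
  'D_(1, 0) (fst \o phi) x + 'D_(0, 1) (snd \o phi) x.

Definition C1 (W : normedModType R) (u : R * R -> W) : Prop :=
  [/\ forall x, differentiable u x,
      continuous ('D_(1, 0) u) & continuous ('D_(0, 1) u)].

(* Elements of C^1_c(Omega; W) are identified with their extensions by zero to
   the whole plane; the support is the closure of the set where [u] is nonzero. *)
Definition C1c (W : normedModType R) Omega (u : R * R -> W) : Prop :=
  [/\ C1 u, compact (closure [set x | u x != 0])
    & closure [set x | u x != 0] `<=` Omega].

Definition rayleigh (p : R) Omega (u : R * R -> R) : \bar R :=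
  (\int[lebesgue2 R]_(x in Omega) (enorm (gradient u x) `^ p)%:E
   / \int[lebesgue2 R]_(x in Omega) (`|u x| `^ p)%:E)%E.

Definition lambda (p : R) Omega : \bar R :=
  ereal_inf [set rayleigh p Omega u
            | u in [set u : R * R -> R | C1c Omega u /\ exists x, u x != 0]].

(* De Giorgi perimeter in the whole plane. *)
Definition perimeter E : \bar R :=
  ereal_sup [set (\int[lebesgue2 R]_(x in E) (divergence phi x)%:E)%E
            | phi in [set phi : R * R -> R * R |
                        C1c setT phi /\ forall x, enorm (phi x) <= 1]].

(* Restricting to Borel competitors does not change the infimum: every Lebesgue
   measurable set contains a Borel set of the same measure and perimeter. *)
Definition cheeger Omega : \bar R :=
  ereal_inf [set (perimeter E / lebesgue2 R E)%E
            | E in [set E | [/\ measurable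
                                  (E : set (measurableTypeR R * measurableTypeR R)),
                                compact (closure E),
                                closure E `<=` Omega
                              & (0 < lebesgue2 R E)%E]]].

Definition inradius Omega : \bar R :=
  ereal_sup [set r%:E | r in [set r : R | 0 < r /\
                                exists x, eball x r `<=` Omega]].

(* lambda_p^{1/p} for 1 <= p <= +oo; the value at -oo is irrelevant. *)
Definition lambda_root (p : \bar R) Omega : \bar R :=
  match p with
  | p%:E => if p == 1 then cheeger Omega else (lambda p Omega `^ p^-1)%E
  | +oo%E => ((inradius Omega)^-1)%E
  | -oo%E => 0%E
  end.

Definition Fpq (p q : \bar R) Omega : \bar R :=
  (lambda_root p Omega / lambda_root q Omega)%E.

Definition A2convex Omega : Prop :=
  [/\ open Omega,
      convex_set (M := (R * R)%type) Omega,
      (0 < lebesgue2 R Omega)%E & (lebesgue2 R Omega < +oo)%E].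

End plane.

(* Main.v *)
Require Import Defs.
From mathcomp Require Import all_boot all_order all_algebra.
From mathcomp Require Import all_classical all_reals all_analysis.
From mathcomp Require Import measurable_realfun ring lra.

Set Implicit Arguments.
Unset Strict Implicit.
Unset Printing Implicit Defensive.
Import Order.TTheory GRing.Theory Num.Theory.
Import numFieldNormedType.Exports.
Local Open Scope classical_set_scope.
Local Open Scope ring_scope.

(* F = Fpq p q is invariant under similarities. Let Q be the unit square, and call
   c an r-Poincare constant if c int |v|^r <= int |v'|^r for all C^1 functions v
   supported in an interval of length less than 1.

   Long thin domains have energy almost at least F(Q). If the vertical chords of Om
   are shorter than 1, integrating over them bounds lambda_r(Om) from below by any
   r-Poincare constant; conversely, testing lambda_r on a rectangle a x b with
   products v(x/a) v(y/b) turns a lower bound for lambda_r into an r-Poincare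
   constant. Comparing |(X,Y)|^r with |X|^r + |Y|^r, with the factor 2^(r/2-1) in
   one direction or the other according to the position of r with respect to 2, yields
   lambda_p^(1/p)(Om) >= lambda_p^(1/p)(Q) / (sqrt 2 m) if the chords of Om are
   shorter than m and p >= 2, and
   lambda_q^(1/q)(Om) <= (1/a + 1/b) lambda_q^(1/q)(Q) / sqrt 2 if Om contains an
   a x b rectangle and q <= 2. A thin convex domain of maximal chord m contains a
   rectangle of height close to m and of width much larger than m. At the end points
   r = 1 and r = +oo the same bounds follow from the perimeter of rectangles, from a
   calibration of the square and from the inradius.

   The remaining domains can be moved, by similarities, into a class of convex sets
   that all contain a fixed disc and lie in a fixed larger one. An ultrafilter limit
   of a minimising sequence in this class agrees with some members of the sequence on
   any given finite grid, hence is squeezed between dilates of these members by factors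
   arbitrarily close to 1, and is a minimiser by scaling and monotonicity. So either Q
   is a minimiser, or the domains of energy below some F(Om0) < F(Q) are in the
   compact class. *)

(** The exponent 2 is where t^(r/2) turns from concave to convex. Passing from a long strip of
    height 1 to the unit square multiplies lambda_r^(1/r) by at most sqrt 2 for r >= 2 and by at
    least sqrt 2 for r <= 2; with q <= 2 <= p this makes F(Q) at most the limit of F on thinner and
    thinner domains.

    The obstacle is collapse: a sequence of thinner and thinner domains has no limit in the class,
    and for a single thin domain only F >= (1 - eta) F(Q) is available. Hence the final case
    distinction. If Q is not a minimiser, some Om0 lies strictly below it; this gap fixes eta, eta
    fixes the thickness k under which domains may be discarded, and k fixes the radius of the disc
    contained in the remaining ones.

    F is a quotient of two decreasing functionals, hence not monotone itself. No semicontinuity is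
    proved: the limit and a member of the sequence are nested up to dilation in both directions, and
    the numerator uses one inclusion, the denominator the other. All comparisons are made in the
    extended reals, so that no energy has to be shown finite or positive beforehand. *)

Notation plane R := (measurableTypeR R * measurableTypeR R)%type.

(** * Open sets and continuous functions for the product sigma-algebra *)

Section measurability.
Context {R : realType}.

(** The product sigma-algebra is generated by rectangles, so an open set is written as the countable
    union of the rational squares that it contains. *)
Lemma open_measurable_plane (A : set (R * R)) : open A -> measurable (A : set (plane R)).
Proof.
move=> oA.
pose box (a : rat) (b : rat) (r : rat) : set (plane R) :=
  (`](ratr a - ratr r), (ratr a + ratr r)[%classic : set R) `*`
  (`](ratr b - ratr r), (ratr b + ratr r)[%classic : set R).
pose F a b r := if `[< box a b r `<=` A >] then box a b r else set0.
have -> : A = \bigcup_a \bigcup_b \bigcup_r F a b r.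
  apply/seteqP; split => [[x y] Axy|[x y] [a _ [b _ [r _]]]]; last first.
    by rewrite /F; case: asboolP => // + Fxy; apply.
  have [e /= e0 exy] := (nbhs_ballP _ _).1 (open_nbhs_nbhs (conj oA Axy)).
  have [r] : exists r : rat, 0 < (ratr r : R) < e / 2.
    have : 0 < e / 2 by rewrite divr_gt0.
    by move=> /rat_in_itvoo[r]; rewrite in_itv/= => ?; exists r.
  move=> /andP[r0 re].
  have [a] : exists a : rat, x - ratr r < ratr a < x + ratr r.
    have : x - ratr r < x + ratr r by lra.
    by move=> /rat_in_itvoo[a]; rewrite in_itv/= => ?; exists a.
  move=> /andP[xa1 xa2].
  have [b] : exists b : rat, y - ratr r < ratr b < y + ratr r.
    have : y - ratr r < y + ratr r by lra.
    by move=> /rat_in_itvoo[b]; rewrite in_itv/= => ?; exists b.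
  move=> /andP[yb1 yb2].
  exists a => //; exists b => //; exists r => //; rewrite /F asboolT.
    by split; rewrite /= in_itv/=; lra.
  move=> [x' y'] [/=]; rewrite !in_itv/= => /andP[? ?] /andP[? ?].
  by apply: exy; split; rewrite /ball/= ltr_norml; lra.
apply: bigcupT_measurable_rat => a; apply: bigcupT_measurable_rat => b.
apply: bigcupT_measurable_rat => r; rewrite /F; case: ifP => // _.
by apply: measurableX; exact: measurable_itv.
Qed.

Lemma continuous_measurable_plane (f : R * R -> R) : continuous f ->
  measurable_fun [set: plane R] (f : plane R -> measurableTypeR R).
Proof.
move=> /continuousP cf; apply: (measurability _ (measurable_realfun.RGenOpens.measurableE R)).
move=> _ [_ [a [b ->] <-]]; rewrite setTI; apply: open_measurable_plane.
exact/cf/interval_open.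
Qed.

End measurability.

(** * Change of variables under similarities *)

Section changevar.
Context {R : realType}.
Local Open Scope ereal_scope.
Local Notation mu := (@lebesgue_measure R).

Lemma measurable_affine (a b : R) :
  measurable_fun [set: measurableTypeR R] ((fun y => a * y + b)%R : measurableTypeR R -> measurableTypeR R).
Proof.
apply: measurable_funD => //; apply: measurable_funM => //.
Qed.

(** The pushforward multiplied by a gives every half-open interval its length, and this determines
    Lebesgue measure. *)
Lemma lebesgue_measure_affine (a b : R) (A : set (measurableTypeR R)) : (0 < a)%R ->
  measurable A ->
  pushforward mu ((fun y => a * y + b)%R : measurableTypeR R -> measurableTypeR R) A = a^-1%:E * mu A.
Proof.
move=> a0 mA.
have a0' : (0 <= a)%R by exact: ltW.
suff H : mu A = mscale (NngNum a0') (pushforward mu ((fun y => a * y + b)%R : measurableTypeR R -> measurableTypeR R)) A.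
  by rewrite (H (measurable_affine a b)) /mscale/= muleA -EFinM mulVf ?gt_eqF// mul1e.
move=> m; apply: lebesgue_measure_unique => //=.
move=> _ [[x y]] _ <-.
rewrite /mscale/= /pushforward.
rewrite (_ : _ @^-1` _ = [set` `](x - b) / a, (y - b) / a]%R])%R; last first.
  apply/seteqP; split => z /=; rewrite !in_itv/= ltr_pdivrMr// ler_pdivlMr//; lra.
rewrite !lebesgue_measure_itv/= !lte_fin ltr_pM2r ?invr_gt0// ltrD2r.
case: ifPn => _; last by rewrite mule0.
by rewrite -!EFinD -EFinM; congr EFin; field; rewrite gt_eqF.
Qed.

Lemma integral_affine (a b : R) (f : measurableTypeR R -> \bar R) : (0 < a)%R ->
  measurable_fun setT f -> (forall x, 0 <= f x) ->
  \int[mu]_y f (a * y + b)%R = a^-1%:E * \int[mu]_y f y.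
Proof.
move=> a0 mf f0.
have mphi := measurable_affine a b.
transitivity (\int[pushforward mu ((fun y => a * y + b)%R : measurableTypeR R -> measurableTypeR R)]_y f y).
  by rewrite ge0_integral_pushforward// preimage_setT.
have ai0 : (0 <= a^-1)%R by rewrite invr_ge0 ltW.
transitivity (\int[mscale (NngNum ai0) mu]_y f y).
  apply: eq_measure_integral => //= A mA _.
  exact: lebesgue_measure_affine.
by rewrite ge0_integral_mscale.
Qed.

(** The change of variables formula for nonnegative functions, as a property stable under
    composition: it then has to be checked on shears only, where it is Tonelli and a one-dimensional
    substitution. *)
Definition scales (T : plane R -> plane R) (k : R) :=
  measurable_fun setT T /\ forall f : plane R -> \bar R,
  measurable_fun setT f -> (forall x, 0 <= f x) ->
  \int[lebesgue2 R]_x f (T x) = k%:E * \int[lebesgue2 R]_x f x.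

Lemma scales_comp T S k l : scales T k -> scales S l -> scales (S \o T) (k * l)%R.
Proof.
move=> [mT hT] [mS hS]; split; first exact: measurableT_comp.
by move=> f mf f0; rewrite (hT (f \o S))//= ?hS ?muleA//; exact: measurableT_comp.
Qed.

Lemma scales_shear_y (a k b : R) : (0 < a)%R ->
  scales (fun x => (x.1, a * x.2 + (k * x.1 + b)))%R a^-1.
Proof.
move=> a0.
have mT : measurable_fun setT
  ((fun x => (x.1, a * x.2 + (k * x.1 + b)))%R : plane R -> plane R).
  apply: measurable_fun_pair => //=.
  by apply: measurable_funD; [apply: measurable_funM|apply: measurable_funD => //; apply: measurable_funM].
split=> // f mf f0.
rewrite fubini_tonelli1//; last exact: measurableT_comp.
rewrite fubini_tonelli1// /fubini_F/=.
rewrite -ge0_integralZl_EFin//; last by rewrite invr_ge0 ltW.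
- apply: eq_integral => x _.
  rewrite (integral_affine (k * x + b) (f := fun y => f (x, y)))//.
  exact: measurable_fun_pair2.
- by move=> x _; exact: integral_ge0.
- exact: measurable_fun_fubini_tonelli_F.
Qed.

Lemma scales_shear_x (a k b : R) : (0 < a)%R ->
  scales (fun x => (a * x.1 + (k * x.2 + b), x.2))%R a^-1.
Proof.
move=> a0.
have mT : measurable_fun setT
  ((fun x => (a * x.1 + (k * x.2 + b), x.2))%R : plane R -> plane R).
  apply: measurable_fun_pair => //=.
  by apply: measurable_funD; [apply: measurable_funM|apply: measurable_funD => //; apply: measurable_funM].
split=> // f mf f0.
rewrite fubini_tonelli2//; last exact: measurableT_comp.
rewrite fubini_tonelli2// /fubini_G/=.
rewrite -ge0_integralZl_EFin//; last by rewrite invr_ge0 ltW.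
- apply: eq_integral => y _.
  rewrite (integral_affine (k * y + b) (f := fun x => f (x, y)))//.
  exact: measurable_fun_pair1.
- by move=> x _; exact: integral_ge0.
- exact: measurable_fun_fubini_tonelli_G.
Qed.

Definition simil (s c d b1 b2 : R) (x : R * R) : R * R :=
  (s * (c * x.1 - d * x.2) + b1, s * (d * x.1 + c * x.2) + b2)%R.

(* A rotation by an angle in [-pi/2, pi/2] is a product of three shears. *)
Lemma scales_simil (s c d b1 b2 : R) : (0 < s)%R -> (0 <= c)%R ->
  (c ^+ 2 + d ^+ 2 = 1)%R -> scales (simil s c d b1 b2) (s ^- 2)%R.
Proof.
move=> s0 c0 cd.
have c1 : (1 + c != 0)%R by rewrite gt_eqF// ltr_wpDr.
(* For c = cos and d = sin of the angle, t is the tangent of the half angle. The dilation and the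
   translation are absorbed in the third shear and in a fourth map. *)
pose t := (d / (1 + c))%R.
have dt : (d * t = 1 - c)%R by apply: (mulIf c1); rewrite /t -mulrA divfK//; nra.
have tc : (t * c = d - t)%R by apply: (mulIf c1); rewrite /t mulrAC divfK// mulrBl divfK//; ring.
have h1 := scales_shear_x (- t) 0 (@ltr01 R).
have h2 := scales_shear_y d 0 (@ltr01 R).
have h3 := scales_shear_x (- t * s) b1 s0.
have h4 := scales_shear_y 0 b2 s0.
have := scales_comp (scales_comp (scales_comp h1 h2) h3) h4.
rewrite invr1 !mul1r -invfM -expr2.
congr scales; apply/funext => -[x y]; rewrite /simil/=; congr pair.
  transitivity (s * (x - 2 * (t * y) - (d * t) * x + t * (d * t) * y) + b1)%R; first by ring.
  rewrite dt; transitivity (s * (c * x - (t + t * c) * y) + b1)%R; first by ring.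
  by rewrite tc; ring.
transitivity (s * (y + d * x - (d * t) * y) + b2)%R; first by ring.
by rewrite dt; ring.
Qed.

End changevar.

(** * Directional derivatives and C^1 functions on the plane *)

Section C1_calculus.
Context {R : realType}.

Lemma continuous_fst2 : continuous (fst : R * R -> R).
Proof. by move=> x; exact: cvg_fst. Qed.

Lemma continuous_snd2 : continuous (snd : R * R -> R).
Proof. by move=> x; exact: cvg_snd. Qed.

Lemma continuous_pair2 (U V W : topologicalType) (f : U -> V) (g : U -> W) :
  continuous f -> continuous g -> continuous (fun x => (f x, g x)).
Proof. by move=> cf cg x; exact: (cvg_pair (cf x) (cg x)). Qed.

Lemma differentiable_fst2 (x : R * R) : differentiable (fst : R * R -> R) x.
Proof. apply: linear_differentiable; exact: continuous_fst2. Qed.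

Lemma differentiable_snd2 (x : R * R) : differentiable (snd : R * R -> R) x.
Proof. apply: linear_differentiable; exact: continuous_snd2. Qed.

Lemma C1_continuous (W : normedModType R) (u : R * R -> W) : C1 u -> continuous u.
Proof. by case=> du _ _ x; exact: differentiable_continuous. Qed.

Lemma derive_coords (W : normedModType R) (u : R * R -> W) x (a b : R) :
  differentiable u x ->
  'D_(a, b) u x = a *: 'D_(1, 0) u x + b *: 'D_(0, 1) u x.
Proof.
move=> du; rewrite !deriveE// -!linearZ -linearD; congr ('d u x _).
by apply: injective_projections => /=; rewrite scaler0 ?addr0 ?add0r; exact: (esym (mulr1 _)).
Qed.

Lemma derive_fst (u : R * R -> R * R) x v : differentiable u x ->
  'D_v (fst \o u) x = ('D_v u x).1.
Proof.
move=> du; rewrite !deriveE//; last first.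
  by apply: differentiable_comp => //; exact: differentiable_fst2.
rewrite diff_comp//; last exact: differentiable_fst2.
by rewrite /= diff_lin//; exact: continuous_fst2.
Qed.

Lemma derive_snd (u : R * R -> R * R) x v : differentiable u x ->
  'D_v (snd \o u) x = ('D_v u x).2.
Proof.
move=> du; rewrite !deriveE//; last first.
  by apply: differentiable_comp => //; exact: differentiable_snd2.
rewrite diff_comp//; last exact: differentiable_snd2.
by rewrite /= diff_lin//; exact: continuous_snd2.
Qed.

Lemma C1_fst (u : R * R -> R * R) : C1 u -> C1 (fst \o u).
Proof.
move=> [du c1 c2]; split.
- by move=> x; apply: differentiable_comp => //; exact: differentiable_fst2.
- rewrite (_ : 'D_(1, 0) (fst \o u) = fst \o ('D_(1, 0) u)); last first.
    by apply/funext => x; rewrite derive_fst.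
  by move=> x; apply: continuous_comp; [exact: c1|exact: continuous_fst2].
- rewrite (_ : 'D_(0, 1) (fst \o u) = fst \o ('D_(0, 1) u)); last first.
    by apply/funext => x; rewrite derive_fst.
  by move=> x; apply: continuous_comp; [exact: c2|exact: continuous_fst2].
Qed.

Lemma C1_snd (u : R * R -> R * R) : C1 u -> C1 (snd \o u).
Proof.
move=> [du c1 c2]; split.
- by move=> x; apply: differentiable_comp => //; exact: differentiable_snd2.
- rewrite (_ : 'D_(1, 0) (snd \o u) = snd \o ('D_(1, 0) u)); last first.
    by apply/funext => x; rewrite derive_snd.
  by move=> x; apply: continuous_comp; [exact: c1|exact: continuous_snd2].
- rewrite (_ : 'D_(0, 1) (snd \o u) = snd \o ('D_(0, 1) u)); last first.
    by apply/funext => x; rewrite derive_snd.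
  by move=> x; apply: continuous_comp; [exact: c2|exact: continuous_snd2].
Qed.

Lemma C1_pair (f g : R * R -> R) : C1 f -> C1 g -> C1 (fun x => (f x, g x)).
Proof.
move=> [df f1 f2] [dg g1 g2].
have dfg x : differentiable (fun y : R * R => (f y, g y)) x.
  exact: differentiable_pair.
have E v : 'D_v (fun y => (f y, g y)) = (fun x => ('D_v f x, 'D_v g x)).
  by apply/funext => x; rewrite !deriveE// diff_pair.
by split=> //; rewrite E; exact: continuous_pair2.
Qed.

Lemma C1_lin (f g : R * R -> R) (a b : R) : C1 f -> C1 g ->
  C1 (fun x => a * f x + b * g x).
Proof.
move=> [df f1 f2] [dg g1 g2].
have E v : 'D_v (fun y => a * f y + b * g y) = (fun x => a * 'D_v f x + b * 'D_v g x).
  apply/funext => x.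
  rewrite [LHS](@deriveD _ _ _ (a *: f) (b *: g)); first last.
  - by apply: derivableZ; exact: diff_derivable.
  - by apply: derivableZ; exact: diff_derivable.
  by rewrite !deriveZ//; exact: diff_derivable.
split.
- move=> x; apply: (@differentiableD _ _ _ (a *: f) (b *: g)); exact: differentiableZ.
- by rewrite E => x; apply: cvgD; (apply: cvgM; [exact: cvg_cst|]); [exact: f1|exact: g1].
- by rewrite E => x; apply: cvgD; (apply: cvgM; [exact: cvg_cst|]); [exact: f2|exact: g2].
Qed.

Lemma derive_supp (W : normedModType R) (u : R * R -> W) x v :
  ~ closure [set x | u x != 0] x -> 'D_v u x = 0.
Proof.
move=> nx; rewrite -(derive_cst (0 : W) x v); apply: near_eq_derive.
have oc : open (~` closure [set x | u x != 0]) by exact/closed_openC/closed_closure.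
have : nbhs x (~` closure [set x | u x != 0]) by exact: open_nbhs_nbhs.
apply: filterS => y /= yu.
by apply/eqP/negPn/negP => uy; apply: yu; exact: (@subset_closure _ _ y).
Qed.

Lemma eq0_supp (W : normedModType R) (u : R * R -> W) x :
  ~ closure [set x | u x != 0] x -> u x = 0.
Proof.
by move=> nx; apply/eqP/negPn/negP => uy; apply: nx; exact: (@subset_closure _ _ x).
Qed.

End C1_calculus.

(** * Similarities of the plane and their action on test functions *)

Section similarity.
Context {R : realType}.
Implicit Types (s c d : R) (T S : R * R -> R * R).

(** The condition [0 <= c] restricts the rotation to angles for which three shears suffice. The
    class is still stable under inverses, and any segment can be laid along the first axis once its
    endpoints are suitably ordered. *)
Definition similarity s T := exists c d b1 b2,
  [/\ 0 < s, 0 <= c, c ^+ 2 + d ^+ 2 = 1 & T = simil s c d b1 b2].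

Lemma similarity_gt0 s T : similarity s T -> 0 < s.
Proof. by case=> [? [? [? [? []]]]]. Qed.

Lemma similarity_inv s T : similarity s T -> exists S,
  [/\ similarity s^-1 S, cancel T S & cancel S T].
Proof.
move=> [c [d [b1 [b2 [s0 c0 cd ->]]]]].
have sn : s != 0 by rewrite gt_eqF.
exists (simil s^-1 c (- d) (- (s^-1 * (c * b1 + d * b2))) (s^-1 * (d * b1 - c * b2))).
split.
- exists c, (- d), (- (s^-1 * (c * b1 + d * b2))), (s^-1 * (d * b1 - c * b2)).
  by split=> //; rewrite ?invr_gt0// sqrrN.
- move=> [x y]; rewrite /simil/=; congr pair.
    transitivity ((c ^+ 2 + d ^+ 2) * x); last by rewrite cd mul1r.
    by field.
  transitivity ((c ^+ 2 + d ^+ 2) * y); last by rewrite cd mul1r.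
  by field.
- move=> [x y]; rewrite /simil/=; congr pair.
    transitivity ((c ^+ 2 + d ^+ 2) * x + (1 - (c ^+ 2 + d ^+ 2)) * b1); last by rewrite cd; ring.
    by field.
  transitivity ((c ^+ 2 + d ^+ 2) * y + (1 - (c ^+ 2 + d ^+ 2)) * b2); last by rewrite cd; ring.
  by field.
Qed.

Lemma continuous_simil s c d b1 b2 : continuous (simil s c d b1 b2 : R * R -> R * R).
Proof.
apply: continuous_pair2 => x; apply: cvgD; try exact: cvg_cst;
  apply: cvgM; try exact: cvg_cst; [apply: cvgB|apply: cvgD];
  (apply: cvgM; first exact: cvg_cst);
  solve [exact: continuous_fst2 | exact: continuous_snd2].
Qed.

Lemma similarity_continuous s T : similarity s T -> continuous T.
Proof. by move=> [c [d [b1 [b2 [_ _ _ ->]]]]]; exact: continuous_simil. Qed.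

Lemma similarity_scales s T : similarity s T -> scales T (s ^- 2).
Proof. by move=> [c [d [b1 [b2 [s0 c0 cd ->]]]]]; exact: scales_simil. Qed.

Lemma enorm_simil s c d b1 b2 (x y : R * R) : 0 < s -> c ^+ 2 + d ^+ 2 = 1 ->
  enorm (simil s c d b1 b2 x - simil s c d b1 b2 y) = s * enorm (x - y).
Proof.
move=> s0 cd; rewrite /enorm -[in RHS](gtr0_norm s0) -sqrtr_sqr -sqrtrM ?sqr_ge0//.
congr Num.sqrt; case: x y => [x1 x2] [y1 y2] /=; rewrite /simil/=.
transitivity (s ^+ 2 * ((c ^+ 2 + d ^+ 2) * ((x1 - y1) ^+ 2 + (x2 - y2) ^+ 2))); last first.
  by rewrite cd mul1r.
by ring.
Qed.

Lemma similarity_enorm s T (x y : R * R) : similarity s T ->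
  enorm (T x - T y) = s * enorm (x - y).
Proof. by move=> [c [d [b1 [b2 [s0 c0 cd ->]]]]]; exact: enorm_simil. Qed.

(** As the similarity is affine, the two difference quotients are the same function of h. *)
Lemma derive_simil s c d b1 b2 (W : normedModType R) (u : R * R -> W) x a b :
  let T := simil s c d b1 b2 in
  'D_(a, b) (u \o T) x = 'D_(s * (c * a - d * b), s * (d * a + c * b)) u (T x).
Proof.
set T := simil _ _ _ _ _; rewrite /=; set v := (s * _, _); rewrite /derive.
rewrite (_ : (fun h : R => h^-1 *: ((u \o T \o shift x) (h *: (a, b)) - (u \o T) x)) =
  (fun h : R => h^-1 *: ((u \o shift (T x)) (h *: v) - u (T x))))//.
apply/funext => h /=; congr (_ *: (u _ - _)).
rewrite /shift/= /T /simil /v; apply: injective_projections => /=.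
  rewrite (_ : h *: _ = h * (s * (c * a - d * b)))// (_ : h *: a = h * a)// (_ : h *: b = h * b)//.
  by ring.
rewrite (_ : h *: _ = h * (s * (d * a + c * b)))// (_ : h *: a = h * a)// (_ : h *: b = h * b)//.
by ring.
Qed.

Lemma derive_simil_coords s c d b1 b2 (W : normedModType R) (u : R * R -> W) x a b :
  let T := simil s c d b1 b2 in differentiable u (T x) ->
  'D_(a, b) (u \o T) x =
    (s * (c * a - d * b)) *: 'D_(1, 0) u (T x) + (s * (d * a + c * b)) *: 'D_(0, 1) u (T x).
Proof. by move=> T du; rewrite derive_simil derive_coords. Qed.

Lemma C1_simil s c d b1 b2 (W : normedModType R) (u : R * R -> W) :
  C1 u -> C1 (u \o simil s c d b1 b2).
Proof.
set T := simil _ _ _ _ _ => -[du u1 u2].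
have dT x : differentiable T x.
  have dl a b e : differentiable (fun x : R * R => s * (a * x.1 + b * x.2) + e) x.
    apply: differentiableD => //.
    apply: differentiableM => //; apply: differentiableD => //;
    apply: differentiableM => //; solve [exact: differentiable_fst2 | exact: differentiable_snd2].
  apply: differentiable_pair; last exact: dl.
  by under eq_fun do rewrite -mulNr; exact: dl.
have cT : continuous T by exact: continuous_simil.
have E v : exists a b, forall x, 'D_v (u \o T) x = a *: 'D_(1, 0) u (T x) + b *: 'D_(0, 1) u (T x).
  case: v => v w; by eexists; eexists => x; rewrite derive_simil_coords.
have c1 : continuous ('D_(1, 0) u \o T).
  by move=> x; apply: continuous_comp; [exact: cT|exact: u1].
have c2 : continuous ('D_(0, 1) u \o T).
  by move=> x; apply: continuous_comp; [exact: cT|exact: u2].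
have cE v : continuous ('D_v (u \o T)).
  have [a [b ab]] := E v; rewrite (funext ab).
  by move=> x; exact: (cvgD (cvgZl_tmp (k := a) (c1 x)) (cvgZl_tmp (k := b) (c2 x))).
by split=> // x; exact: differentiable_comp.
Qed.

Lemma similarity_C1 s T (W : normedModType R) (u : R * R -> W) :
  similarity s T -> C1 u -> C1 (u \o T).
Proof. by move=> [c [d [b1 [b2 [_ _ _ ->]]]]]; exact: C1_simil. Qed.

Lemma similarity_compact s T (K : set (R * R)) : similarity s T -> compact K ->
  compact (T @^-1` K).
Proof.
move=> /similarity_inv[S [/similarity_continuous cS TS ST]] cK.
rewrite (_ : T @^-1` K = S @` K).
  by apply: continuous_compact => //; exact: continuous_subspaceT.
apply/seteqP; split => [x Kx|_ [y Ky <-]]; first by exists (T x).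
by rewrite /= ST.
Qed.

Lemma similarity_closure s T (A : set (R * R)) : similarity s T ->
  closure (T @^-1` A) `<=` T @^-1` (closure A).
Proof.
move=> /similarity_continuous/continuous_closedP cT.
have := cT _ (@closed_closure _ A) => cl.
rewrite [X in _ `<=` X](closure_id _).1//; apply: closure_subset => x.
exact: (@subset_closure _ A (T x)).
Qed.

Lemma similarity_C1c s T (W : normedModType R) (u : R * R -> W) Om :
  similarity s T -> C1c Om u -> C1c (T @^-1` Om) (u \o T).
Proof.
move=> sT [uC1 cu su].
have h : closure [set x | (u \o T) x != 0] `<=` T @^-1` (closure [set x | u x != 0]).
  exact: (similarity_closure sT).
split; first exact: (similarity_C1 sT).
- apply: subclosed_compact h; first exact: closed_closure.
  exact: (similarity_compact sT).
- by apply: (subset_trans h) => x /=; exact: su.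
Qed.

End similarity.

(** * Scaling and monotonicity *)

Section lambda_similarity.
Context {R : realType}.
Implicit Types (s p : R) (T S : R * R -> R * R) (Om : set (R * R)).

Lemma enorm_ge0 (x : R * R) : 0 <= enorm x.
Proof. exact: sqrtr_ge0. Qed.

Lemma enorm0 : enorm (0 : R * R) = 0.
Proof. by rewrite /enorm/= expr0n/= addr0 sqrtr0. Qed.

Lemma sqr_enorm (x : R * R) : enorm x ^+ 2 = x.1 ^+ 2 + x.2 ^+ 2.
Proof. by rewrite sqr_sqrtr// addr_ge0// sqr_ge0. Qed.

Lemma continuous_enorm_pair (U : topologicalType) (f g : U -> R) :
  continuous f -> continuous g -> continuous (fun x => enorm (f x, g x)).
Proof.
move=> cf cg x; rewrite /enorm/=.
apply: (@continuous_comp _ _ _ (fun x => f x ^+ 2 + g x ^+ 2) Num.sqrt).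
  by apply: cvgD; apply: cvgM; solve [exact: cf|exact: cg].
exact: sqrt_continuous.
Qed.

Lemma measurable_powR_comp (f : R * R -> R) p : continuous f ->
  measurable_fun [set: plane R] (fun x : plane R => (f x `^ p)%:E).
Proof.
move=> cf; apply/measurable_EFinP.
apply: (measurableT_comp (f := @powR R ^~ p)); first exact: measurable_powR.
exact: continuous_measurable_plane.
Qed.

Lemma C1_continuous_gradient (u : R * R -> R) : C1 u ->
  continuous (fun x => enorm (gradient u x)).
Proof. by move=> [_ u1 u2]; exact: (continuous_enorm_pair u1 u2). Qed.

Lemma continuous_normr (u : R * R -> R) : continuous u -> continuous (fun x => `|u x|).
Proof. by move=> cu x; apply: cvg_norm; exact: cu. Qed.

Lemma measurable_gradient p (u : R * R -> R) : C1 u ->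
  measurable_fun [set: plane R] (fun x : plane R => (enorm (gradient u x) `^ p)%:E).
Proof. by move=> /C1_continuous_gradient; exact: measurable_powR_comp. Qed.

Lemma measurable_powR_normr p (u : R * R -> R) : continuous u ->
  measurable_fun [set: plane R] (fun x : plane R => (`|u x| `^ p)%:E).
Proof. by move=> /continuous_normr; exact: measurable_powR_comp. Qed.

(** Both integrands vanish off the support, because 0 to the power p is 0 for [p != 0]. From here on
    the domain enters only through the class of test functions, which gives monotonicity and lets
    Fubini work on the whole plane. *)
Lemma rayleigh_setT p Om (u : R * R -> R) : p != 0 -> C1c Om u ->
  rayleigh p Om u = rayleigh p setT u.
Proof.
move=> p0 [_ _ su]; rewrite /rayleigh; congr (_ * inve _)%E;
  rewrite integral_mkcond; apply: eq_integral => x _; rewrite patchE;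
  case: ifPn => // /negP xOm; (have nx : ~ closure [set x | u x != 0] x
    by move=> cx; apply: xOm; rewrite inE; exact: su).
- by rewrite /gradient !derive_supp// enorm0 powR0.
- by rewrite eq0_supp// normr0 powR0.
Qed.

Lemma inve_EFinM (k : R) (x : \bar R) : 0 < k -> ((k%:E * x)^-1 = k^-1%:E * x^-1)%E.
Proof.
move=> k0; case: x => [r| |].
- rewrite -EFinM !inver mulf_eq0 gt_eqF//=; case: ifPn => [_|_].
    by rewrite gt0_muley// lte_fin invr_gt0.
  by rewrite invfM EFinM.
- by rewrite gt0_muley ?lte_fin// !invey mule0.
- by rewrite gt0_muleNy ?lte_fin// !inveNy gt0_muleNy// lte_fin invr_gt0.
Qed.

Lemma scale_mul (a b : R) : a *: (b : R^o) = a * b. Proof. by []. Qed.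

Lemma gradient_simil s c d b1 b2 (u : R * R -> R) x : 0 < s ->
  c ^+ 2 + d ^+ 2 = 1 -> differentiable u (simil s c d b1 b2 x) ->
  enorm (gradient (u \o simil s c d b1 b2) x) =
  s * enorm (gradient u (simil s c d b1 b2 x)).
Proof.
move=> s0 cd du; rewrite /gradient !derive_simil_coords//.
set p := 'D_(1, 0) u _; set q := 'D_(0, 1) u _.
rewrite /enorm -[in RHS](gtr0_norm s0) -sqrtr_sqr -sqrtrM ?sqr_ge0//=.
congr Num.sqrt; rewrite !scale_mul.
transitivity (s ^+ 2 * ((c ^+ 2 + d ^+ 2) * (p ^+ 2 + q ^+ 2))); last first.
  by rewrite cd mul1r.
by ring.
Qed.

Lemma rayleigh_similarity p s T (u : R * R -> R) : similarity s T -> C1 u ->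
  rayleigh p setT (u \o T) = ((s `^ p)%:E * rayleigh p setT u)%E.
Proof.
move=> sT uC1; have [mT hT] := similarity_scales sT; have s0 := similarity_gt0 sT.
have k0 : 0 < s ^- 2 by rewrite invr_gt0 exprn_gt0.
have mu1 := measurable_gradient p uC1.
have mu2 := measurable_powR_normr p (C1_continuous uC1).
have pos1 (x : plane R) : (0 <= (enorm (gradient u x) `^ p)%:E)%E by rewrite lee_fin powR_ge0.
have pos2 (x : plane R) : (0 <= (`|u x| `^ p)%:E)%E by rewrite lee_fin powR_ge0.
have E2 : (\int[lebesgue2 R]_x (`|(u \o T) x| `^ p)%:E =
    (s ^- 2)%:E * \int[lebesgue2 R]_x (`|u x| `^ p)%:E)%E.
  exact: (hT _ mu2 pos2).
have E1 : (\int[lebesgue2 R]_x (enorm (gradient (u \o T) x) `^ p)%:E =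
    (s `^ p)%:E * ((s ^- 2)%:E * \int[lebesgue2 R]_x (enorm (gradient u x) `^ p)%:E))%E.
  rewrite -(hT _ mu1 pos1).
  transitivity (\int[lebesgue2 R]_x ((s `^ p)%:E * (enorm (gradient u (T x)) `^ p)%:E))%E.
    apply: eq_integral => x _; have [du _ _] := uC1.
    move: (sT) => [c [d [b1 [b2 [_ _ cd ->]]]]].
    by rewrite gradient_simil// powRM ?enorm_ge0 ?(ltW s0)// EFinM.
  have mg : measurable_fun setT (fun x : plane R => (enorm (gradient u (T x)) `^ p)%:E).
    exact: (measurableT_comp mu1 mT).
  have Z := @ge0_integralZl_EFin _ _ _ (lebesgue2 R) setT measurableT
    (fun x : plane R => (enorm (gradient u (T x)) `^ p)%:E) (fun x _ => pos1 (T x)) mg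
    (s `^ p) (powR_ge0 _ _).
  exact: Z.
have -> : rayleigh p setT (u \o T) =
    ((s `^ p)%:E * ((s ^- 2)%:E * \int[lebesgue2 R]_x (enorm (gradient u x) `^ p)%:E) *
     ((s ^- 2)%:E * \int[lebesgue2 R]_x (`|u x| `^ p)%:E)^-1)%E.
  by congr (_ * inve _)%E; [exact: E1|exact: E2].
rewrite /rayleigh.
set A := (\int[_]_x _)%E; set B := (\int[_]_x _)%E.
rewrite inve_EFinM// -(muleA (s `^ p)%:E); congr (_ * _)%E.
by rewrite muleACA -EFinM mulfV ?mul1e ?gt_eqF.
Qed.

Lemma rayleigh_ge0 p Om (u : R * R -> R) : (0 <= rayleigh p Om u)%E.
Proof.
rewrite /rayleigh mule_ge0 ?inve_ge0 ?integral_ge0// => x _;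
  by rewrite lee_fin powR_ge0.
Qed.

Lemma lambda_ge0 p Om : (0 <= lambda p Om)%E.
Proof. by apply: le_ereal_inf_tmp => _ [u _ <-]; exact: rayleigh_ge0. Qed.

(** One inequality is enough: [lambda_root_similarity] obtains the other one from the inverse
    similarity. *)
Lemma lambda_similarity p s T Om : p != 0 -> similarity s T ->
  (lambda p (T @^-1` Om) <= (s `^ p)%:E * lambda p Om)%E.
Proof.
move=> p0 sT; have s0 := similarity_gt0 sT.
have sp0 : 0 < s `^ p by rewrite powR_gt0.
rewrite -lee_pdivrMl//; apply: le_ereal_inf_tmp => _ [u [uC [x ux]] <-].
rewrite lee_pdivrMl// (rayleigh_setT p0 uC) -(rayleigh_similarity _ sT); last by case: uC.
have uT := similarity_C1c sT uC.
rewrite -(rayleigh_setT p0 uT); apply: ereal_inf_lbound; exists (u \o T) => //.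
split=> //; have [S [_ _ ST]] := similarity_inv sT.
by exists (S x); rewrite /= ST.
Qed.

Lemma lambda_anti p Om1 Om2 : p != 0 -> Om1 `<=` Om2 ->
  (lambda p Om2 <= lambda p Om1)%E.
Proof.
move=> p0 O12; apply: le_ereal_inf_tmp => _ [u [uC [x ux]] <-].
have uC2 : C1c Om2 u by case: uC => ? ? su; split=> //; exact: subset_trans O12.
rewrite (rayleigh_setT p0 uC) -(rayleigh_setT p0 uC2).
by apply: ereal_inf_lbound; exists u => //; split=> //; exists x.
Qed.

Lemma inradius_similarity s T Om : similarity s T ->
  (inradius Om <= s%:E * inradius (T @^-1` Om))%E.
Proof.
move=> sT; have s0 := similarity_gt0 sT.
apply: ge_ereal_sup => _ [r [r0 [x xOm]] <-].
rewrite -lee_pdivrMl// -EFinM; apply: ereal_sup_ubound.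
exists (s^-1 * r) => //; split; first by rewrite mulr_gt0// invr_gt0.
have [S [sS TS ST]] := similarity_inv sT.
exists (S x) => y; rewrite /eball/= => h; apply: xOm.
by rewrite /eball/= -{1}(ST x) (similarity_enorm _ _ sT) mulrC -ltr_pdivlMr// mulrC.
Qed.

Lemma inradius_mono Om1 Om2 : Om1 `<=` Om2 -> (inradius Om1 <= inradius Om2)%E.
Proof.
move=> O12; apply: ge_ereal_sup => _ [r [r0 [x xOm]] <-].
apply: ereal_sup_ubound; exists r => //; split=> //; exists x.
exact: subset_trans O12.
Qed.

Lemma cheeger_anti Om1 Om2 : Om1 `<=` Om2 -> (cheeger Om2 <= cheeger Om1)%E.
Proof.
move=> O12; apply: le_ereal_inf_tmp => _ [E [mE cE sE E0] <-].
apply: ereal_inf_lbound; exists E => //; split=> //; exact: subset_trans O12.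
Qed.

Lemma perimeter_ge0 (E : set (R * R)) : (0 <= perimeter E)%E.
Proof.
have E0 v : 'D_v (cst (0 : R * R) : R * R -> R * R) = cst 0.
  by apply/funext => x; rewrite derive_cst.
apply: ereal_sup_ubound; exists (cst 0).
  split; last by move=> x; rewrite enorm0 ler01.
  split=> //.
  - by split=> [x||]//; rewrite E0 => x; exact: cvg_cst.
  - rewrite (_ : [set x | _] = set0) ?closure0; first exact: compact0.
    by apply/seteqP; split => // x /=; rewrite eqxx.
transitivity (\int[lebesgue2 R]_(x in E) 0 : \bar R)%E; last by rewrite integral0.
apply: eq_integral => x _; rewrite /divergence.
by rewrite (_ : fst \o _ = cst 0)// (_ : snd \o _ = cst 0)// !derive_cst addr0.
Qed.

(** The divergence has no sign, so the positive and negative parts are transported separately. When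
    both have infinite integral, both sides equal -oo by the convention on differences. *)
Lemma integral_scales (T : plane R -> plane R) k (f : plane R -> R) : scales T k -> 0 < k ->
  measurable_fun setT f ->
  (\int[lebesgue2 R]_x (f (T x))%:E = k%:E * \int[lebesgue2 R]_x (f x)%:E)%E.
Proof.
move=> [mT hT] k0 mf.
rewrite integralE [in RHS]integralE.
have mf' : measurable_fun setT (EFin \o f) by exact/measurable_EFinP.
have := hT _ (measurable_funepos mf') (fun x => funepos_ge0 _ x).
have := hT _ (measurable_funeneg mf') (fun x => funeneg_ge0 _ x).
rewrite [X in (X = _ -> _)](_ : _ = \int[lebesgue2 R]_x ((EFin \o (f \o T))^\- x))%E; last first.
  by apply: eq_integral => x _; rewrite !funenegE.
move=> ->.
rewrite [X in (X = _ -> _)](_ : _ = \int[lebesgue2 R]_x ((EFin \o (f \o T))^\+ x))%E; last first.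
  by apply: eq_integral => x _; rewrite !funeposE.
move=> ->.
set A := (\int[_]_x _)%E; set B := (\int[_]_x _)%E.
have : (0 <= A)%E by apply: integral_ge0 => x _; exact: funepos_ge0.
have : (0 <= B)%E by apply: integral_ge0 => x _; exact: funeneg_ge0.
have k0' : (0 < k%:E)%E by rewrite lte_fin.
case: A => [a| |]; case: B => [b| |]// _ _.
- by rewrite /= -?EFinB -?EFinM -?EFinN -?EFinD -?EFinM; congr EFin; ring.
- by rewrite gt0_muley//= gt0_muleNy.
- by rewrite gt0_muley//= gt0_muley.
- by rewrite gt0_muley//= gt0_muleNy.
Qed.

End lambda_similarity.

(** * Perimeter and Cheeger constant under similarities *)

Section perimeter_similarity.
Context {R : realType}.
Implicit Types (s p : R) (T S : R * R -> R * R) (Om E : set (R * R)).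

Lemma C1_divergence (phi : R * R -> R * R) : C1 phi -> continuous (divergence phi).
Proof.
move=> C; have [_ c1 _] := C1_fst C; have [_ _ c2] := C1_snd C.
by move=> x; apply: cvgD; [exact: c1|exact: c2].
Qed.

Lemma integral_pmul k (f : plane R -> R) : 0 < k -> measurable_fun setT f ->
  (\int[lebesgue2 R]_x (k * f x)%:E = k%:E * \int[lebesgue2 R]_x (f x)%:E)%E.
Proof.
move=> k0 mf; rewrite integralE [in RHS]integralE.
have mf' : measurable_fun setT (EFin \o f) by exact/measurable_EFinP.
have mp := measurable_funepos mf'.
have mn := measurable_funeneg mf'.
have Zp := @ge0_integralZl_EFin _ _ _ (lebesgue2 R) setT measurableT _
  (fun x _ => funepos_ge0 (EFin \o f) x) mp k (ltW k0).
have Zn := @ge0_integralZl_EFin _ _ _ (lebesgue2 R) setT measurableT _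
  (fun x _ => funeneg_ge0 (EFin \o f) x) mn k (ltW k0).
have Ep : (\int[lebesgue2 R]_x ((fun x => (k * f x)%:E)^\+ x) =
    \int[lebesgue2 R]_x (k%:E * (EFin \o f)^\+ x))%E.
  apply: eq_integral => x _; rewrite !funeposE/= -!EFin_max -EFinM.
  by congr EFin; rewrite maxr_pMr ?(ltW k0)// mulr0.
have En : (\int[lebesgue2 R]_x ((fun x => (k * f x)%:E)^\- x) =
    \int[lebesgue2 R]_x (k%:E * (EFin \o f)^\- x))%E.
  apply: eq_integral => x _; rewrite !funenegE/= -?EFinN -!EFin_max -EFinM.
  by congr EFin; rewrite maxr_pMr ?(ltW k0)// mulr0 mulrN.
rewrite Ep En Zp Zn.
set A := (\int[_]_x _)%E; set B := (\int[_]_x _)%E.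
have : (0 <= A)%E by apply: integral_ge0 => x _; exact: funepos_ge0.
have : (0 <= B)%E by apply: integral_ge0 => x _; exact: funeneg_ge0.
have k0' : (0 < k%:E)%E by rewrite lte_fin.
case: A => [a| |]; case: B => [b| |]// _ _.
- by rewrite /= -?EFinB -?EFinM -?EFinN -?EFinD -?EFinM; congr EFin; ring.
- by rewrite gt0_muley//= gt0_muleNy.
- by rewrite gt0_muley//= gt0_muley.
- by rewrite gt0_muley//= gt0_muleNy.
Qed.

Lemma perimeter_similarity s T E : similarity s T ->
  measurable (E : set (plane R)) ->
  (perimeter E <= s%:E * perimeter (T @^-1` E))%E.
Proof.
move=> sT mE; have s0 := similarity_gt0 sT; have scT := similarity_scales sT.
apply: ge_ereal_sup => _ [phi [phiC phi1] <-].
have [c [d [b1 [b2 [_ _ cd defT]]]]] := sT.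
have [phiC1 cphi _] := phiC.
(* The field [phi \o T] turned back by the inverse rotation: its Euclidean norm is unchanged and its
   divergence is s times that of phi. *)
pose psi (y : R * R) : R * R :=
  (c * (phi (T y)).1 + d * (phi (T y)).2, (- d) * (phi (T y)).1 + c * (phi (T y)).2).
have p1 := C1_fst phiC1; have p2 := C1_snd phiC1.
have p1T := similarity_C1 sT p1; have p2T := similarity_C1 sT p2.
have psiC1 : C1 psi by exact: (C1_pair (C1_lin c d p1T p2T) (C1_lin (- d) c p1T p2T)).
have div_psi y : divergence psi y = s * divergence phi (T y).
  rewrite /divergence.
  rewrite (_ : fst \o psi = c *: (fst \o phi \o T) + d *: (snd \o phi \o T))//.
  rewrite (_ : snd \o psi = (- d) *: (fst \o phi \o T) + c *: (snd \o phi \o T))//.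
  have [d1 _ _] := p1T; have [d2 _ _] := p2T.
  have [e1 _ _] := p1; have [e2 _ _] := p2.
  rewrite !deriveD; try by apply: derivableZ; exact: diff_derivable.
  rewrite !deriveZ; try exact: diff_derivable.
  rewrite defT !derive_simil_coords -?defT; try exact: e1; try exact: e2.
  rewrite !scale_mul.
  set A := 'D_(1, 0) (fst \o phi) _; set B := 'D_(0, 1) (fst \o phi) _.
  set A' := 'D_(1, 0) (snd \o phi) _; set B' := 'D_(0, 1) (snd \o phi) _.
  transitivity (s * ((c ^+ 2 + d ^+ 2) * (A + B'))); last by rewrite cd mul1r.
  by ring.
have -> : (\int[lebesgue2 R]_(x in E) (divergence phi x)%:E =
    s%:E * \int[lebesgue2 R]_(y in T @^-1` E) (divergence psi y)%:E)%E.
  pose f (x : plane R) : R := divergence phi x * \1_E x.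
  have mf : measurable_fun setT f.
    apply: measurable_funM; last exact: measurable_indic.
    by apply: continuous_measurable_plane; exact: C1_divergence.
  have k0 : 0 < s ^- 2 by rewrite invr_gt0 exprn_gt0.
  rewrite [LHS]integral_mkcond [in RHS]integral_mkcond.
  transitivity (\int[lebesgue2 R]_x (f x)%:E)%E.
    apply: eq_integral => x _; rewrite patchE /f indicE.
    by case: ifPn => _; rewrite ?mulr1 ?mulr0.
  have := integral_scales scT k0 mf => sf.
  rewrite [X in (s%:E * X)%E](_ : _ = \int[lebesgue2 R]_x (s * f (T x))%:E)%E; last first.
    apply: eq_integral => x _; rewrite patchE /f indicE.
    rewrite (_ : (x \in T @^-1` E) = (T x \in E)); last by apply/idP/idP; rewrite !inE.
    by case: ifPn => _; rewrite ?mulr1 ?mulr0// div_psi.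
  have mfT : measurable_fun setT (f \o T).
    by have [mT _] := scT; exact: measurableT_comp.
  have ms : measurable_fun setT (fun x : plane R => s * f x) by exact: measurable_funM.
  rewrite (integral_scales scT k0 ms).
  rewrite (integral_pmul s0 mf) !muleA -!EFinM.
  by rewrite (_ : s * s ^- 2 * s = 1) ?mul1e//; field; rewrite gt_eqF.
rewrite lee_pmul2l//; apply: ereal_sup_ubound; exists psi => //; split.
- split=> //.
  apply: (@subclosed_compact _ _ (T @^-1` closure [set x | phi x != 0])).
  + exact: closed_closure.
  + exact: (similarity_compact sT).
  + apply: (subset_trans _ (similarity_closure sT)).
    apply: closure_subset => y /=; apply: contraNN => /eqP phi0.
    by rewrite /psi phi0/= !mulr0 !addr0.
- move=> y; rewrite (_ : enorm (psi y) = enorm (phi (T y)))//.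
  rewrite /enorm; congr Num.sqrt; rewrite /psi/=.
  set a := (phi _).1; set b := (phi _).2.
  transitivity ((c ^+ 2 + d ^+ 2) * (a ^+ 2 + b ^+ 2)); last by rewrite cd mul1r.
  by ring.
Qed.

Lemma measure_similarity s T E : similarity s T -> measurable (E : set (plane R)) ->
  (lebesgue2 R (T @^-1` E) = (s ^- 2)%:E * lebesgue2 R E)%E.
Proof.
move=> sT mE; have [mT hT] := similarity_scales sT.
have mTE : measurable (T @^-1` E : set (plane R)) by rewrite -[X in measurable X]setTI; exact: mT.
have I A : measurable (A : set (plane R)) ->
    lebesgue2 R A = (\int[lebesgue2 R]_x (\1_A x)%:E)%E.
  by move=> mA; rewrite integral_indic// setIT.
rewrite (I _ mTE) (I _ mE) -(hT (fun x => (\1_E x)%:E)).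
- by apply: eq_integral => x _.
- by apply/measurable_EFinP; exact: measurable_indic.
- by move=> x; rewrite lee_fin.
Qed.

Lemma cheeger_ge0 Om : (0 <= cheeger Om)%E.
Proof.
apply: le_ereal_inf_tmp => _ [E _ <-].
by rewrite mule_ge0 ?perimeter_ge0// inve_ge0.
Qed.

Lemma cheeger_similarity s T Om : similarity s T ->
  (cheeger (T @^-1` Om) <= s%:E * cheeger Om)%E.
Proof.
move=> sT; have s0 := similarity_gt0 sT.
have [S [sS TS ST]] := similarity_inv sT.
rewrite -lee_pdivrMl//; apply: le_ereal_inf_tmp => _ [E [mE cE sE E0] <-].
rewrite lee_pdivrMl//.
have mTE : measurable (T @^-1` E : set (plane R)).
  by have [mT _] := similarity_scales sT; rewrite -[X in measurable X]setTI; exact: mT.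
have lE := measure_similarity sT mE.
have clE := similarity_closure (A := E) sT.
apply: (@le_trans _ _ (perimeter (T @^-1` E) / lebesgue2 R (T @^-1` E))%E).
  apply: ereal_inf_lbound; exists (T @^-1` E) => //; split => //.
  - apply: subclosed_compact clE; first exact: closed_closure.
    exact: (similarity_compact sT).
  - by apply: (subset_trans clE) => x /=; exact: sE.
  - by rewrite lE mule_gt0// lte_fin invr_gt0 exprn_gt0.
(* An upper bound for the perimeter of the preimage under T is the perimeter inequality of the
   inverse similarity S. *)
have pE := perimeter_similarity sS mTE.
rewrite (_ : S @^-1` _ = E) in pE; last first.
  by apply/seteqP; split => x /=; rewrite ST.
rewrite lE inve_EFinM ?invr_gt0 ?exprn_gt0// invrK muleCA.
apply: (@le_trans _ _ ((s ^+ 2)%:E * ((s^-1%:E * perimeter E) * (lebesgue2 R E)^-1))%E).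
  rewrite lee_pmul2l ?lte_fin ?exprn_gt0//.
  by rewrite lee_wpmul2r// inve_ge0 measure_ge0.
rewrite !muleA -EFinM.
by rewrite (_ : s ^+ 2 * s^-1 = s)//; field; rewrite gt_eqF.
Qed.

(** The supremum of the empty set is -oo, so a ball contained in Om has to be exhibited. *)
Lemma inradius_ge0 Om : open Om -> Om !=set0 -> (0 <= inradius Om)%E.
Proof.
move=> oO [x Ox].
have [e /= e0 ex] := (nbhs_ballP _ _).1 (open_nbhs_nbhs (conj oO Ox)).
apply: (@le_trans _ _ e%:E); first by rewrite lee_fin ltW.
apply: ereal_sup_ubound; exists e => //; split => //; exists x => y ey.
apply: ex; rewrite /eball/= in ey.
have h (a : R) : a ^+ 2 <= (y - x).1 ^+ 2 + (y - x).2 ^+ 2 -> `|a| < e.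
  move=> ha; apply: le_lt_trans ey.
  by rewrite -sqrtr_sqr ler_wsqrtr.
by split; rewrite /ball/= distrC; apply: h; rewrite ?lerDl ?lerDr sqr_ge0.
Qed.

End perimeter_similarity.

(** * Scaling and monotonicity for all exponents, invariance of F *)

Section lambda_root.
Context {R : realType}.
Implicit Types (s : R) (T S : R * R -> R * R) (Om E : set (R * R)) (r p q : \bar R).

Lemma lambda_root_fin (r : R) Om : lambda_root r%:E Om =
  if r == 1 then cheeger Om else (lambda r Om `^ r^-1)%E.
Proof. by []. Qed.

Lemma lambda_root_pinfty Om : lambda_root +oo%E Om = ((inradius Om)^-1)%E.
Proof. by []. Qed.

Lemma lambda_root_ge0 r Om : open Om -> Om !=set0 -> (0 <= lambda_root r Om)%E.
Proof.
move=> oO O0; case: r => [r| |]; rewrite ?lambda_root_fin ?lambda_root_pinfty//.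
  by case: (r == 1); [exact: cheeger_ge0|exact: poweR_ge0].
by rewrite inve_ge0 inradius_ge0.
Qed.

Lemma le_poweR (r : R) (x y : \bar R) : 0 <= r -> (0 <= x)%E -> (x <= y)%E ->
  (x `^ r <= y `^ r)%E.
Proof.
move=> r0 x0 xy; apply: gt0_ler_poweR => //; rewrite in_itv/= leey andbT//.
exact: le_trans xy.
Qed.

Lemma lambda_root_anti r Om1 Om2 : (1 <= r)%E -> open Om1 -> Om1 !=set0 ->
  Om1 `<=` Om2 -> (lambda_root r Om2 <= lambda_root r Om1)%E.
Proof.
move=> r1 oO O0 O12; case: r r1 => [r| |]; rewrite ?lambda_root_fin ?lambda_root_pinfty; last by [].
- rewrite lee_fin => r1; case: (r == 1); first exact: cheeger_anti.
  have r0 : 0 < r by rewrite (lt_le_trans ltr01).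
  apply: le_poweR; [by rewrite invr_ge0 ltW|exact: lambda_ge0|].
  by apply: lambda_anti => //; rewrite gt_eqF.
- move=> _; have i0 := inradius_ge0 oO O0; have i12 := inradius_mono O12.
  by rewrite lee_pV2// inE //; exact: le_trans i12.
Qed.

Lemma preimage_similarity s T Om : similarity s T -> exists S,
  similarity s^-1 S /\ S @^-1` (T @^-1` Om) = Om.
Proof.
move=> /similarity_inv[S [sS TS ST]]; exists S; split=> //.
by apply/seteqP; split => x /=; rewrite ST.
Qed.

Lemma lambda_root_similarity r s T Om : (1 <= r)%E -> similarity s T ->
  lambda_root r (T @^-1` Om) = (s%:E * lambda_root r Om)%E.
Proof.
move=> r1 sT; have s0 := similarity_gt0 sT.
have [S [sS SO]] := preimage_similarity Om sT.
case: r r1 => [r| |]; rewrite ?lambda_root_fin ?lambda_root_pinfty; last by [].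
- rewrite lee_fin => r1; have r0 : 0 < r by rewrite (lt_le_trans ltr01).
  have rn : r != 0 by rewrite gt_eqF.
  case: (r == 1).
    apply/eqP; rewrite eq_le cheeger_similarity//= -{1}SO.
    by rewrite -lee_pdivlMl// cheeger_similarity.
  transitivity (((s `^ r)%:E * lambda r Om) `^ r^-1)%E; last first.
    rewrite poweRM ?lambda_ge0 ?lee_fin ?powR_ge0//.
    by rewrite poweR_EFin -powRrM mulfV// powRr1// ltW.
  congr poweR; apply/eqP; rewrite eq_le lambda_similarity//= -{1}SO.
  rewrite -lee_pdivlMl ?powR_gt0//.
  rewrite (_ : (s `^ r)^-1 = s^-1 `^ r); first exact: lambda_similarity.
  by rewrite -(powR_inv1 (powR_ge0 s r)) -powRrM mulrC powRrM powR_inv1 ?(ltW s0).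
- move=> _; rewrite -[in RHS](invrK s) -inve_EFinM ?invr_gt0//; congr inve.
  have := inradius_similarity (T @^-1` Om) sS; rewrite SO => i1.
  apply/eqP; rewrite eq_le i1/= lee_pdivrMl//.
  exact: inradius_similarity.
Qed.

Lemma Fpq_similarity p q s T Om : (1 <= p)%E -> (1 <= q)%E -> similarity s T ->
  Fpq p q (T @^-1` Om) = Fpq p q Om.
Proof.
move=> p1 q1 sT; have s0 := similarity_gt0 sT.
rewrite /Fpq !(lambda_root_similarity _ _ sT)// inve_EFinM//.
by rewrite muleACA -EFinM mulfV ?gt_eqF// mul1e.
Qed.

Lemma Fpq_ge0 p q Om : open Om -> Om !=set0 -> (0 <= Fpq p q Om)%E.
Proof. by move=> oO O0; rewrite mule_ge0 ?inve_ge0 ?lambda_root_ge0. Qed.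

Lemma Fpq_compare p q Om Om' (c1 c2 : R) : 0 < c1 -> 0 < c2 ->
  open Om -> Om !=set0 -> open Om' -> Om' !=set0 ->
  (c1%:E * lambda_root p Om' <= lambda_root p Om)%E ->
  (lambda_root q Om <= c2%:E * lambda_root q Om')%E ->
  ((c1 / c2)%:E * Fpq p q Om' <= Fpq p q Om)%E.
Proof.
move=> c10 c20 oO O0 oO' O0' h1 h2; rewrite /Fpq.
have a0 := lambda_root_ge0 p oO O0; have a0' := lambda_root_ge0 p oO' O0'.
have b0 := lambda_root_ge0 q oO O0; have b0' := lambda_root_ge0 q oO' O0'.
rewrite EFinM muleACA -inve_EFinM//.
apply: (@le_trans _ _ (lambda_root p Om * (c2%:E * lambda_root q Om')^-1)%E).
  by rewrite lee_wpmul2r// inve_ge0 mule_ge0// lee_fin ltW.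
by rewrite lee_wpmul2l// lee_pV2// inE// mule_ge0// lee_fin ltW.
Qed.

End lambda_root.

(** * One-dimensional Poincare constants *)

Section powers.
Context {R : realType}.
Implicit Types (a b r p : R).

Lemma powRD_le_convex r a b : 1 <= r -> 0 <= a -> 0 <= b ->
  (a + b) `^ r <= 2 `^ (r - 1) * (a `^ r + b `^ r).
Proof.
move=> r1 a0 b0.
have h20 : (0 : R) <= 2^-1 by lra.
have h21 : (2^-1 : R) <= 1 by lra.
have := @convex_powR R r r1 (Itv01 h20 h21) a b.
rewrite !inE/= !in_itv/= !andbT => /(_ a0 b0).
move=> h'.
have e2 : 1 - 2^-1 = 2^-1 :> R by lra.
have h : (2^-1 * a + (1 - 2^-1) * b) `^ r <= 2^-1 * a `^ r + (1 - 2^-1) * b `^ r := h'.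
rewrite e2 in h.
have r0 : 0 < r by lra.
have -> : (a + b) `^ r = 2 `^ r * (2^-1 * a + 2^-1 * b) `^ r.
  rewrite -powRM//; last by rewrite addr_ge0// mulr_ge0.
  by congr powR; field.
have -> : 2 `^ (r - 1) = 2 `^ r * 2^-1 :> R.
  by rewrite powRD ?powR_inv1//; apply/implyP => _; rewrite pnatr_eq0.
rewrite -mulrA ler_pM2l ?powR_gt0//.
by rewrite mulrDr.
Qed.

(** The convex inequality for the exponent 1/r, applied to a^r and b^r and raised to the power r. *)
Lemma powRD_ge_concave r a b : 0 < r <= 1 -> 0 <= a -> 0 <= b ->
  2 `^ (r - 1) * (a `^ r + b `^ r) <= (a + b) `^ r.
Proof.
move=> /andP[r0 r1] a0 b0.
have ri1 : 1 <= r^-1 by rewrite invf_ge1.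
have := powRD_le_convex ri1 (powR_ge0 a r) (powR_ge0 b r).
rewrite -!powRrM mulfV ?gt_eqF// !powRr1// => h.
have h' := ge0_ler_powR (ltW r0) _ _ h.
move: h'; rewrite !nnegrE powR_ge0 => /(_ isT).
rewrite mulr_ge0 ?powR_ge0 ?addr_ge0// => /(_ isT).
rewrite powRM ?powR_ge0 ?addr_ge0// -!powRrM mulVf ?gt_eqF// powRr1 ?addr_ge0 ?powR_ge0//.
rewrite mulrBl mulVf ?gt_eqF// mul1r => h1.
have -> : 2 `^ (r - 1) = (2 `^ (1 - r))^-1 :> R.
  by rewrite -powRN opprB.
by rewrite ler_pdivrMl ?powR_gt0.
Qed.

(** The fractions a/(a+b) and b/(a+b) lie in [0, 1], so neither exceeds its r-th power, and they add
    up to 1. *)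
Lemma powRD_le_subadditive r a b : 0 < r <= 1 -> 0 <= a -> 0 <= b ->
  (a + b) `^ r <= a `^ r + b `^ r.
Proof.
move=> /andP[r0 r1] a0 b0.
have [ab0|ab0] := eqVneq (a + b) 0.
  by rewrite ab0 powR0 ?gt_eqF// addr_ge0 ?powR_ge0.
have ab : 0 < a + b by rewrite lt_neqAle eq_sym ab0 addr_ge0.
have h c : 0 <= c -> c <= a + b -> c / (a + b) * (a + b) `^ r <= c `^ r.
  move=> c0 cab.
  have [->|cn] := eqVneq c 0; first by rewrite !mul0r powR_ge0.
  have cp : 0 < c by rewrite lt_neqAle eq_sym cn.
  have -> : c `^ r = (c / (a + b)) `^ r * (a + b) `^ r.
    have q0 : 0 <= c / (a + b) by rewrite divr_ge0// ltW.
    by rewrite -(powRM r q0 (ltW ab)) divfK.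
  rewrite ler_pM2r ?powR_gt0//; apply: ger1_powR => //.
  by rewrite divr_gt0//= ler_pdivrMr// mul1r.
have ha := h a a0 ltac:(lra); have hb := h b b0 ltac:(lra).
have -> : (a + b) `^ r = a / (a + b) * (a + b) `^ r + b / (a + b) * (a + b) `^ r.
  by rewrite -mulrDl -mulrDl mulfV// mul1r.
exact: lerD.
Qed.

Lemma enorm_powR p a b : enorm (a, b) `^ p = (a ^+ 2 + b ^+ 2) `^ (p / 2).
Proof.
rewrite /enorm/= -powR12_sqrt ?addr_ge0 ?sqr_ge0// -powRrM; congr powR.
by rewrite mulrC.
Qed.

Lemma normr_powR p a : `|a| `^ p = (a ^+ 2) `^ (p / 2).
Proof.
have := enorm_powR p a 0; rewrite expr0n/= addr0 => <-.
by rewrite /enorm/= expr0n/= addr0 sqrtr_sqr.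
Qed.

Lemma enorm_powR_ge2 p a b : 2 <= p ->
  enorm (a, b) `^ p <= 2 `^ (p / 2 - 1) * (`|a| `^ p + `|b| `^ p).
Proof.
move=> p2; rewrite enorm_powR !normr_powR; apply: powRD_le_convex; rewrite ?sqr_ge0//.
by rewrite ler_pdivlMr// mul1r.
Qed.

Lemma enorm_powR_le2 p a b : 0 < p <= 2 ->
  enorm (a, b) `^ p <= `|a| `^ p + `|b| `^ p.
Proof.
move=> p2; rewrite enorm_powR !normr_powR; apply: powRD_le_subadditive; rewrite ?sqr_ge0//.
by lra.
Qed.

Lemma enorm_powR_le2_ge p a b : 0 < p <= 2 ->
  2 `^ (p / 2 - 1) * (`|a| `^ p + `|b| `^ p) <= enorm (a, b) `^ p.
Proof.
move=> p2; rewrite enorm_powR !normr_powR; apply: powRD_ge_concave; rewrite ?sqr_ge0//.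
by lra.
Qed.

Lemma enorm_powR_ge_snd p a b : 0 <= p -> `|b| `^ p <= enorm (a, b) `^ p.
Proof.
move=> p0; apply: ge0_ler_powR; rewrite ?nnegrE ?normr_ge0 ?enorm_ge0//.
by rewrite -sqrtr_sqr ler_wsqrtr//= lerDr sqr_ge0.
Qed.

End powers.

(** * Poincare constants and restriction to lines *)

Section slices.
Context {R : realType}.
Implicit Types (p c : R) (Om : set (R * R)) (u : R * R -> R).
Local Notation mu := (@lebesgue_measure R).

(** Best constants and extremal functions are never computed: a constant c is extracted from one
    domain and inserted into another. Intervals of length less than 1 in arbitrary position are what
    chords of a domain provide. *)
Definition poincare p c := forall v : R -> R,
  (forall t, derivable v t 1) -> continuous (derive1 v) ->
  forall a b, b - a < 1 -> (forall t, v t != 0 -> a <= t <= b) ->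
  (c%:E * \int[mu]_t (`|v t| `^ p)%:E <= \int[mu]_t (`|derive1 v t| `^ p)%:E)%E.

Lemma compact_segment (K : set R) : compact K -> K !=set0 ->
  exists a b, [/\ K a, K b & forall t, K t -> a <= t <= b].
Proof.
move=> cK K0.
have [b] := @compact_EVT_max _ R id K K0 cK (@continuous_subspaceT _ _ _ _ (fun x => cvg_id)).
rewrite inE => Kb hb.
have cN : {within K, continuous (-%R : R -> R)}.
  by apply: continuous_subspaceT => x; exact: opp_continuous.
have [a] := compact_EVT_max K0 cK cN; rewrite inE => Ka ha.
exists a, b; split=> // t Kt; apply/andP; split.
  by rewrite -lerN2; apply: ha; rewrite inE.
by apply: hb; rewrite inE.
Qed.

Lemma slice_derive (W : normedModType R) (f : R * R -> W) (z w : R * R) (t : R) :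
  differentiable f (t *: w + z) ->
  derivable (fun t : R => f (t *: w + z)) t 1 /\
  derive1 (fun t : R => f (t *: w + z)) t = 'D_w f (t *: w + z).
Proof.
move=> df.
have E : (fun h : R => h^-1 *: (((fun t : R => f (t *: w + z)) \o shift t) (h *: 1) - f (t *: w + z)))
  = (fun h : R => h^-1 *: ((f \o shift (t *: w + z)) (h *: w) - f (t *: w + z))).
  apply/funext => h /=; congr (_ *: (f _ - _)).
  by rewrite scalerDl addrA; congr (_ *: _ + _ + _); exact: mulr1.
have := @diff_derivable _ _ _ f (t *: w + z) w df.
by rewrite derive1E /derivable /derive E.
Qed.

(** The restriction of u to the line e is a C^1 function of one variable. The continuous left
    inverse [pr] of e makes the trace of the support compact, hence contained in the segment between
    two of its own points; both lie in Om, so the chord hypothesis makes this segment shorter than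
    1. *)
Lemma slice_poincare p c Om u (z w : R * R) (e : R -> R * R) (pr : R * R -> R) :
  poincare p c -> p != 0 -> C1c Om u -> continuous ('D_w u) ->
  (forall t, e t = t *: w + z) -> continuous pr -> (forall t, pr (e t) = t) ->
  (forall t t', Om (e t) -> Om (e t') -> `|t - t'| < 1) ->
  (c%:E * \int[mu]_t (`|u (e t)| `^ p)%:E <=
   \int[mu]_t (`|'D_w u (e t)| `^ p)%:E)%E.
Proof.
move=> pc p0 [[du _ _] cK sK] cDw ee cpr pre hOm.
have ce : continuous e.
  rewrite (funext ee) => t; apply: cvgD; last exact: cvg_cst.
  exact: scalel_continuous.
pose v t := u (e t).
have ve : v = (fun t => u (t *: w + z)) by apply/funext => t; rewrite /v ee.
have dv t : derivable v t 1.
  by rewrite ve; have [] := slice_derive (du (t *: w + z)).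
have Dv : derive1 v = (fun t => 'D_w u (e t)).
  by apply/funext => t; rewrite ve ee; have [_] := slice_derive (du (t *: w + z)).
have cDv : continuous (derive1 v).
  by rewrite Dv => t; apply: (@continuous_comp _ _ _ e ('D_w u)); [exact: ce|exact: cDw].
have -> : (fun t => (`|'D_w u (e t)| `^ p)%:E) = (fun t => (`|derive1 v t| `^ p)%:E).
  by rewrite Dv.
pose K : set R := e @^-1` (closure [set x | u x != 0]).
have cpK : compact K.
  apply: (@subclosed_compact _ _ (pr @` closure [set x | u x != 0])).
  - by move/continuous_closedP : ce; apply; exact: closed_closure.
  - by apply: continuous_compact => //; exact: continuous_subspaceT.
  - by move=> t Kt; exists (e t) => //; exact: pre.
have suppK t : v t != 0 -> K t by move=> vt; exact: (@subset_closure _ _ (e t)).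
have [K0|/set0P/negP] := pselect (K !=set0).
  have [a [b [Ka Kb hab]]] := compact_segment cpK K0.
  apply: (pc v dv cDv a b) => [|t /suppK]; last exact: hab.
  by apply: le_lt_trans (hOm _ _ (sK _ Kb) (sK _ Ka)); exact: ler_norm.
rewrite negbK => /eqP K0.
apply: (pc v dv cDv 0 0) => [|t /suppK]; first by rewrite subrr.
by rewrite K0.
Qed.

Lemma segment_measure (u v : R) : u <= v -> mu `[u, v] = (v - u)%:E.
Proof.
move=> uv; rewrite lebesgue_measure_itv/= lte_fin; case: ltP => // h.
by apply/esym; congr EFin; apply/eqP; rewrite subr_eq0 eq_le uv h.
Qed.

Lemma box_measure (a b x y : R) : a <= b -> x <= y ->
  lebesgue2 R (`[a, b] `*` `[x, y]) = ((b - a) * (y - x))%:E.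
Proof.
move=> ab xy; rewrite product_measure1E; try exact: measurable_itv.
by rewrite EFinM; congr (_ * _)%E; exact: segment_measure.
Qed.

Lemma measurable_box (a b x y : R) : measurable (`[a, b] `*` `[x, y] : set (plane R)).
Proof. by apply: measurableX; exact: measurable_itv. Qed.

Lemma nbhs_box (x : R * R) (A : set (R * R)) : nbhs x A ->
  exists e, 0 < e /\ `[x.1 - e, x.1 + e] `*` `[x.2 - e, x.2 + e] `<=` A.
Proof.
move=> /nbhs_ballP[e /= e0 ex]; exists (e / 2); split; first by rewrite divr_gt0.
move=> [a b] [/=]; rewrite !in_itv/= => /andP[h1 h2] /andP[h3 h4].
by apply: ex; split; rewrite /ball/= ltr_norml; lra.
Qed.

Lemma integral_scale_indic (k : R) (B : set (plane R)) : 0 <= k -> measurable B ->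
  (\int[lebesgue2 R]_y (k * \1_B y)%:E = k%:E * lebesgue2 R B)%E.
Proof.
move=> k0 mB; under eq_integral do rewrite EFinM.
rewrite ge0_integralZl_EFin//; first by rewrite integral_indic// setIT.
by apply/measurable_EFinP; exact: measurable_indic.
Qed.

Lemma integral_gt0_nbhs (f : plane R -> R) (x : R * R) (k : R) :
  measurable_fun setT f -> (forall x, 0 <= f x) -> 0 < k ->
  nbhs x [set y : R * R | k <= f y] -> (0 < \int[lebesgue2 R]_x (f x)%:E)%E.
Proof.
move=> mf f0 k0 nx; have [e [e0 ex]] := nbhs_box nx.
set B := _ `*` _ in ex.
have mB : measurable (B : set (plane R)) by exact: measurable_box.
apply: (@lt_le_trans _ _ (k%:E * lebesgue2 R B)%E).
  have h1 : x.1 - e <= x.1 + e by lra.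
  have h2 : x.2 - e <= x.2 + e by lra.
  rewrite /B (box_measure h1 h2) -EFinM lte_fin mulr_gt0// mulr_gt0//; lra.
rewrite -(integral_scale_indic (ltW k0) mB); apply: ge0_le_integral => //.
- by move=> y _; rewrite lee_fin mulr_ge0// ltW.
- by apply/measurable_EFinP; apply: measurable_funM => //; exact: measurable_indic.
- exact/measurable_EFinP.
- move=> y _; rewrite lee_fin indicE; case: (boolP (y \in B)); rewrite ?mulr0//= mulr1.
  by rewrite inE => /ex.
Qed.

Lemma integral_powR_gt0 p u : 0 <= p -> continuous u -> (exists x, u x != 0) ->
  (0 < \int[lebesgue2 R]_x (`|u x| `^ p)%:E)%E.
Proof.
move=> p0 cu [x ux].
have ux0 : 0 < `|u x| by rewrite normr_gt0.
have mf := measurable_powR_normr p cu.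
apply: (@integral_gt0_nbhs _ x ((`|u x| / 2) `^ p)).
- exact/measurable_EFinP.
- by move=> y; exact: powR_ge0.
- by rewrite powR_gt0// divr_gt0.
have nu : nbhs (`|u x|) [set r | `|u x| / 2 < r].
  apply: open_nbhs_nbhs; split; first exact: open_gt.
  by rewrite /= ltr_pdivrMr// ltr_pMr// ltr1n.
have nx : nbhs x [set y | `|u x| / 2 < `|u y|] := continuous_normr cu nu.
apply: (filterS _ nx) => y /= /ltW uy.
by apply: ge0_ler_powR; rewrite // nnegrE ?divr_ge0.
Qed.

Lemma compact_sub_box (K : set (R * R)) : compact K -> exists M, 0 <= M /\
  K `<=` `[- M, M] `*` `[- M, M].
Proof.
move=> /compact_bounded[M [_ hM]].
exists (`|M| + 1); split; first by rewrite addr_ge0.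
have M1 : M < `|M| + 1 by rewrite (le_lt_trans (ler_norm M))// ltrDl.
move=> [x y] Kxy; have /= := hM _ M1 (x, y) Kxy.
rewrite prod_normE/= ge_max => /andP[xM yM].
by split; rewrite /= in_itv/= -ler_norml.
Qed.

Lemma integral_powR_lty p u (K : set (R * R)) : 0 < p -> continuous u ->
  compact K -> (forall x, ~ K x -> u x = 0) ->
  (\int[lebesgue2 R]_x (`|u x| `^ p)%:E < +oo)%E.
Proof.
move=> p0 cu cK uK.
have [M [M0 KM]] := compact_sub_box cK.
set B := _ `*` _ in KM.
have mB : measurable (B : set (plane R)) by exact: measurable_box.
have : compact (u @` K).
  by apply: continuous_compact => //; exact: continuous_subspaceT.
move=> /compact_bounded[C [_ hC]].
pose C' := (`|C| + 1) `^ p.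
have C0 : 0 <= C' by exact: powR_ge0.
have fC x : `|u x| `^ p <= C' * \1_B x.
  have [Kx|nKx] := pselect (K x); last first.
    by rewrite uK// normr0 powR0 ?gt_eqF// mulr_ge0.
  rewrite indicE mem_set ?mulr1; last exact: KM.
  have C1 : C < `|C| + 1 by rewrite (le_lt_trans (ler_norm C))// ltrDl.
  apply: ge0_ler_powR; rewrite ?nnegrE ?(ltW p0) ?addr_ge0//.
  by apply: (hC _ C1 (u x)); exists x.
have mf := measurable_powR_normr p cu.
apply: (@le_lt_trans _ _ (\int[lebesgue2 R]_y (C' * \1_B y)%:E)%E).
  apply: ge0_le_integral => //.
  - by apply/measurable_EFinP; apply: measurable_funM => //; exact: measurable_indic.
  - by move=> y _; rewrite lee_fin.
rewrite (integral_scale_indic C0 mB).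
have h1 : - M <= M by lra.
by rewrite /B (box_measure h1 h1) -EFinM ltry.
Qed.

End slices.

(** * Lower bounds for lambda from the length of chords *)

Section rayleigh_lower.
Context {R : realType}.
Implicit Types (p c : R) (Om : set (R * R)) (u : R * R -> R).
Local Notation mu := (@lebesgue_measure R).

Lemma C1c_integral_fin p Om u : 0 < p -> C1c Om u -> (exists x, u x != 0) ->
  exists2 N : R, 0 < N & (\int[lebesgue2 R]_x (`|u x| `^ p)%:E = N%:E)%E.
Proof.
move=> p0 [uC1 cK _] u0; have cu := C1_continuous uC1.
have := integral_powR_gt0 (ltW p0) cu u0.
have := integral_powR_lty p0 cu cK (fun x => @eq0_supp _ _ u x).
by case: (\int[_]_x _)%E => // N _ N0; exists N.
Qed.

Lemma rayleigh_gradient_ge p Om u c : 0 < p -> C1c Om u -> (exists x, u x != 0) ->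
  (c%:E <= rayleigh p Om u)%E ->
  (c%:E * \int[lebesgue2 R]_x (`|u x| `^ p)%:E <=
   \int[lebesgue2 R]_x (enorm (gradient u x) `^ p)%:E)%E.
Proof.
move=> p0 uC u0; rewrite (rayleigh_setT _ uC) ?gt_eqF// /rayleigh.
have [N N0 EN] := C1c_integral_fin p0 uC u0.
by rewrite EN inver gt_eqF// lee_pdivlMr.
Qed.

Lemma rayleigh_ge p Om u c : 0 < p -> C1c Om u -> (exists x, u x != 0) ->
  (c%:E * \int[lebesgue2 R]_x (`|u x| `^ p)%:E <=
   \int[lebesgue2 R]_x (enorm (gradient u x) `^ p)%:E)%E ->
  (c%:E <= rayleigh p Om u)%E.
Proof.
move=> p0 uC u0 h; rewrite (rayleigh_setT _ uC) ?gt_eqF// /rayleigh.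
have [N N0 EN] := C1c_integral_fin p0 uC u0.
by rewrite EN in h *; rewrite inver gt_eqF// lee_pdivlMr.
Qed.

Lemma fubini_poincare_y c (f g : plane R -> R) : 0 <= c ->
  measurable_fun setT f -> measurable_fun setT g ->
  (forall x, 0 <= f x) -> (forall x, 0 <= g x) ->
  (forall x, c%:E * \int[mu]_y (f (x, y))%:E <= \int[mu]_y (g (x, y))%:E)%E ->
  (c%:E * \int[lebesgue2 R]_x (f x)%:E <= \int[lebesgue2 R]_x (g x)%:E)%E.
Proof.
move=> c0 mf mg f0 g0 H.
have ef : measurable_fun setT (fun x => (f x)%:E) by exact/measurable_EFinP.
have eg : measurable_fun setT (fun x => (g x)%:E) by exact/measurable_EFinP.
have f0' x : (0 <= (f x)%:E)%E by rewrite lee_fin.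
have g0' x : (0 <= (g x)%:E)%E by rewrite lee_fin.
have F0 (x : measurableTypeR R) : [set: measurableTypeR R] x ->
    (0 <= fubini_F mu (fun x => (f x)%:E) x)%E.
  by move=> _; apply: integral_ge0 => y _; exact: f0'.
have mF := measurable_fun_fubini_tonelli_F (m2 := mu) _ ef f0'.
have mG := measurable_fun_fubini_tonelli_F (m2 := mu) _ eg g0'.
rewrite (fubini_tonelli1 _ ef f0') (fubini_tonelli1 _ eg g0').
rewrite -(ge0_integralZl_EFin _ measurableT F0 mF c0).
apply: ge0_le_integral => //.
- by move=> x _; rewrite mule_ge0// F0.
- exact: measurable_funeM.
- by move=> x _; exact: H.
Qed.

Lemma fubini_poincare_x c (f g : plane R -> R) : 0 <= c ->
  measurable_fun setT f -> measurable_fun setT g ->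
  (forall x, 0 <= f x) -> (forall x, 0 <= g x) ->
  (forall y, c%:E * \int[mu]_x (f (x, y))%:E <= \int[mu]_x (g (x, y))%:E)%E ->
  (c%:E * \int[lebesgue2 R]_x (f x)%:E <= \int[lebesgue2 R]_x (g x)%:E)%E.
Proof.
move=> c0 mf mg f0 g0 H.
have ef : measurable_fun setT (fun x => (f x)%:E) by exact/measurable_EFinP.
have eg : measurable_fun setT (fun x => (g x)%:E) by exact/measurable_EFinP.
have f0' x : (0 <= (f x)%:E)%E by rewrite lee_fin.
have g0' x : (0 <= (g x)%:E)%E by rewrite lee_fin.
have F0 (x : measurableTypeR R) : [set: measurableTypeR R] x ->
    (0 <= fubini_G mu (fun x => (f x)%:E) x)%E.
  by move=> _; apply: integral_ge0 => y _; exact: f0'.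
have mF := measurable_fun_fubini_tonelli_G (m1 := mu) _ ef f0'.
have mG := measurable_fun_fubini_tonelli_G (m1 := mu) _ eg g0'.
rewrite (fubini_tonelli2 _ ef f0') (fubini_tonelli2 _ eg g0').
rewrite -(ge0_integralZl_EFin _ measurableT F0 mF c0).
apply: ge0_le_integral => //.
- by move=> x _; rewrite mule_ge0// F0.
- exact: measurable_funeM.
- by move=> x _; exact: H.
Qed.

Lemma poincare_y p c Om u : 0 <= c -> 0 < p -> poincare p c -> C1c Om u ->
  (forall x y y', Om (x, y) -> Om (x, y') -> `|y - y'| < 1) ->
  (c%:E * \int[lebesgue2 R]_x (`|u x| `^ p)%:E <=
   \int[lebesgue2 R]_x (`|'D_(0, 1) u x| `^ p)%:E)%E.
Proof.
move=> c0 p0 pc uC hOm; have [[du _ c2] _ _] := uC.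
have cu := C1_continuous (let: And3 h _ _ := uC in h).
have mf := measurable_powR_normr p cu; have mg := measurable_powR_normr p c2.
apply: fubini_poincare_y => //; try by move=> x; exact: powR_ge0.
- exact/measurable_EFinP.
- exact/measurable_EFinP.
move=> x.
have line t : t *: (0, 1) + (x, 0) = (x, t) :> R * R.
  by apply: injective_projections; rewrite /= ?scaler0 ?add0r// addr0; exact: mulr1.
have pn : p != 0 by rewrite gt_eqF.
exact: (@slice_poincare _ p c Om u (x, 0) (0, 1) (fun t => (x, t)) snd pc pn uC c2 (fun t => esym (line t))
  continuous_snd2 (fun t => erefl) (hOm x)).
Qed.

Lemma poincare_x p c Om u : 0 <= c -> 0 < p -> poincare p c -> C1c Om u ->
  (forall y x x', Om (x, y) -> Om (x', y) -> `|x - x'| < 1) ->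
  (c%:E * \int[lebesgue2 R]_x (`|u x| `^ p)%:E <=
   \int[lebesgue2 R]_x (`|'D_(1, 0) u x| `^ p)%:E)%E.
Proof.
move=> c0 p0 pc uC hOm; have [[du c1 _] _ _] := uC.
have cu := C1_continuous (let: And3 h _ _ := uC in h).
have mf := measurable_powR_normr p cu; have mg := measurable_powR_normr p c1.
apply: fubini_poincare_x => //; try by move=> x; exact: powR_ge0.
- exact/measurable_EFinP.
- exact/measurable_EFinP.
move=> y.
have line t : t *: (1, 0) + (0, y) = (t, y) :> R * R.
  by apply: injective_projections; rewrite /= ?scaler0 ?add0r// addr0; exact: mulr1.
have pn : p != 0 by rewrite gt_eqF.
exact: (@slice_poincare _ p c Om u (0, y) (1, 0) (fun t => (t, y)) fst pc pn uC c1 (fun t => esym (line t))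
  continuous_fst2 (fun t => erefl) (hOm y)).
Qed.

(** The horizontal derivative is dropped; on long thin domains this costs nothing in the limit. *)
Lemma lambda_ge_thin p c Om : 0 <= c -> 0 < p -> poincare p c ->
  (forall x y y', Om (x, y) -> Om (x, y') -> `|y - y'| < 1) ->
  (c%:E <= lambda p Om)%E.
Proof.
move=> c0 p0 pc hOm; apply: le_ereal_inf_tmp => _ [u [uC u0] <-].
apply: rayleigh_ge => //.
apply: (le_trans (poincare_y c0 p0 pc uC hOm)).
have [uC1 _ _] := uC; have [_ _ c2] := uC1.
apply: ge0_le_integral => //.
- exact: measurable_powR_normr.
- exact: measurable_gradient.
- by move=> x _; rewrite lee_fin enorm_powR_ge_snd// ltW.
Qed.

(** The inequalities on horizontal and on vertical chords are added, which gives 2 c, and concavity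
    of t^(p/2) contributes 2^(p/2-1). *)
Lemma lambda_ge_square p c Om : 0 <= c -> 0 < p <= 2 -> poincare p c ->
  (forall x y y', Om (x, y) -> Om (x, y') -> `|y - y'| < 1) ->
  (forall y x x', Om (x, y) -> Om (x', y) -> `|x - x'| < 1) ->
  ((2 `^ (p / 2) * c)%:E <= lambda p Om)%E.
Proof.
move=> c0 p2 pc hy hx; have /andP[p0 _] := p2.
apply: le_ereal_inf_tmp => _ [u [uC u0] <-].
apply: rayleigh_ge => //.
have hY := poincare_y c0 p0 pc uC hy; have hX := poincare_x c0 p0 pc uC hx.
have [uC1 _ _] := uC; have [_ c1 c2] := uC1.
have cu := C1_continuous uC1.
set k := 2 `^ (p / 2 - 1).
have k0 : 0 <= k by exact: powR_ge0.
have m1 := measurable_powR_normr p c1; have m2 := measurable_powR_normr p c2.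
have -> : 2 `^ (p / 2) * c = k * (c + c).
  rewrite /k powRB ?powRr1//; first by field.
  by apply/implyP; rewrite pnatr_eq0.
set N := (\int[lebesgue2 R]_x (`|u x| `^ p)%:E)%E in hX hY *.
have N0 : (0 <= N)%E by apply: integral_ge0 => x _; rewrite lee_fin powR_ge0.
apply: (@le_trans _ _ (k%:E * (\int[lebesgue2 R]_x (`|'D_(1, 0) u x| `^ p)%:E +
  \int[lebesgue2 R]_x (`|'D_(0, 1) u x| `^ p)%:E))%E).
  rewrite EFinM -muleA EFinD ge0_muleDl ?lee_fin//.
  have k0' : (0 <= k%:E)%E by rewrite lee_fin.
  exact: (lee_wpmul2l k0' (leeD hX hY)).
have pos1 (x : plane R) : setT x -> (0 <= (`|'D_(1, 0) u x| `^ p)%:E)%E.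
  by rewrite lee_fin powR_ge0.
have pos2 (x : plane R) : setT x -> (0 <= (`|'D_(0, 1) u x| `^ p)%:E)%E.
  by rewrite lee_fin powR_ge0.
rewrite -(ge0_integralD _ measurableT pos1 m1 pos2 m2).
have pos3 (x : plane R) : setT x ->
    (0 <= (`|'D_(1, 0) u x| `^ p)%:E + (`|'D_(0, 1) u x| `^ p)%:E)%E.
  by move=> _; rewrite -EFinD lee_fin addr_ge0// powR_ge0.
have m3 := emeasurable_funD m1 m2.
rewrite -(ge0_integralZl_EFin _ measurableT pos3 m3 k0).
apply: ge0_le_integral => //.
- by move=> x _; rewrite mule_ge0 ?lee_fin// pos3.
- exact: measurable_funeM.
- exact: measurable_gradient.
- by move=> x _; rewrite -EFinD -EFinM lee_fin enorm_powR_le2_ge.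
Qed.

End rayleigh_lower.

(** * Products of functions of one variable *)

Section tensor.
Context {R : realType}.
Implicit Types (p c : R) (Om : set (R * R)) (f g v : R -> R).
Local Notation mu := (@lebesgue_measure R).

Lemma C1_tensor f g : (forall t, derivable f t 1) -> continuous (derive1 f) ->
  (forall t, derivable g t 1) -> continuous (derive1 g) ->
  let u := fun x : R * R => f x.1 * g x.2 in
  [/\ C1 u, forall x, 'D_(1, 0) u x = derive1 f x.1 * g x.2
    & forall x, 'D_(0, 1) u x = f x.1 * derive1 g x.2].
Proof.
move=> df cf dg cg u.
have ctf : continuous f by move=> t; apply: differentiable_continuous; exact/derivable1_diffP.
have ctg : continuous g by move=> t; apply: differentiable_continuous; exact/derivable1_diffP.
have du x : differentiable u x.
  apply: (@differentiableM _ _ (f \o fst) (g \o snd)).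
  - apply: differentiable_comp; first exact: differentiable_fst2.
    exact/derivable1_diffP.
  - apply: differentiable_comp; first exact: differentiable_snd2.
    exact/derivable1_diffP.
have D1 x : 'D_(1, 0) u x = derive1 f x.1 * g x.2.
  case: x => x1 x2 /=.
  have line t : t *: (1, 0) + (0, x2) = (t, x2) :> R * R.
    by apply: injective_projections; rewrite /= ?scaler0 ?add0r// addr0; exact: mulr1.
  have [_] := slice_derive (du (x1 *: (1, 0) + (0, x2))).
  have -> : (fun t : R => u (t *: (1, 0) + (0, x2))) = (fun t => f t * g x2).
    by apply/funext => t; rewrite line.
  by rewrite line derive1Mr// => <-.
have D2 x : 'D_(0, 1) u x = f x.1 * derive1 g x.2.
  case: x => x1 x2 /=.
  have line t : t *: (0, 1) + (x1, 0) = (x1, t) :> R * R.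
    by apply: injective_projections; rewrite /= ?scaler0 ?add0r// addr0; exact: mulr1.
  have [_] := slice_derive (du (x2 *: (0, 1) + (x1, 0))).
  have -> : (fun t : R => u (t *: (0, 1) + (x1, 0))) = (fun t => f x1 * g t).
    by apply/funext => t; rewrite line.
  by rewrite line derive1Ml// => <-.
have cc (h1 h2 : R -> R) : continuous h1 -> continuous h2 ->
    continuous (fun x : R * R => h1 x.1 * h2 x.2).
  move=> c1 c2 x; apply: (@cvgM _ _ _ _ (h1 \o fst) (h2 \o snd)).
  - by apply: continuous_comp; [exact: continuous_fst2|exact: c1].
  - by apply: continuous_comp; [exact: continuous_snd2|exact: c2].
split=> //; split=> //.
- by rewrite (funext D1); exact: (cc _ _ cf ctg).
- by rewrite (funext D2); exact: (cc _ _ ctf cg).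
Qed.

Lemma integral_tensor (F G : R -> R) :
  measurable_fun [set: measurableTypeR R] F -> measurable_fun [set: measurableTypeR R] G ->
  (forall x, 0 <= F x) -> (forall x, 0 <= G x) ->
  (\int[lebesgue2 R]_x (F x.1 * G x.2)%:E = \int[mu]_x (F x)%:E * \int[mu]_x (G x)%:E)%E.
Proof.
move=> mF mG F0 G0.
have m2 : measurable_fun [set: plane R] (fun x : plane R => (F x.1 * G x.2)%:E).
  apply/measurable_EFinP; apply: measurable_funM.
    exact: (measurableT_comp mF).
  exact: (measurableT_comp mG).
have p2 (x : plane R) : (0 <= (F x.1 * G x.2)%:E)%E by rewrite lee_fin mulr_ge0.
have eF : measurable_fun [set: measurableTypeR R] (EFin \o F) by exact/measurable_EFinP.
have eG : measurable_fun [set: measurableTypeR R] (EFin \o G) by exact/measurable_EFinP.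
have F0' (x : measurableTypeR R) : setT x -> (0 <= (EFin \o F) x)%E by rewrite lee_fin.
have G0' (x : measurableTypeR R) : setT x -> (0 <= (EFin \o G) x)%E by rewrite lee_fin.
have IG0 : (0 <= \int[mu]_x (EFin \o G) x)%E by exact: integral_ge0.
rewrite (fubini_tonelli1 _ m2 p2).
rewrite -(ge0_integralZr _ measurableT eF F0' IG0).
apply: eq_integral => x _; rewrite /fubini_F /=.
by rewrite -(ge0_integralZl_EFin _ measurableT G0' eG (F0 x)).
Qed.

Lemma derive1_affine v (a t : R) : (forall s, derivable v s 1) -> continuous (derive1 v) ->
  let f := fun x => v (a * x + t) in
  [/\ forall s, derivable f s 1, continuous (derive1 f)
    & forall s, derive1 f s = a * derive1 v (a * s + t)].
Proof.
move=> dv cv f.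
have dl s : derivable (fun x : R => a * x + t) s 1.
  by apply: derivableD; [apply: derivableM|].
have D s : derive1 f s = a * derive1 v (a * s + t).
  rewrite [LHS](derive1_comp (dl s) (dv _)) mulrC; congr (_ * _).
  rewrite derive1E deriveD// derive_cst addr0 deriveM// derive_cst derive_id scaler0 addr0.
  exact: mulr1.
split; last exact: D.
- move=> s; apply/derivable1_diffP; apply: (@differentiable_comp _ _ _ _ (fun x : R => a * x + t) v).
    exact/derivable1_diffP.
  exact/derivable1_diffP.
- rewrite (funext D) => s; apply: cvgM; first exact: cvg_cst.
  apply: (@continuous_comp _ _ _ (fun x : R => a * x + t) (derive1 v)); last exact: cv.
  by apply: cvgD; [apply: cvgM; [exact: cvg_cst|exact: cvg_id]|exact: cvg_cst].
Qed.

Lemma integral_powR_affine p (h : R -> R) (a t k : R) : 0 < a -> 0 <= k -> continuous h ->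
  (\int[mu]_x (`|k * h (a^-1 * x + t)| `^ p)%:E =
   (a * k `^ p)%:E * \int[mu]_x (`|h x| `^ p)%:E)%E.
Proof.
move=> a0 k0 ch.
have mh : measurable_fun [set: measurableTypeR R] (fun x : R => (`|h x| `^ p)%:E).
  apply/measurable_EFinP; apply: (measurableT_comp (f := @powR R ^~ p)).
    exact: measurable_powR.
  apply: continuous_measurable_fun => x; apply: cvg_norm; exact: ch.
have h0 (x : measurableTypeR R) : (0 <= (`|h x| `^ p)%:E)%E by rewrite lee_fin powR_ge0.
have ai0 : 0 < a^-1 by rewrite invr_gt0.
have A := integral_affine t ai0 mh h0; rewrite invrK in A.
rewrite EFinM [(a%:E * _)%E]muleC -muleA -A.
have ml : measurable_fun [set: measurableTypeR R] (fun x : R => (`|h (a^-1 * x + t)| `^ p)%:E).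
  exact: (measurableT_comp mh (measurable_affine a^-1 t)).
have l0 (x : measurableTypeR R) : setT x -> (0 <= (`|h (a^-1 * x + t)| `^ p)%:E)%E.
  by rewrite lee_fin powR_ge0.
rewrite -(ge0_integralZl_EFin _ measurableT l0 ml (powR_ge0 k p)).
by apply: eq_integral => x _; rewrite normrM powRM// (ger0_norm k0) EFinM.
Qed.

End tensor.

(** * Poincare constants extracted from a rectangle *)

Section poincare_of_lambda.
Context {R : realType}.
Implicit Types (p c : R) (Om : set (R * R)) (f g v : R -> R).
Local Notation mu := (@lebesgue_measure R).

Lemma compact_box (a b x y : R) : compact (`[a, b] `*` `[x, y] : set (R * R)).
Proof. by apply: compact_setX; exact: segment_compact. Qed.

(** Let I and J be the integrals of |v|^p and |v'|^p. The product test function has mass a b I^2 and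
    energy at most k (a^-p + b^-p) a b I J, and one factor I cancels. The comparison constant k is
    2^(p/2-1) for p >= 2 and 1 for p <= 2. *)
Lemma poincare_of_lambda p Om (k a b x0 y0 c : R) : 0 < p ->
  (forall X Y, enorm (X, Y) `^ p <= k * (`|X| `^ p + `|Y| `^ p)) -> 0 < k ->
  0 < a -> 0 < b ->
  (forall x y, x0 < x < x0 + a -> y0 < y < y0 + b -> Om (x, y)) -> 0 <= c ->
  ((k * ((a^-1) `^ p + (b^-1) `^ p) * c)%:E <= lambda p Om)%E -> poincare p c.
Proof.
move=> p0 hk k0 a0 b0 hOm c0 hl v dv cv al be ab supv.
have pn : p != 0 by rewrite gt_eqF.
have ctv : continuous v by move=> t; apply: differentiable_continuous; exact/derivable1_diffP.
have [[s vs]|v0] := pselect (exists s, v s != 0); last first.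
  rewrite (_ : (fun t => (`|v t| `^ p)%:E) = cst 0%E).
    by rewrite integral_cst// mul0e mule0 integral_ge0// => t _; rewrite lee_fin powR_ge0.
  apply/funext => t; suff -> : v t = 0 by rewrite normr0 powR0.
  by apply/eqP/negPn/negP => vt; apply: v0; exists t.
have /andP[als sbe] := supv s vs.
(* The shifts send the centre of the rectangle to the midpoint of [al, be]. As be - al < 1, the
   supports of f and g then stay strictly inside its sides. *)
pose t1 := (al + be) / 2 - a^-1 * x0 - 2^-1.
pose t2 := (al + be) / 2 - b^-1 * y0 - 2^-1.
have [df cf Df] := derive1_affine a^-1 t1 dv cv.
have [dg cg Dg] := derive1_affine b^-1 t2 dv cv.
have [uC1 D1 D2] := C1_tensor df cf dg cg.
set f := (fun x => v (a^-1 * x + t1)) in df cf Df uC1 D1 D2.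
set g := (fun x => v (b^-1 * x + t2)) in dg cg Dg uC1 D1 D2.
set u := (fun x : R * R => f x.1 * g x.2) in uC1 D1 D2.
pose K : set (R * R) := `[a * (al - t1), a * (be - t1)] `*` `[b * (al - t2), b * (be - t2)].
have an : a != 0 by rewrite gt_eqF.
have bn : b != 0 by rewrite gt_eqF.
have suK : [set x | u x != 0] `<=` K.
  move=> [x y] /=; rewrite mulf_eq0 negb_or => /andP[/supv /andP[fx1 fx2] /supv /andP[gy1 gy2]].
  split; rewrite /= in_itv/=.
    have -> : x = a * (a^-1 * x) by rewrite mulrA mulfV ?mul1r.
    by rewrite !ler_pM2l// lerBlDr lerBrDr fx1 fx2.
  have -> : y = b * (b^-1 * y) by rewrite mulrA mulfV ?mul1r.
  by rewrite !ler_pM2l// lerBlDr lerBrDr gy1 gy2.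
have cK : compact K by exact: compact_box.
have clK : closure [set x | u x != 0] `<=` K.
  rewrite [X in _ `<=` X](closure_id _).1; first exact: closure_subset.
  exact: (compact_closed (@norm_hausdorff _ _)).
have KOm : K `<=` Om.
  move=> [x y] [/=]; rewrite !in_itv/= => /andP[h1 h2] /andP[h3 h4]; apply: hOm.
    have e1 : a * (al - t1) = x0 + a / 2 - a * ((be - al) / 2) by rewrite /t1; field.
    have e2 : a * (be - t1) = x0 + a / 2 + a * ((be - al) / 2) by rewrite /t1; field.
    have : a * ((be - al) / 2) < a * (1 / 2) by rewrite ltr_pM2l//; lra.
    by lra.
  have e1 : b * (al - t2) = y0 + b / 2 - b * ((be - al) / 2) by rewrite /t2; field.
  have e2 : b * (be - t2) = y0 + b / 2 + b * ((be - al) / 2) by rewrite /t2; field.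
  have : b * ((be - al) / 2) < b * (1 / 2) by rewrite ltr_pM2l//; lra.
  by lra.
have uC : C1c Om u.
  split=> //; first by apply: subclosed_compact clK => //; exact: closed_closure.
  exact: subset_trans KOm.
have u0 : exists x, u x != 0.
  exists (a * (s - t1), b * (s - t2)); rewrite /u /f /g /= mulf_neq0//.
    by rewrite mulrA mulVf ?mul1r ?subrK.
  by rewrite mulrA mulVf ?mul1r ?subrK.
have [N N0 EN] := C1c_integral_fin p0 uC u0.
set I := (\int[mu]_t (`|v t| `^ p)%:E)%E.
set J := (\int[mu]_t (`|derive1 v t| `^ p)%:E)%E.
have I0 : (0 <= I)%E by apply: integral_ge0 => t _; rewrite lee_fin powR_ge0.
have J0 : (0 <= J)%E by apply: integral_ge0 => t _; rewrite lee_fin powR_ge0.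
have mpow (h : R -> R) : continuous h ->
    measurable_fun [set: measurableTypeR R] (fun x : R => `|h x| `^ p).
  move=> ch; apply: (measurableT_comp (f := @powR R ^~ p)).
    exact: measurable_powR.
  by apply: continuous_measurable_fun => x; apply: cvg_norm; exact: ch.
have tens (h1 h2 : R -> R) : continuous h1 -> continuous h2 ->
    (\int[lebesgue2 R]_x (`|h1 x.1 * h2 x.2| `^ p)%:E =
     \int[mu]_x (`|h1 x| `^ p)%:E * \int[mu]_x (`|h2 x| `^ p)%:E)%E.
  move=> c1 c2.
  rewrite -(integral_tensor (mpow _ c1) (mpow _ c2)); try by move=> x; exact: powR_ge0.
  by apply: eq_integral => x _; rewrite normrM powRM.
have ctf : continuous f by move=> t; apply: differentiable_continuous; exact/derivable1_diffP.
have ctg : continuous g by move=> t; apply: differentiable_continuous; exact/derivable1_diffP.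
have If : (\int[mu]_x (`|f x| `^ p)%:E = a%:E * I)%E.
  have := integral_powR_affine p t1 a0 ler01 ctv; rewrite powR1 mulr1 => <-.
  by apply: eq_integral => x _; rewrite mul1r.
have Ig : (\int[mu]_x (`|g x| `^ p)%:E = b%:E * I)%E.
  have := integral_powR_affine p t2 b0 ler01 ctv; rewrite powR1 mulr1 => <-.
  by apply: eq_integral => x _; rewrite mul1r.
have ai0 : 0 <= a^-1 by rewrite invr_ge0 ltW.
have bi0 : 0 <= b^-1 by rewrite invr_ge0 ltW.
have Jf : (\int[mu]_x (`|derive1 f x| `^ p)%:E = (a * a^-1 `^ p)%:E * J)%E.
  rewrite -(integral_powR_affine p t1 a0 ai0 cv).
  by apply: eq_integral => x _; rewrite Df.
have Jg : (\int[mu]_x (`|derive1 g x| `^ p)%:E = (b * b^-1 `^ p)%:E * J)%E.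
  rewrite -(integral_powR_affine p t2 b0 bi0 cv).
  by apply: eq_integral => x _; rewrite Dg.
have EI : (N%:E = (a%:E * I) * (b%:E * I))%E.
  by rewrite -EN -If -Ig -(tens _ _ ctf ctg).
(* The mass N is a positive real equal to (a I)(b I), which excludes both I = 0 and I = +oo. *)
have [i i0 Ei] : exists2 i, 0 < i & I = i%:E.
  case Ie : I EI I0 => [i| |]//.
    move=> + i0; rewrite -!EFinM => -[Ni]; exists i => //.
    rewrite lee_fin in i0; rewrite lt_neqAle i0 andbT eq_sym.
    by apply/negP => /eqP iz; move: N0; rewrite Ni iz !mulr0 ltxx.
  by rewrite !gt0_muley ?lte_fin// mulyy.
have hr : ((k * (a^-1 `^ p + b^-1 `^ p) * c)%:E <= rayleigh p Om u)%E.
  by apply: (le_trans hl); apply: ereal_inf_lbound; exists u.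
have {}hr : ((k * (a^-1 `^ p + b^-1 `^ p) * c)%:E * N%:E <=
    \int[lebesgue2 R]_x (enorm (gradient u x) `^ p)%:E)%E.
  by rewrite -EN; exact: (rayleigh_gradient_ge p0 uC u0 hr).
have [_ cu1 cu2] := uC1.
have m1 := measurable_powR_normr p cu1; have m2 := measurable_powR_normr p cu2.
have pos1 (x : plane R) : setT x -> (0 <= (`|'D_(1, 0) u x| `^ p)%:E)%E.
  by rewrite lee_fin powR_ge0.
have pos2 (x : plane R) : setT x -> (0 <= (`|'D_(0, 1) u x| `^ p)%:E)%E.
  by rewrite lee_fin powR_ge0.
have pos3 (x : plane R) : setT x ->
    (0 <= (`|'D_(1, 0) u x| `^ p)%:E + (`|'D_(0, 1) u x| `^ p)%:E)%E.
  by move=> _; rewrite -EFinD lee_fin addr_ge0// powR_ge0.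
have m3 := emeasurable_funD m1 m2.
have E1 : (\int[lebesgue2 R]_x (`|'D_(1, 0) u x| `^ p)%:E =
    ((a * a^-1 `^ p)%:E * J) * (b%:E * I))%E.
  rewrite -Jf -Ig -(tens _ _ cf ctg).
  by apply: eq_integral => x _; rewrite D1.
have E2 : (\int[lebesgue2 R]_x (`|'D_(0, 1) u x| `^ p)%:E =
    (a%:E * I) * ((b * b^-1 `^ p)%:E * J))%E.
  rewrite -Jg -If -(tens _ _ ctf cg).
  by apply: eq_integral => x _; rewrite D2.
have up : (\int[lebesgue2 R]_x (enorm (gradient u x) `^ p)%:E <=
    k%:E * (((a * a^-1 `^ p)%:E * J) * (b%:E * I) + (a%:E * I) * ((b * b^-1 `^ p)%:E * J)))%E.
  rewrite -E1 -E2 -(ge0_integralD _ measurableT pos1 m1 pos2 m2).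
  rewrite -(ge0_integralZl_EFin _ measurableT pos3 m3 (ltW k0)).
  have mgr := measurable_gradient p uC1.
  apply: (ge0_le_integral _ measurableT _ mgr (measurable_funeM k%:E m3)).
  - by move=> x _; rewrite lee_fin powR_ge0.
  - by move=> x _; rewrite -EFinD -EFinM lee_fin hk.
have := le_trans hr up; rewrite Ei -EFinM.
rewrite Ei -!EFinM in EI; case: EI => EI.
case Je : J J0 => [j| |]//; last first.
  by move=> _ _; rewrite leey.
rewrite lee_fin => j0; rewrite -!EFinM !lee_fin EI => h.
set P := a^-1 `^ p in h *; set Q := b^-1 `^ p in h *.
have P0 : 0 < P by apply: powR_gt0; rewrite invr_gt0.
have Q0 : 0 < Q by apply: powR_gt0; rewrite invr_gt0.
have h' : (k * (P + Q) * (a * b) * i) * (c * i) <= (k * (P + Q) * (a * b) * i) * j.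
  apply: le_trans (le_trans _ h) _; rewrite le_eqVlt; apply/orP; left; apply/eqP; ring.
by move: h'; rewrite ler_pM2l// !mulr_gt0// addr_gt0.
Qed.

End poincare_of_lambda.

(** * Cheeger constants of rectangles and of the square *)

Section perimeter_rectangle.
Context {R : realType}.
Local Notation mu := (@lebesgue_measure R).

Lemma measurable_fun_box (g : R * R -> R) (B : set (plane R)) : continuous g -> measurable B ->
  measurable_fun [set: plane R] (fun z : plane R => g z * \1_B z).
Proof.
move=> cg mB; apply: measurable_funM; first exact: continuous_measurable_plane.
exact: measurable_indic.
Qed.

Lemma integrable_box (g : R * R -> R) (a b x y : R) : continuous g -> a <= b -> x <= y ->
  (lebesgue2 R).-integrable [set: plane R]
    (fun z => (g z * \1_(`[a, b] `*` `[x, y]) z)%:E).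
Proof.
move=> cg ab xy; set B := _ `*` _.
have mB : measurable (B : set (plane R)) by exact: measurable_box.
have cB : compact (B : set (R * R)) by apply: compact_setX; exact: segment_compact.
have : compact (g @` B).
  by apply: continuous_compact => //; exact: continuous_subspaceT.
move=> /compact_bounded[C [_ hC]].
have C1 : C < `|C| + 1 by rewrite (le_lt_trans (ler_norm C))// ltrDl.
have C0 : 0 <= `|C| + 1 by rewrite addr_ge0.
apply/integrableP; split.
  by apply/measurable_EFinP; exact: measurable_fun_box.
apply: (@le_lt_trans _ _ (\int[lebesgue2 R]_z ((`|C| + 1) * \1_B z)%:E)%E).
  apply: ge0_le_integral => //.
  - apply: measurableT_comp => //.
    by apply/measurable_EFinP; exact: measurable_fun_box.
  - by apply/measurable_EFinP; apply: measurable_funM => //; exact: measurable_indic.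
  - move=> z _; rewrite /= lee_fin indicE; case: (boolP (z \in B)); rewrite ?mulr0 ?normr0//= !mulr1.
    by rewrite inE => Bz; apply: (hC _ C1 (g z)); exists z.
rewrite (integral_scale_indic C0 mB) /B (box_measure ab xy).
by rewrite -EFinM ltry.
Qed.

Lemma indic_setX (A B : set R) (x y : R) : \1_(A `*` B) (x, y) = \1_A x * \1_B y :> R.
Proof.
rewrite !indicE in_setX/=.
by case: (x \in A); case: (y \in B); rewrite /= ?mulr0 ?mulr1.
Qed.

Lemma FTC_slice (h h' : R -> R) (a b : R) : a < b -> continuous h' ->
  (forall t, derivable h t 1) -> derive1 h = h' ->
  (\int[mu]_y (h' y * \1_(`[a, b]) y)%:E = (h b - h a)%:E)%E.
Proof.
move=> ab ch' dh Dh.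
have ch : continuous h by move=> t; apply: differentiable_continuous; exact/derivable1_diffP.
have := @continuous_FTC2 R h' h a b ab _ _ _.
rewrite EFinB => <-.
- rewrite [RHS]integral_mkcond; apply: eq_integral => y _; rewrite patchE indicE.
  by case: (y \in _); rewrite ?mulr1 ?mulr0.
- exact: continuous_subspaceT.
- split => //.
  + by apply: cvg_at_right_filter; exact: ch.
  + by apply: cvg_at_left_filter; exact: ch.
- by move=> t _; rewrite -Dh.
Qed.

(** By the fundamental theorem of calculus every vertical slice contributes the difference of two
    values of f, at most 2. *)
Lemma integral_box_y (f : R * R -> R) (a b x y : R) : C1 f -> a < b -> x < y ->
  (forall z, `|f z| <= 1) ->
  (\int[lebesgue2 R]_z ('D_(0, 1) f z * \1_(`[a, b] `*` `[x, y]) z)%:E <= (2 * (b - a))%:E)%E.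
Proof.
move=> [df _ cf] ab xy f1.
have ig := integrable_box cf (ltW ab) (ltW xy).
rewrite -(integral12_prod_meas1 ig).
have E s : fubini_F mu (fun z : plane R => ('D_(0, 1) f z * \1_(`[a, b] `*` `[x, y]) z)%:E) s =
    ((f (s, y) - f (s, x)) * \1_(`[a, b]) s)%:E.
  rewrite /fubini_F.
  have line t : t *: (0, 1) + (s, 0) = (s, t) :> R * R.
    by apply: injective_projections; rewrite /= ?scaler0 ?add0r// addr0; exact: mulr1.
  have sl t := slice_derive (df (t *: (0, 1) + (s, 0))).
  have fe : (fun t : R => f (t *: (0, 1) + (s, 0))) = (fun t => f (s, t)).
    by apply/funext => t; rewrite line.
  have ds t : derivable (fun t => f (s, t)) t 1.
    by have [] := sl t; rewrite fe.
  have Ds : derive1 (fun t => f (s, t)) = (fun t => 'D_(0, 1) f (s, t)).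
    by apply/funext => t; have [_] := sl t; rewrite fe line.
  have cs : continuous (fun t => 'D_(0, 1) f (s, t)).
    move=> t; apply: (@continuous_comp _ _ _ (fun t : R => (s, t)) ('D_(0, 1) f)); last exact: cf.
    by apply: (@continuous_pair2 _ _ _ (cst s) id) => w; [exact: cvg_cst|exact: cvg_id].
  transitivity (\int[mu]_t ((\1_(`[a, b]) s)%:E * ('D_(0, 1) f (s, t) * \1_(`[x, y]) t)%:E))%E.
    apply: eq_integral => t _; rewrite indic_setX -EFinM; congr EFin; ring.
  have [sab|sab] := boolP (s \in `[a, b]%classic).
    rewrite indicE sab mulr1 -(FTC_slice xy cs ds Ds).
    by apply: eq_integral => t _; rewrite mul1e.
  rewrite indicE (negbTE sab) mulr0; rewrite -[RHS](@integral0 _ _ _ mu setT).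
  by apply: eq_integral => t _; rewrite mul0e.
have Ib : (\int[mu]_s (2 * \1_(`[a, b]) s)%:E = (2 * (b - a))%:E)%E.
  under eq_integral do rewrite EFinM.
  rewrite ge0_integralZl_EFin//; last by apply/measurable_EFinP; exact: measurable_indic.
  rewrite integral_indic// setIT EFinM; congr (_ * _)%E.
  exact: (segment_measure (ltW ab)).
rewrite -Ib; apply: le_integral => //.
- exact: (integrable_fubini_F ig).
- apply/integrableP; split.
    by apply/measurable_EFinP; apply: measurable_funM => //; exact: measurable_indic.
  under eq_integral do rewrite /= ger0_norm ?mulr_ge0//.
  by rewrite Ib ltry.
- move=> s _; rewrite E lee_fin ler_wpM2r//.
  have := f1 (s, y); have := f1 (s, x); rewrite !ler_norml => /andP[? ?] /andP[? ?]; lra.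
Qed.

Lemma integral_box_x (f : R * R -> R) (a b x y : R) : C1 f -> a < b -> x < y ->
  (forall z, `|f z| <= 1) ->
  (\int[lebesgue2 R]_z ('D_(1, 0) f z * \1_(`[a, b] `*` `[x, y]) z)%:E <= (2 * (y - x))%:E)%E.
Proof.
move=> [df cf _] ab xy f1.
have ig := integrable_box cf (ltW ab) (ltW xy).
rewrite -(integral21_prod_meas1 ig).
have E s : fubini_G mu (fun z : plane R => ('D_(1, 0) f z * \1_(`[a, b] `*` `[x, y]) z)%:E) s =
    ((f (b, s) - f (a, s)) * \1_(`[x, y]) s)%:E.
  rewrite /fubini_G.
  have line t : t *: (1, 0) + (0, s) = (t, s) :> R * R.
    by apply: injective_projections; rewrite /= ?scaler0 ?add0r// addr0; exact: mulr1.
  have sl t := slice_derive (df (t *: (1, 0) + (0, s))).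
  have fe : (fun t : R => f (t *: (1, 0) + (0, s))) = (fun t => f (t, s)).
    by apply/funext => t; rewrite line.
  have ds t : derivable (fun t => f (t, s)) t 1.
    by have [] := sl t; rewrite fe.
  have Ds : derive1 (fun t => f (t, s)) = (fun t => 'D_(1, 0) f (t, s)).
    by apply/funext => t; have [_] := sl t; rewrite fe line.
  have cs : continuous (fun t => 'D_(1, 0) f (t, s)).
    move=> t; apply: (@continuous_comp _ _ _ (fun t : R => (t, s)) ('D_(1, 0) f)); last exact: cf.
    by apply: (@continuous_pair2 _ _ _ id (cst s)) => w; [exact: cvg_id|exact: cvg_cst].
  transitivity (\int[mu]_t ((\1_(`[x, y]) s)%:E * ('D_(1, 0) f (t, s) * \1_(`[a, b]) t)%:E))%E.
    apply: eq_integral => t _; rewrite indic_setX -EFinM; congr EFin; ring.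
  have [sab|sab] := boolP (s \in `[x, y]%classic).
    rewrite indicE sab mulr1 -(FTC_slice ab cs ds Ds).
    by apply: eq_integral => t _; rewrite mul1e.
  rewrite indicE (negbTE sab) mulr0; rewrite -[RHS](@integral0 _ _ _ mu setT).
  by apply: eq_integral => t _; rewrite mul0e.
have Ib : (\int[mu]_s (2 * \1_(`[x, y]) s)%:E = (2 * (y - x))%:E)%E.
  under eq_integral do rewrite EFinM.
  rewrite ge0_integralZl_EFin//; last by apply/measurable_EFinP; exact: measurable_indic.
  rewrite integral_indic// setIT EFinM; congr (_ * _)%E.
  exact: (segment_measure (ltW xy)).
have I2 : mu.-integrable setT (fun s => (2 * \1_(`[x, y]) s)%:E).
  apply/integrableP; split.
    by apply/measurable_EFinP; apply: measurable_funM => //; exact: measurable_indic.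
  under eq_integral do rewrite /= ger0_norm ?mulr_ge0//.
  by rewrite Ib ltry.
have le2 s : `|f (b, s) - f (a, s)| <= 2.
  have := f1 (a, s); have := f1 (b, s); rewrite !ler_norml => /andP[? ?] /andP[? ?]; lra.
have I1 : mu.-integrable setT
    (fubini_G mu (fun z : plane R => ('D_(1, 0) f z * \1_(`[a, b] `*` `[x, y]) z)%:E)).
  apply: (le_integrable measurableT (measurable_fubini_G ig) _ I2) => s _.
  by rewrite E /= lee_fin !normrM ler_wpM2r// (ger0_norm (ler0n _ 2)).
rewrite -Ib; apply: le_integral => //.
move=> s _; rewrite E lee_fin ler_wpM2r//.
exact: le_trans (ler_norm _) (le2 s).
Qed.

Lemma enorm_ge_coords (x : R * R) : `|x.1| <= enorm x /\ `|x.2| <= enorm x.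
Proof.
by split; rewrite -sqrtr_sqr ler_wsqrtr// ?lerDl ?lerDr sqr_ge0.
Qed.

Lemma perimeter_rectangle (a b x y : R) : a < b -> x < y ->
  (perimeter (`[a, b] `*` `[x, y]) <= (2 * (b - a) + 2 * (y - x))%:E)%E.
Proof.
move=> ab xy; apply: ge_ereal_sup => _ [phi [phiC phi1] <-].
have [phiC1 _ _] := phiC.
have p1 := C1_fst phiC1; have p2 := C1_snd phiC1.
have [_ c1 _] := p1; have [_ _ c2] := p2.
have i1 := integrable_box c1 (ltW ab) (ltW xy).
have i2 := integrable_box c2 (ltW ab) (ltW xy).
set B := `[a, b] `*` `[x, y].
have -> : (\int[lebesgue2 R]_(z in B) (divergence phi z)%:E =
    \int[lebesgue2 R]_z (('D_(1, 0) (fst \o phi) z * \1_B z)%:E + ('D_(0, 1) (snd \o phi) z * \1_B z)%:E))%E.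
  rewrite integral_mkcond; apply: eq_integral => z _; rewrite patchE -EFinD -mulrDl indicE.
  by case: (z \in B); rewrite ?mulr1 ?mulr0.
rewrite (integralD _ i1 i2)// addrC EFinD; apply: leeD.
  by apply: integral_box_y => // z; apply: le_trans (phi1 z); exact: (enorm_ge_coords _).2.
by apply: integral_box_x => // z; apply: le_trans (phi1 z); exact: (enorm_ge_coords _).1.
Qed.

(** The competitor is the closed rectangle itself. Rounding its corners would do better, but this
    value is what the lower bound 2 sqrt 2 for the square is matched with. *)
Lemma cheeger_rectangle (Om : set (R * R)) (a b x y : R) : a < b -> x < y ->
  `[a, b] `*` `[x, y] `<=` Om -> (cheeger Om <= (2 * ((b - a)^-1 + (y - x)^-1))%:E)%E.
Proof.
move=> ab xy BOm; set B := _ `*` _ in BOm.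
have mB : measurable (B : set (plane R)) by exact: measurable_box.
have cB : compact (B : set (R * R)) by apply: compact_setX; exact: segment_compact.
have clB : closure B = B.
  by rewrite -(closure_id _).1//; exact: (compact_closed (@norm_hausdorff _ _)).
have mE : lebesgue2 R B = ((b - a) * (y - x))%:E by exact: (box_measure (ltW ab) (ltW xy)).
have m0 : 0 < (b - a) * (y - x) by rewrite mulr_gt0// subr_gt0.
apply: (@le_trans _ _ (perimeter B / lebesgue2 R B)%E).
  apply: ereal_inf_lbound; exists B => //; split; rewrite ?clB//.
  by rewrite mE lte_fin.
rewrite mE inver gt_eqF// lee_pdivrMr// -EFinM.
apply: (le_trans (perimeter_rectangle ab xy)); rewrite lee_fin.
rewrite le_eqVlt; apply/orP; left; apply/eqP; field.
by rewrite !subr_eq0 !gt_eqF.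
Qed.

End perimeter_rectangle.

(** * A C^1 cutoff on the line *)

Section cutoff.
Context {R : realType}.

Lemma is_derive_mulr_normr (z : R) : is_derive z 1 (fun t => t * `|t|) (2 * `|z|).
Proof.
have [z0|z0|->] := ltgtP z 0.
- have h : \near z, (fun t : R => - (t * t)) z = (fun t => t * `|t|) z.
    near=> t; have t0 : t < 0 by near: t; exact: lt_nbhsl.
    by rewrite ltr0_norm// mulrN.
  apply: (near_eq_is_derive h).
  have : is_derive z 1 (fun t : R => - (t * t)) (- (z *: 1 + z *: 1)) by exact: is_deriveN.
  by move=> /is_derive_eq; apply; rewrite ltr0_norm// [z *: 1]mulr1; ring.
- have h : \near z, (fun t : R => t * t) z = (fun t => t * `|t|) z.
    near=> t; have t0 : 0 < t by near: t; exact: lt_nbhsr.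
    by rewrite gtr0_norm.
  apply: (near_eq_is_derive h).
  have : is_derive z 1 (fun t : R => t * t) (z *: 1 + z *: 1) by exact: is_deriveM.
  by move=> /is_derive_eq; apply; rewrite gtr0_norm// [z *: 1]mulr1; ring.
- rewrite normr0 mulr0.
  have H : h^-1 *: (((fun t : R => t * `|t|) \o shift 0) (h *: 1) - 0 * `|0 : R|) @[h --> 0^'] --> (0 : R).
    have E : \forall h \near (0 : R)^', `|h| =
        h^-1 *: (((fun t : R => t * `|t|) \o shift 0) (h *: 1) - 0 * `|0 : R|).
      have := @nbhs_dnbhs_neq _ (0 : R); apply: filterS => h h0.
      rewrite /= /shift mul0r subr0 addr0 [h *: 1]mulr1 [_ *: _]mulrA mulVf//.
      by rewrite mul1r.
    apply: (cvg_trans (near_eq_cvg E)).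
    have := @norm_continuous _ R 0; rewrite /continuous_at normr0 => cn.
    exact: (cvg_trans (cvg_app _ (@nbhs_dnbhs _ 0)) cn).
  by split; [exact: cvgP H|exact: cvg_lim H].
Unshelve. all: by end_near. Qed.


(** In this form C^1 regularity reduces to that of [z * |z|], whose derivative is [2 * |z|]. *)
Definition sqpos (z : R) := 2^-1 * (z * z + z * `|z|).

Lemma sqpos_le0 z : z <= 0 -> sqpos z = 0.
Proof. by move=> z0; rewrite /sqpos ler0_norm// mulrN subrr mulr0. Qed.

Lemma sqpos_ge0E z : 0 <= z -> sqpos z = z ^+ 2.
Proof. by move=> z0; rewrite /sqpos ger0_norm//; field. Qed.

Lemma sqpos_ge0 z : 0 <= sqpos z.
Proof.
have [z0|z0] := lerP z 0; first by rewrite sqpos_le0.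
by rewrite sqpos_ge0E ?sqr_ge0// ltW.
Qed.

Lemma is_derive_sqpos (z : R) : is_derive z 1 sqpos (z + `|z|).
Proof.
have h1 : is_derive z 1 (fun t : R => t * t) (z *: 1 + z *: 1) by exact: is_deriveM.
have h2 := is_derive_mulr_normr z.
have := is_deriveZ 2^-1 (is_deriveD h1 h2).
move=> /is_derive_eq; apply.
rewrite [z *: 1]mulr1 [_ *: _](_ : _ = 2^-1 * (z + z + 2 * `|z|))//.
by field.
Qed.

(* A C^1 cutoff, equal to 1 on [-1/2, 1/2] and to 0 outside [-1/2 - e, 1/2 + e]; only
   the C^1 function [sqpos z = max(z, 0)^2] enters. *)
Definition cutoff (e x : R) :=
  sqpos (1 - e ^- 2 * (sqpos (x - 2^-1) + sqpos (- x - 2^-1))).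

Lemma cutoff1 e x : `|x| <= 2^-1 -> cutoff e x = 1.
Proof.
rewrite ler_norml => /andP[h1 h2]; rewrite /cutoff.
have z1 : x - 2^-1 <= 0 by lra.
have z2 : - x - 2^-1 <= 0 by lra.
by rewrite (sqpos_le0 z1) (sqpos_le0 z2) addr0 mulr0 subr0 sqpos_ge0E// expr1n.
Qed.

Lemma cutoff0 e x : 0 < e -> 2^-1 + e <= `|x| -> cutoff e x = 0.
Proof.
move=> e0 hx; rewrite /cutoff sqpos_le0// subr_le0.
rewrite -(ler_pM2l (exprn_gt0 2 e0)) mulr1 mulrA mulfV ?mul1r ?expf_neq0 ?gt_eqF//.
have [x0|x0] := lerP 0 x.
  rewrite (ger0_norm x0) in hx.
  apply: (@le_trans _ _ (sqpos (x - 2^-1))); last by rewrite lerDl sqpos_ge0.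
  by rewrite sqpos_ge0E; [rewrite lerXn2r ?nnegrE//; lra|lra].
rewrite (ltr0_norm x0) in hx.
apply: (@le_trans _ _ (sqpos (- x - 2^-1))); last by rewrite lerDr sqpos_ge0.
by rewrite sqpos_ge0E; [rewrite lerXn2r ?nnegrE//; lra|lra].
Qed.

Lemma cutoff_ge0 e x : 0 <= cutoff e x. Proof. exact: sqpos_ge0. Qed.

Lemma cutoff_le1 e x : cutoff e x <= 1.
Proof.
rewrite /cutoff; set s := 1 - _.
have s1 : s <= 1.
  rewrite /s lerBlDr lerDl mulr_ge0//; first by rewrite invr_ge0 sqr_ge0.
  by rewrite addr_ge0 ?sqpos_ge0.
have [s0|s0] := lerP s 0; first by rewrite sqpos_le0.
by rewrite sqpos_ge0E ?(ltW s0)// expr_le1// ltW.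
Qed.

Definition dcutoff (e x : R) :=
  let s := 1 - e ^- 2 * (sqpos (x - 2^-1) + sqpos (- x - 2^-1)) in
  (s + `|s|) * (- (e ^- 2 * ((x - 2^-1 + `|x - 2^-1|) - (- x - 2^-1 + `|- x - 2^-1|)))).

Lemma is_derive_cutoff (e x : R) : is_derive x 1 (cutoff e) (dcutoff e x).
Proof.
have d1 : is_derive x 1 (fun x : R => x - 2^-1) 1.
  have : is_derive x 1 (fun x : R => x - 2^-1) (1 - 0) by exact: is_deriveB.
  by rewrite subr0.
have d2 : is_derive x 1 (fun x : R => - x - 2^-1) (- 1).
  have : is_derive x 1 (fun x : R => - x - 2^-1) (- 1 - 0) by exact: is_deriveB.
  by rewrite subr0.
have e1 := is_derive1_comp (f := sqpos) (g := fun x : R => x - 2^-1) (x := x) (is_derive_sqpos (x - 2^-1)) d1.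
have e2 := is_derive1_comp (f := sqpos) (g := fun x : R => - x - 2^-1) (x := x) (is_derive_sqpos (- x - 2^-1)) d2.
have e3 := is_deriveZ (e ^- 2) (is_deriveD e1 e2).
have e4 := is_deriveB (is_derive_cst (1 : R) x 1) e3.
have := is_derive1_comp (f := sqpos) (is_derive_sqpos _) e4.
move=> /is_derive_eq; apply; rewrite /dcutoff; congr (_ * _).
rewrite [_ *: _](_ : _ = e ^- 2 * ((x - 2^-1 + `|x - 2^-1|) * 1 + (- x - 2^-1 + `|- x - 2^-1|) * (- 1)))//.
by ring.
Qed.

Lemma dcutoff0 e x : `|x| <= 2^-1 -> dcutoff e x = 0.
Proof.
rewrite ler_norml => /andP[h1 h2]; rewrite /dcutoff.
have z1 : x - 2^-1 <= 0 by lra.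
have z2 : - x - 2^-1 <= 0 by lra.
by rewrite (ler0_norm z1) (ler0_norm z2) !subrr mulr0 oppr0 mulr0.
Qed.

Let cD (f g : R -> R) : continuous f -> continuous g -> continuous (fun x => f x + g x).
Proof. by move=> cf cg x; apply: cvgD; [exact: cf|exact: cg]. Qed.
Let cM (f g : R -> R) : continuous f -> continuous g -> continuous (fun x => f x * g x).
Proof. by move=> cf cg x; apply: cvgM; [exact: cf|exact: cg]. Qed.
Let cN (f : R -> R) : continuous f -> continuous (fun x => - f x).
Proof. by move=> cf x; apply: cvgN; exact: cf. Qed.
Let cA (f : R -> R) : continuous f -> continuous (fun x => `|f x|).
Proof. by move=> cf x; apply: cvg_norm; exact: cf. Qed.
Let cC (k : R) : continuous (fun _ : R => k). Proof. by move=> x; exact: cvg_cst. Qed.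
Let cI : continuous (fun x : R => x). Proof. by move=> x; exact: cvg_id. Qed.

Lemma continuous_dcutoff e : continuous (dcutoff e).
Proof.
have a1 : continuous (fun x : R => x - 2^-1).
  exact: (cD cI (@cC (- 2^-1))).
have a2 : continuous (fun x : R => - x - 2^-1).
  exact: (cD (cN cI) (@cC (- 2^-1))).
have cS (f : R -> R) : continuous f -> continuous (fun x => sqpos (f x)).
  by move=> cf; have := (cM (@cC (2^-1)) (cD (cM cf cf) (cM cf (cA cf)))); exact.
have s1 := cD (@cC 1) (cN (cM (@cC (e ^- 2)) (cD (cS _ a1) (cS _ a2)))).
exact: (cM (cD s1 (cA s1)) (cN (cM (@cC (e ^- 2)) (cD (cD a1 (cA a1)) (cN (cD a2 (cA a2))))))).
Qed.

Lemma derive1_cutoff e x : derive1 (cutoff e) x = dcutoff e x.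
Proof. by rewrite derive1E; have [_ ->] := is_derive_cutoff e x. Qed.

Definition ramp (e k x : R) := k * x * cutoff e x.

Lemma is_derive_ramp (e k x : R) :
  is_derive x 1 (ramp e k) (k * cutoff e x + k * x * dcutoff e x).
Proof.
have d1 := is_deriveZ k (is_derive_id x (1 : R)).
have := is_deriveM d1 (is_derive_cutoff e x).
move=> /is_derive_eq; apply.
rewrite [k *: 1]mulr1 [X in X + _](_ : _ = (k * x) * dcutoff e x)//.
by rewrite [X in _ + X](_ : _ = cutoff e x * k)//; ring.
Qed.

Lemma cutoff_ramp_C1 (e k : R) :
  [/\ forall t, derivable (cutoff e) t 1, continuous (derive1 (cutoff e)),
      forall t, derivable (ramp e k) t 1 & continuous (derive1 (ramp e k))].
Proof.
have dc t : derivable (cutoff e) t 1 by have [] := is_derive_cutoff e t.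
have cc : continuous (cutoff e).
  by move=> t; apply: differentiable_continuous; exact/derivable1_diffP.
split; first exact: dc.
- by rewrite (funext (derive1_cutoff e)); exact: continuous_dcutoff.
- by move=> t; have [] := is_derive_ramp e k t.
- have E x : derive1 (ramp e k) x = k * cutoff e x + k * x * dcutoff e x.
    by rewrite derive1E; have [_ ->] := is_derive_ramp e k x.
  rewrite (funext E); exact: (cD (cM (@cC k) cc) (cM (cM (@cC k) cI) (@continuous_dcutoff e))).
Qed.

End cutoff.

(** * Calibration of the unit square *)

Section unit_square.
Context {R : realType}.

Definition usquare : set (R * R) := [set x | `|x.1| < 2^-1 /\ `|x.2| < 2^-1].

Lemma open_usquare : open usquare.
Proof.
have h (f : R * R -> R) : continuous f -> open [set x | `|f x| < 2^-1].
  move=> cf; have := @open_lt R 2^-1; move/continuousP : (continuous_normr cf); apply.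
exact: openI (h _ continuous_fst2) (h _ continuous_snd2).
Qed.

Lemma usquare0 : usquare !=set0.
Proof. by exists (0, 0); rewrite /usquare /= normr0; split; lra. Qed.

Lemma ramp_bound (e k x : R) : 0 < e -> 0 <= k -> `|ramp e k x| <= k * (2^-1 + e).
Proof.
move=> e0 k0; rewrite /ramp (normrM (k * x)) (normrM k) (ger0_norm k0) (ger0_norm (cutoff_ge0 _ _)).
rewrite -mulrA ler_wpM2l//.
have [h|h] := lerP (2^-1 + e) `|x|.
  by rewrite cutoff0// mulr0; lra.
apply: (@le_trans _ _ (`|x| * 1)); last by lra.
by rewrite ler_wpM2l// cutoff_le1.
Qed.

(* The field is [k * (x, y)] on the square, which has constant divergence [2 k]
   and norm at most 1 up to the corners. *)
Lemma perimeter_usquare (E : set (R * R)) (k : R) : 0 < k -> 2 * k ^+ 2 < 4 ->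
  measurable (E : set (plane R)) -> E `<=` usquare ->
  ((2 * k)%:E * lebesgue2 R E <= perimeter E)%E.
Proof.
move=> k0 k2 mE EQ.
(* The norm of the truncated field is at most its value sqrt 2 k (1/2 + e) at the corners of the
   enlarged square; since k < sqrt 2, a small e keeps this below 1. The bound e <= 1/2 keeps the
   support in [-1, 1]^2. *)
have [e [e0 e1 ke]] : exists e : R, [/\ 0 < e, e <= 2^-1 & 2 * (k * (2^-1 + e)) ^+ 2 <= 1].
  have k1 : k < Num.sqrt 2.
    by rewrite -(gtr0_norm k0) -sqrtr_sqr ltr_sqrt//; lra.
  have s0 : 0 < Num.sqrt 2 :> R by rewrite sqrtr_gt0.
  have ss : Num.sqrt 2 ^+ 2 = 2 :> R by rewrite sqr_sqrtr.
  exists (Num.min 2^-1 ((Num.sqrt 2 / k - 1) / 2)).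
  have h : 0 < (Num.sqrt 2 / k - 1) / 2.
    by rewrite divr_gt0// subr_gt0 ltr_pdivlMr// mul1r.
  split; first by rewrite lt_min h andbT; lra.
    by rewrite ge_min lexx.
  set m := Num.min _ _.
  have hm : m <= (Num.sqrt 2 / k - 1) / 2 by rewrite /m ge_min lexx orbT.
  have m0 : 0 < m by rewrite /m lt_min h andbT; lra.
  have : k * (2^-1 + m) <= Num.sqrt 2 / 2.
    apply: (@le_trans _ _ (k * (2^-1 + (Num.sqrt 2 / k - 1) / 2))).
      by rewrite ler_pM2l// lerD2l.
    by rewrite le_eqVlt; apply/orP; left; apply/eqP; field; rewrite gt_eqF.
  move=> hk; have : (k * (2^-1 + m)) ^+ 2 <= (Num.sqrt 2 / 2) ^+ 2.
    have a1 : 0 <= k * (2^-1 + m) by rewrite mulr_ge0 ?(ltW k0)//; lra.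
    have a2 : 0 <= Num.sqrt 2 / 2 :> R by lra.
    by rewrite lerXn2r ?nnegrE.
  rewrite expr_div_n ss; lra.
have [dc cc dr cr] := cutoff_ramp_C1 e k.
have [f1C f1x f1y] := C1_tensor dr cr dc cc.
have [f2C f2x f2y] := C1_tensor dc cc dr cr.
pose phi (x : R * R) : R * R := (ramp e k x.1 * cutoff e x.2, cutoff e x.1 * ramp e k x.2).
have phiC1 : C1 phi by exact: C1_pair f1C f2C.
have phi1 x : enorm (phi x) <= 1.
  rewrite -(ler_sqr (enorm_ge0 _)) ?nnegrE// sqr_enorm expr1n /phi/=
    (exprMn 2 (ramp e k x.1) (cutoff e x.2)) (exprMn 2 (cutoff e x.1) (ramp e k x.2)).
  have b x' : ramp e k x' ^+ 2 <= (k * (2^-1 + e)) ^+ 2.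
    have a1 : 0 <= k * (2^-1 + e) by rewrite mulr_ge0 ?(ltW k0)//; lra.
    by rewrite -(real_normK (num_real (ramp e k x'))) lerXn2r ?nnegrE// ramp_bound// ltW.
  have c x' : cutoff e x' ^+ 2 <= 1 by rewrite expr_le1 ?cutoff_ge0// cutoff_le1.
  have c0 x' : 0 <= cutoff e x' ^+ 2 by exact: sqr_ge0.
  have r0 x' : 0 <= ramp e k x' ^+ 2 by exact: sqr_ge0.
  apply: (@le_trans _ _ (ramp e k x.1 ^+ 2 * 1 + 1 * ramp e k x.2 ^+ 2)).
    exact: (lerD (ler_wpM2l (r0 _) (c _)) (ler_wpM2r (r0 _) (c _))).
  by have := b x.1; have := b x.2; lra.
have suppK : closure [set x | phi x != 0] `<=` `[-1, 1] `*` `[-1, 1].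
  rewrite [X in _ `<=` X](closure_id _).1; last first.
    by apply: (compact_closed (@norm_hausdorff _ _)); exact: compact_box.
  apply: closure_subset => -[x y] /=; apply: contraNP => h.
  have z t : ~~ (-1 <= t <= 1) -> cutoff e t = 0.
    move=> ht; apply: cutoff0 => //; apply: (@le_trans _ _ 1); first lra.
    rewrite leNgt; apply: contraNN ht; rewrite ltr_norml => /andP[? ?]; apply/andP; split; lra.
  apply/eqP; rewrite /phi /ramp /=.
  have [hx|/z ->] := boolP (-1 <= x <= 1); last by rewrite !(mulr0, mul0r).
  have [hy|/z ->] := boolP (-1 <= y <= 1); last by rewrite !(mulr0, mul0r).
  by exfalso; apply: h; split; rewrite /= in_itv.
have div_phi x : E x -> divergence phi x = 2 * k.
  move=> /EQ[/ltW x1 /ltW x2]; rewrite /divergence.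
  rewrite (_ : fst \o phi = (fun x => ramp e k x.1 * cutoff e x.2))// f1x.
  rewrite (_ : snd \o phi = (fun x => cutoff e x.1 * ramp e k x.2))// f2y.
  have rE t : `|t| <= 2^-1 -> derive1 (ramp e k) t = k.
    move=> ht; rewrite derive1E; have [_ ->] := is_derive_ramp e k t.
    by rewrite cutoff1// dcutoff0// mulr0 addr0 mulr1.
  by rewrite !rE// !cutoff1//; ring.
have -> : ((2 * k)%:E * lebesgue2 R E = \int[lebesgue2 R]_(x in E) (divergence phi x)%:E)%E.
  rewrite (eq_integral (cst (2 * k)%:E)); last first.
    by move=> x; rewrite inE => Ex; rewrite div_phi.
  by rewrite integral_cst.
apply: ereal_sup_ubound; exists phi => //; split=> //; split=> //.
apply: subclosed_compact suppK; first exact: closed_closure.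
exact: compact_box.
Qed.

Lemma usquare_measure_lty (E : set (R * R)) : measurable (E : set (plane R)) ->
  E `<=` usquare -> (lebesgue2 R E < +oo)%E.
Proof.
move=> mE EQ; apply: (@le_lt_trans _ _ (lebesgue2 R (`[-1, 1] `*` `[-1, 1]))).
  apply: le_measure; rewrite ?inE//; first exact: measurable_box.
  move=> [x y] /EQ[/=]; rewrite !ltr_norml => /andP[? ?] /andP[? ?].
  by split; rewrite /= in_itv/=; apply/andP; split; lra.
by rewrite box_measure ?ltry//; lra.
Qed.

Lemma cheeger_usquare : ((2 * Num.sqrt 2)%:E <= cheeger usquare)%E.
Proof.
have s0 : 0 < Num.sqrt 2 :> R by rewrite sqrtr_gt0.
have ss : Num.sqrt 2 ^+ 2 = 2 :> R by rewrite sqr_sqrtr.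
apply: le_ereal_inf_tmp => _ [E [mE cE sE E0] <-].
have EQ : E `<=` usquare by apply: subset_trans sE; exact: subset_closure.
have := usquare_measure_lty mE EQ.
have P0 := perimeter_ge0 E.
have H k : 0 < k -> k < Num.sqrt 2 -> ((2 * k)%:E * lebesgue2 R E <= perimeter E)%E.
  move=> k0 ks; apply: perimeter_usquare => //.
  suff : k ^+ 2 < Num.sqrt 2 ^+ 2 by rewrite ss; lra.
  by rewrite ltrXn2r// ltW.
move: E0 H P0; case: (lebesgue2 R E) => // m m0 H P0 _; rewrite lte_fin in m0.
rewrite inver gt_eqF// lee_pdivlMr// -EFinM.
case: (perimeter E) P0 H => [r| |]//; last by move=> _ _; rewrite leey.
rewrite !lee_fin => r0 H.
have m2 : 0 < 2 * m by rewrite mulr_gt0.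
suff : Num.sqrt 2 <= r / (2 * m) by rewrite ler_pdivlMr//; lra.
rewrite leNgt; apply/negP; set t := r / (2 * m) => ts.
have t0 : 0 <= t by rewrite divr_ge0// ltW.
(* The calibration is available only for k strictly below sqrt 2. If half the quotient of E, here t,
   were smaller than sqrt 2, the midpoint of the two would be an admissible k larger than t. *)
have := H ((t + Num.sqrt 2) / 2); rewrite -EFinM lee_fin.
have k1 : 0 < (t + Num.sqrt 2) / 2 by lra.
have k2 : (t + Num.sqrt 2) / 2 < Num.sqrt 2 by lra.
move=> /(_ k1 k2).
have -> : r = 2 * t * m by rewrite /t; field; rewrite gt_eqF.
by rewrite ler_pM2r// => ?; lra.
Qed.

End unit_square.

(** * Comparison with the square *)

Section comparison_with_square.
Context {R : realType}.
Implicit Types (p q : \bar R) (Om : set (R * R)).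

(** Poincare constants are real numbers while [lambda] takes values in the extended reals, so x is
    tested on the reals below it. The case x = +oo is included and forces y = +oo. *)
Lemma le_scale_approx (k : R) (x y : \bar R) : 0 < k -> (0 <= x)%E ->
  (forall c : R, 0 <= c -> ((k * c)%:E <= x)%E -> (c%:E <= y)%E) ->
  (x <= k%:E * y)%E.
Proof.
move=> k0; case: x => [x| |]// x0 H.
  have h := H (x / k); rewrite divr_ge0 ?(ltW k0)// in h.
  have -> : x = k * (x / k) by rewrite mulrC divfK ?gt_eqF.
  rewrite EFinM lee_pmul2l// h// mulrC divfK ?gt_eqF//.
have -> : y = +oo%E; last by rewrite gt0_muley// lte_fin.
case: y H => [y| |] // H.
  have := H (`|y| + 1); rewrite addr_ge0// leey lee_fin => /(_ isT isT) h.
  by exfalso; have := ler_norm y; lra.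
by have := H 0; rewrite lexx leey => /(_ isT isT).
Qed.

Lemma sqrt2_ge1 : 1 <= Num.sqrt 2 :> R.
Proof. by rewrite -[leLHS]sqrtr1 ler_wsqrtr// ler1n. Qed.

Lemma inradius_usquare_ge : ((2^-1)%:E <= inradius (usquare : set (R * R)))%E.
Proof.
apply: ereal_sup_ubound; exists 2^-1 => //; split; first by rewrite invr_gt0.
exists 0 => x; rewrite /eball/= subr0 => h; have [h1 h2] := enorm_ge_coords x.
by split; [exact: le_lt_trans h1 h|exact: le_lt_trans h2 h].
Qed.

Lemma inradius_thin_le Om :
  (forall x y y', Om (x, y) -> Om (x, y') -> `|y - y'| < 1) ->
  (inradius Om <= (2^-1)%:E)%E.
Proof.
move=> hOm; apply: ge_ereal_sup => _ [r [r0 [x hx]] <-].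
rewrite lee_fin leNgt; apply/negP => r2.
have b (t : R) : `|t| < r -> Om (x.1, x.2 + t).
  move=> tr; apply: hx; rewrite /eball/= /enorm/= subrr expr0n/= add0r.
  by rewrite addrAC subrr add0r sqrtr_sqr.
have h1 : `|2^-1 : R| < r by rewrite ger0_norm; lra.
have h2 : `|- 2^-1 : R| < r by rewrite normrN.
have := hOm _ _ _ (b _ h1) (b _ h2).
by rewrite (_ : x.2 + 2^-1 - (x.2 - 2^-1) = 1); [rewrite normr1 ltxx|field].
Qed.

(** Once the chords are scaled to length less than 1, constants are extracted from the square and
    inserted into Om. On the unit square the products cost 2^(p/2-1) (1 + 1) = 2^(p/2), whose p-th
    root is sqrt 2. *)
Lemma lambda_root_thin p Om (m : R) : (2%:E <= p)%E -> 0 < m -> open Om -> Om !=set0 ->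
  (forall x y y', Om (x, y) -> Om (x, y') -> `|y - y'| < m) ->
  (((Num.sqrt 2 * m)^-1)%:E * lambda_root p usquare <= lambda_root p Om)%E.
Proof.
move=> p2 m0 oO O0 hOm.
have s1 := sqrt2_ge1.
have s0 : 0 < Num.sqrt 2 :> R by rewrite sqrtr_gt0.
have sm0 : 0 < Num.sqrt 2 * m by rewrite mulr_gt0.
rewrite lee_pdivrMl//.
have sT : similarity m (simil m 1 0 0 0).
  by exists 1, 0, 0, 0; split=> //; rewrite expr1n expr0n/= addr0.
have p1 : (1 <= p)%E by apply: le_trans p2; rewrite lee_fin ler1n.
rewrite EFinM -muleA -(lambda_root_similarity Om p1 sT).
set Om1 := _ @^-1` Om.
have hOm1 x y y' : Om1 (x, y) -> Om1 (x, y') -> `|y - y'| < 1.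
  rewrite /Om1 /simil /= !(mul0r, mul1r, add0r, addr0, subr0) => h h'.
  have := hOm _ _ _ h h'; rewrite -mulrBr normrM gtr0_norm// -ltr_pdivlMl// mulVf//.
  by rewrite gt_eqF.
have oQ := @open_usquare R; have Q0 := @usquare0 R.
case: p p1 p2 => [p| |]//; rewrite ?lee_fin => p1 p2; last first.
  clear p1 p2.
  rewrite !lambda_root_pinfty.
  (* For p = +oo the inradii compare directly, by way of 1/2, and the factor sqrt 2 >= 1 is added at
     the end. *)
  have iQ := inradius_usquare_ge; have iO := inradius_thin_le hOm1.
  have oO1 : open Om1.
    by move/continuousP : (similarity_continuous sT); apply.
  have O10 : Om1 !=set0.
    have [S [_ _ ST]] := similarity_inv sT; case: O0 => z Oz.
    by exists (S z); rewrite /Om1 /= ST.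
  have iO0 := inradius_ge0 oO1 O10; have iQ0 := inradius_ge0 oQ Q0.
  apply: (@le_trans _ _ (inradius Om1)^-1%E).
    by rewrite lee_pV2 ?inE//; exact: le_trans iQ.
  rewrite -[leLHS]mul1e; apply: lee_wpmul2r; first by rewrite inve_ge0.
  by rewrite lee_fin.
have p0 : 0 < p by lra.
rewrite !lambda_root_fin (_ : (p == 1) = false); last by apply/negbTE; rewrite gt_eqF//; lra.
have -> : Num.sqrt 2 = (2 `^ (p / 2)) `^ p^-1 :> R.
  rewrite -powRrM mulrAC mulfV ?gt_eqF// mul1r powR12_sqrt//.
rewrite -poweR_EFin -poweRM ?lambda_ge0 ?lee_fin ?powR_ge0//.
apply: le_poweR; [by rewrite invr_ge0 ltW|exact: lambda_ge0|].
apply: le_scale_approx; [by rewrite powR_gt0|exact: lambda_ge0|] => c c0 hc.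
apply: (lambda_ge_thin c0 p0 _ hOm1).
apply: (@poincare_of_lambda _ p usquare (2 `^ (p / 2 - 1)) 1 1 (- 2^-1) (- 2^-1) c) => //.
- by move=> X Y; exact: enorm_powR_ge2.
- move=> x y hx hy; rewrite /usquare /= !ltr_norml; split; lra.
- rewrite invr1 powR1.
  have -> : 2 `^ (p / 2 - 1) * (1 + 1) = 2 `^ (p / 2) :> R; last by [].
  rewrite powRB ?powRr1//; first by field.
  by apply/implyP; rewrite pnatr_eq0.
Qed.

(** The exchange in the opposite direction: constants are extracted from the rectangle, at cost A^q
    + B^q since q <= 2, and inserted into the open square, whose chords in both directions are
    shorter than 1. Subadditivity of t^(1/q) turns the q-th root of A^q + B^q into A + B. *)
Lemma lambda_root_rectangle q Om (a b x y : R) : (1 <= q)%E -> (q <= 2%:E)%E -> a < b -> x < y ->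
  `[a, b] `*` `[x, y] `<=` Om ->
  (lambda_root q Om <=
   (((b - a)^-1 + (y - x)^-1) / Num.sqrt 2)%:E * lambda_root q usquare)%E.
Proof.
move=> q1 q2 ab xy BOm.
have s0 : 0 < Num.sqrt 2 :> R by rewrite sqrtr_gt0.
have A0 : 0 < (b - a)^-1 by rewrite invr_gt0 subr_gt0.
have B0 : 0 < (y - x)^-1 by rewrite invr_gt0 subr_gt0.
set A := (b - a)^-1 in A0 *; set B := (y - x)^-1 in B0 *.
have AB0 : 0 < A + B by rewrite addr_gt0.
case: q q1 q2 => [q| |]//; rewrite !lee_fin => q1 q2.
rewrite !lambda_root_fin; case: (eqVneq q 1) => [_|qn].
  apply: (le_trans (cheeger_rectangle ab xy BOm)).
  apply: (@le_trans _ _ (((A + B) / Num.sqrt 2)%:E * (2 * Num.sqrt 2)%:E)%E).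
    rewrite -EFinM lee_fin le_eqVlt; apply/orP; left; apply/eqP.
    by rewrite /A /B; field; rewrite !subr_eq0 !gt_eqF.
  by apply: lee_wpmul2l; [rewrite lee_fin divr_ge0// ltW|exact: cheeger_usquare].
have q12 : 1 < q by rewrite lt_neqAle eq_sym qn.
have q0 : 0 < q by lra.
have K0 : 0 < A `^ q + B `^ q by rewrite addr_gt0// powR_gt0.
have Q0 := lambda_ge0 q (usquare : set (R * R)); have O0 := lambda_ge0 q Om.
have main : (lambda q Om <= ((A `^ q + B `^ q) / 2 `^ (q / 2))%:E * lambda q usquare)%E.
  have : (lambda q Om <= (A `^ q + B `^ q)%:E * ((2 `^ (q / 2))^-1%:E * lambda q usquare))%E.
    apply: le_scale_approx => // c c0 hc.
    rewrite lee_pdivlMl ?powR_gt0// -EFinM.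
    apply: lambda_ge_square => //; first by rewrite q0 q2.
    - apply: (@poincare_of_lambda _ q Om 1 (b - a) (y - x) a x c) => //; rewrite ?subr_gt0 ?mul1r//.
      + by move=> X Y; rewrite mul1r; apply: enorm_powR_le2; rewrite q0 q2.
      + move=> s t hs ht; apply: BOm; split; rewrite /= in_itv/=; apply/andP; split; lra.
    - by move=> s t t' [/= _]; rewrite ltr_norml => h1 [/= _]; rewrite ltr_norml => h2; rewrite ltr_norml; lra.
    - by move=> s t t' [/=]; rewrite ltr_norml => h1 _ [/=]; rewrite ltr_norml => h2 _; rewrite ltr_norml; lra.
  by rewrite muleA -EFinM.
have qi0 : 0 <= q^-1 by rewrite invr_ge0 ltW.
apply: (le_trans (le_poweR qi0 O0 main)).
have K1 : 0 <= (A `^ q + B `^ q) / 2 `^ (q / 2) by rewrite divr_ge0 ?powR_ge0// ltW.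
rewrite poweRM ?lee_fin// poweR_EFin; apply: lee_wpmul2r; first exact: poweR_ge0.
have i0 : 0 <= (2 `^ (q / 2))^-1 :> R by rewrite invr_ge0 powR_ge0.
rewrite lee_fin powRM ?(ltW K0)//.
have -> : ((2 `^ (q / 2))^-1) `^ q^-1 = (Num.sqrt 2)^-1 :> R.
  rewrite -powRN -powRrM mulNr mulrAC mulfV ?gt_eqF// mul1r powRN powR12_sqrt//.
rewrite ler_wpM2r ?invr_ge0 ?(ltW s0)//.
have := @powRD_le_subadditive R q^-1 (A `^ q) (B `^ q) _ (powR_ge0 _ _) (powR_ge0 _ _).
rewrite -!powRrM mulfV ?gt_eqF// !powRr1 ?(ltW A0) ?(ltW B0)//; apply.
by rewrite invr_gt0 q0 invf_le1.
Qed.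

End comparison_with_square.

(** * Normalisation of convex domains *)

Section convex_domains.
Context {R : realType}.
Implicit Types (Om : set (R * R)) (s t : R).
Local Notation mu := (@lebesgue_measure R).

Lemma convex_setP Om : convex_set (M := (R * R)%type) Om <->
  forall (x y : R * R) t, 0 <= t <= 1 -> Om x -> Om y ->
    Om (t * x.1 + (1 - t) * y.1, t * x.2 + (1 - t) * y.2).
Proof.
split=> [cO x y t /andP[t0 t1] Ox Oy|cO x y t].
  have := cO x y (Itv01 t0 t1); rewrite !inE => /(_ Ox Oy).
  by move=> h; exact: h.
rewrite !inE => Ox Oy.
have t01 : 0 <= t%:num <= 1 by apply/andP; split; [exact: ge0|exact: le1].
exact: (cO x y t%:num t01 Ox Oy).
Qed.

Lemma A2convex_open Om : A2convex Om -> open Om. Proof. by case. Qed.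

Lemma A2convex_neq0 Om : A2convex Om -> Om !=set0.
Proof.
move=> [_ _ O0 _]; apply/set0P/negP => /eqP O; move: O0.
by rewrite O measure0 ltxx.
Qed.

Lemma A2convex_similarity s (T : R * R -> R * R) Om : similarity s T -> A2convex Om ->
  A2convex (T @^-1` Om).
Proof.
move=> sT [oO cO O0 Oy].
have s0 := similarity_gt0 sT.
have mO : measurable (Om : set (plane R)) by exact: open_measurable_plane.
split.
- by move/continuousP : (similarity_continuous sT); apply.
- apply/convex_setP => x y t t01 /= Ox Oy'.
  move/convex_setP : cO => /(_ _ _ t t01 Ox Oy').
  move: sT => [c [d [b1 [b2 [_ _ _ ->]]]]]; rewrite /simil/=.
  by congr Om; congr pair; ring.
- by rewrite (measure_similarity sT mO) mule_gt0// lte_fin invr_gt0 exprn_gt0.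
- rewrite (measure_similarity sT mO); move: Oy; case: (lebesgue2 R Om) O0 => // m _ _.
  by rewrite -EFinM ltry.
Qed.

(** The quarter turn transfers a bound on one side successively to the other three. *)
Lemma rotation_similarity : similarity 1 (simil (1 : R) 0 1 0 0).
Proof. by exists 0, 1, 0, 0; split=> //; rewrite expr0n/= expr1n add0r. Qed.

(** Om contains the triangle with apex P over a vertical segment of length 2 e through x. Over the
    half of its width nearest to x its sections have length at least e, so the measure of Om is at
    least e d / 2, which bounds the horizontal distance d of P. *)
Lemma A2convex_ubound_fst Om : A2convex Om -> exists M : R, forall x, Om x -> x.1 <= M.
Proof.
move=> AO; have [[x1 x2] Ox] := A2convex_neq0 AO; have [oO cO O0 Oy] := AO.
move/convex_setP in cO.
have [e [e0 ex]] := nbhs_box (open_nbhs_nbhs (conj oO Ox)); rewrite /= in ex.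
have mO : measurable (Om : set (plane R)) by exact: open_measurable_plane.
have [V OV] : exists V : R, lebesgue2 R Om = V%:E.
  by case: (lebesgue2 R Om) O0 Oy => // V; exists V.
exists (x1 + 2 * V / e) => -[P1 P2] OP /=.
have V0 : 0 < V by rewrite OV lte_fin in O0.
have [Px|Px] := lerP P1 x1; first by rewrite ler_wpDr// divr_ge0// ?ltW// mulr_gt0.
rewrite -lerBlDl ler_pdivlMr//.
set d := P1 - x1; have d0 : 0 < d by rewrite subr_gt0.
suff : ((e * (d / 2))%:E <= lebesgue2 R Om)%E by rewrite OV lee_fin; lra.
have I : (\int[mu]_s (e * \1_(`[x1, x1 + d / 2]) s)%:E = (e * (d / 2))%:E)%E.
  under eq_integral do rewrite EFinM.
  rewrite ge0_integralZl_EFin//; [|by apply/measurable_EFinP; exact: measurable_indic|exact: ltW].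
  rewrite integral_indic// setIT EFinM; congr (_ * _)%E.
  have le1 : x1 <= x1 + d / 2 by lra.
  by apply: (etrans (segment_measure le1)); congr EFin; ring.
rewrite -I; apply: ge0_le_integral => //.
- by move=> s _; rewrite lee_fin mulr_ge0// ltW.
- by apply/measurable_EFinP; apply: measurable_funM => //; exact: measurable_indic.
- exact: measurable_fun_xsection.
move=> s _; rewrite indicE; case: (boolP (s \in _)); rewrite ?mulr0 ?measure_ge0//= mulr1.
rewrite inE/= in_itv/= => /andP[s1 s2].
pose t := (s - x1) / d.
have t0 : 0 <= t by rewrite divr_ge0 ?subr_ge0// ltW.
have t2 : t <= 2^-1 by rewrite ler_pdivrMr//; lra.
pose y0 := t * P2 + (1 - t) * x2.
have sub : `[y0 - e / 2, y0 + e / 2] `<=` xsection Om s.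
  move=> y; rewrite /= in_itv/= => /andP[h1 h2]; apply/xsectionP.
  have Q : Om (x1, x2 + (y - y0) / (1 - t)).
    have t1 : 0 < 1 - t by lra.
    have h3 : - e <= (y - y0) / (1 - t) <= e.
      by rewrite ler_pdivlMr// ler_pdivrMr//; apply/andP; split; nra.
    by apply: ex; split; rewrite /= in_itv/=; apply/andP; split; lra.
  have t01 : 0 <= t <= 1 by apply/andP; split; lra.
  have := cO _ _ t t01 OP Q; congr Om; congr pair => /=.
    rewrite /t -/d (_ : P1 = x1 + d); last by rewrite /d; ring.
    by field; rewrite gt_eqF.
  rewrite mulrDr mulrCA mulfV; last by rewrite subr_eq0 eq_sym lt_eqF//; lra.
  by rewrite /y0; ring.
have y0e : y0 - e / 2 <= y0 + e / 2 by lra.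
have -> : e%:E = mu `[y0 - e / 2, y0 + e / 2].
  by apply/esym; apply: (etrans (segment_measure y0e)); congr EFin; field.
by apply: le_measure => //; rewrite inE; [exact: measurable_itv|exact: measurable_xsection].
Qed.

Lemma A2convex_ubound_snd Om : A2convex Om -> exists M : R, forall x, Om x -> x.2 <= M.
Proof.
move=> AO; have [M hM] := A2convex_ubound_fst (A2convex_similarity rotation_similarity AO).
exists M => -[x1 x2] Ox; apply: (hM (x2, - x1)).
by move: Ox; rewrite /simil/=; congr Om; congr pair; ring.
Qed.

Lemma A2convex_lbound_fst Om : A2convex Om -> exists M : R, forall x, Om x -> - x.1 <= M.
Proof.
move=> AO; have [M hM] := A2convex_ubound_snd (A2convex_similarity rotation_similarity AO).
exists M => -[x1 x2] Ox; apply: (hM (x2, - x1)).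
by move: Ox; rewrite /simil/=; congr Om; congr pair; ring.
Qed.

Lemma A2convex_lbound_snd Om : A2convex Om -> exists M : R, forall x, Om x -> - x.2 <= M.
Proof.
move=> AO; have [M hM] := A2convex_lbound_fst (A2convex_similarity rotation_similarity AO).
exists M => -[x1 x2] Ox; apply: (hM (x2, - x1)).
by move: Ox; rewrite /simil/=; congr Om; congr pair; ring.
Qed.

Lemma enorm_le_sum (x : R * R) : enorm x <= `|x.1| + `|x.2|.
Proof.
have h : 0 <= `|x.1| + `|x.2| by rewrite addr_ge0.
rewrite -(ler_sqr (enorm_ge0 _)) ?nnegrE// sqr_enorm sqrrD.
rewrite !real_normK ?num_real// -addrA [X in _ <= _ + X]addrC lerD2l lerDl.
by rewrite mulrn_wge0// mulr_ge0.
Qed.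

Lemma A2convex_bounded Om : A2convex Om -> exists M : R, forall x, Om x -> enorm x <= M.
Proof.
move=> AO.
have [M1 h1] := A2convex_ubound_fst AO; have [M2 h2] := A2convex_ubound_snd AO.
have [M3 h3] := A2convex_lbound_fst AO; have [M4 h4] := A2convex_lbound_snd AO.
exists ((`|M1| + `|M3|) + (`|M2| + `|M4|)) => x Ox.
apply: (le_trans (enorm_le_sum x)); apply: lerD.
  rewrite ler_norml; apply/andP; split.
    have := h3 _ Ox; have := ler_norm M3; have := normr_ge0 M1; lra.
  have := h1 _ Ox; have := ler_norm M1; have := normr_ge0 M3; lra.
rewrite ler_norml; apply/andP; split.
  have := h4 _ Ox; have := ler_norm M4; have := normr_ge0 M2; lra.
have := h2 _ Ox; have := ler_norm M2; have := normr_ge0 M4; lra.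
Qed.

(** The points (0, 0) and (1, 0) are nearly a diameter. The supremum of the distances is not
    attained in an open set, so a pair at more than half of it is used, whence the bound 2. *)
Definition normalised Om := [/\ A2convex Om, Om (0, 0), Om (1, 0) &
  forall x, Om x -> enorm x < 2].

Lemma enormB (x y : R * R) : enorm (x - y) = enorm (y - x).
Proof. by rewrite /enorm/=; congr Num.sqrt; ring. Qed.

Lemma enorm_triangle (x y : R * R) : enorm (x + y) <= enorm x + enorm y.
Proof.
have h : 0 <= enorm x + enorm y by rewrite addr_ge0 ?enorm_ge0.
rewrite -(ler_sqr (enorm_ge0 _)) ?nnegrE// sqrrD !sqr_enorm/=.
have cs : x.1 * y.1 + x.2 * y.2 <= enorm x * enorm y.
  apply: le_trans (ler_norm _) _.
  rewrite -(ler_sqr (normr_ge0 _)) ?nnegrE ?mulr_ge0 ?enorm_ge0//.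
  rewrite real_normK ?num_real// exprMn !sqr_enorm -subr_ge0.
  rewrite (_ : _ - _ = (x.1 * y.2 - x.2 * y.1) ^+ 2) ?sqr_ge0//; ring.
by rewrite mulr2n; lra.
Qed.

Lemma A2convex_normalise Om : A2convex Om ->
  exists s (T : R * R -> R * R), similarity s T /\ normalised (T @^-1` Om).
Proof.
move=> AO; have [M hM] := A2convex_bounded AO.
have [[x1 x2] Ox] := A2convex_neq0 AO; have [oO _ _ _] := AO.
have [e [e0 ex]] := nbhs_box (open_nbhs_nbhs (conj oO Ox)); rewrite /= in ex.
pose S : set R := [set r | exists x y, [/\ Om x, Om y & r = enorm (y - x)]].
have Se : S e.
  exists (x1, x2), (x1 + e, x2); split=> //.
    by apply: ex; split; rewrite /= in_itv/=; apply/andP; split; lra.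
  by rewrite /enorm/= addrAC subrr add0r subrr expr0n/= addr0 sqrtr_sqr gtr0_norm.
have hS : has_sup S.
  split; first by exists e.
  exists (M + M) => _ [x [y [Ox' Oy' ->]]].
  apply: (le_trans (enorm_triangle _ _)); apply: lerD; first exact: hM.
  by rewrite -[X in enorm X]sub0r -enormB subr0; exact: hM.
have eS : e <= sup S by apply: sup_upper_bound.
have D0 : 0 < sup S / 2 by apply: divr_gt0 => //; exact: lt_le_trans eS.
have [l [a [b [Oa Ob ->]]]] := sup_adherent D0 hS.
rewrite (_ : sup S - sup S / 2 = sup S / 2); last by field.
(* Exchanging the endpoints makes the angle admissible for [similarity]. *)
wlog ab : a b Oa Ob / 0 <= (b - a).1.
  move=> W; have [h|h] := lerP 0 (b - a).1; first exact: (W a b).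
  by rewrite enormB; apply: (W b a) => //; move: h => /=; lra.
set L := enorm (b - a) => hL.
have L0 : 0 < L by exact: lt_trans hL.
have Ln : L != 0 by rewrite gt_eqF.
have cd : ((b - a).1 / L) ^+ 2 + ((b - a).2 / L) ^+ 2 = 1.
  rewrite !expr_div_n -mulrDl -sqr_enorm -/L mulfV// expf_neq0//.
pose T := simil L ((b - a).1 / L) ((b - a).2 / L) a.1 a.2.
have sT : similarity L T.
  exists ((b - a).1 / L), ((b - a).2 / L), a.1, a.2; split=> //.
  by rewrite divr_ge0// ltW.
have T0 : T (0, 0) = a.
  by rewrite /T /simil/= !mulr0 subr0 addr0 mulr0 !add0r; case: (a).
have T1 : T (1, 0) = b.
  rewrite /T /simil/= !mulr1 !mulr0 subr0 addr0 ![L * _]mulrC !divfK//= !subrK.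
  by case: (b).
exists L, T; split=> //; split.
- exact: (A2convex_similarity sT AO).
- by rewrite /= T0.
- by rewrite /= T1.
- move=> x /= OTx; have := similarity_enorm x 0 sT.
  rewrite subr0 (_ : T 0 = a)// => h.
  rewrite -(ltr_pM2l L0) -h.
  have : enorm (T x - a) <= sup S by apply: sup_upper_bound => //; exists a, (T x).
  by lra.
Qed.

End convex_domains.

(** * Thin domains against fat domains *)

Section thin_or_fat.
Context {R : realType}.
Implicit Types (Om : set (R * R)) (p q : \bar R).

(* [r]-fat domains: a class of convex sets that is compact for the Hausdorff distance
   modulo closures. *)
Definition fat (r : R) Om := [/\ open Om, convex_set (M := (R * R)%type) Om,
  eball 0 r `<=` Om & Om `<=` eball 0 4].

Lemma convex3 Om (x y z : R * R) (a b c : R) : convex_set (M := (R * R)%type) Om ->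
  Om x -> Om y -> Om z -> 0 <= a -> 0 <= b -> 0 <= c -> a + b + c = 1 ->
  Om (a * x.1 + b * y.1 + c * z.1, a * x.2 + b * y.2 + c * z.2).
Proof.
move=> /convex_setP cO Ox Oy Oz a0 b0 c0 abc.
have [c1|c1] := eqVneq c 1.
  have -> : a = 0 by lra.
  have -> : b = 0 by lra.
  by rewrite c1 !mul0r !add0r !mul1r; case: z Oz.
have cc : 0 < 1 - c by move: c1; rewrite neq_lt => /orP[|]; lra.
have t01 : 0 <= a / (1 - c) <= 1.
  by rewrite divr_ge0 ?(ltW cc)//= ler_pdivrMr//; lra.
have s01 : 0 <= c <= 1 by apply/andP; split; lra.
have := cO _ _ c s01 Oz (cO _ _ _ t01 Ox Oy); congr Om.
have bE : b = 1 - c - a by lra.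
by congr pair => /=; rewrite bE; field; rewrite gt_eqF.
Qed.

(* A vertical chord of length at least [k] has an endpoint at height at least [k / 2], which
   together with (0, 0) and (1, 0) spans a triangle; [T] moves its centroid to the origin. *)
Lemma fat_or_thin Om (k : R) : 0 < k -> normalised Om ->
  (forall x y y', Om (x, y) -> Om (x, y') -> `|y - y'| < k) \/
  exists T : R * R -> R * R, similarity 1 T /\ fat (k / (3 * (k + 6))) (T @^-1` Om).
Proof.
move=> k0 [AO O0 O1 O2]; have [oO cO _ _] := AO.
have [h|/existsNP[x /existsNP[y /existsNP[y' /not_implyP[Oy /not_implyP[Oy' /negP]]]]]] :=
  pselect (forall x y y', Om (x, y) -> Om (x, y') -> `|y - y'| < k); first by left.
rewrite -leNgt => kyy; right.
have [P2 [OP kP]] : exists P2, Om (x, P2) /\ k <= 2 * `|P2|.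
  have [h|h] := lerP k (2 * `|y|); first by exists y.
  exists y'; split=> //; have := ler_normB y y'; lra.
have [xb Pb] : `|x| < 2 /\ `|P2| < 2.
  have [h1 h2] := enorm_ge_coords (x, P2); have := O2 _ OP.
  by split; [exact: le_lt_trans h1 _|exact: le_lt_trans h2 _].
have P0 : 0 < `|P2| by lra.
have Pn : P2 != 0 by rewrite -normr_gt0.
(* The radius solves 6 r / k + r = 1/3. Moving the centroid by w changes the three barycentric
   weights by at most |w1| + 3 |be|, where be = w2 / P2 is at most 2 r / k in absolute value; hence
   the weights stay nonnegative. *)
set r := k / (3 * (k + 6)).
have k6 : 0 < k + 6 by lra.
have r0 : 0 < r by rewrite divr_gt0// mulr_gt0.
have rk : r * (k + 6) = k / 3 by rewrite /r; field; rewrite gt_eqF.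
pose z1 := (1 + x) / 3; pose z2 := P2 / 3.
have ball w1 w2 : `|w1| < r -> `|w2| < r -> Om (w1 + z1, w2 + z2).
  move=> h1 h2; set be := w2 / P2.
  have hbe : `|be| * k <= 2 * r.
    rewrite /be normrM normfV.
    have : `|w2| / `|P2| * k <= `|w2| * 2.
      rewrite mulrAC ler_pdivrMr// -mulrA ler_wpM2l//; lra.
    by lra.
  have hb : `|be| * (k * 3) + r * k <= k / 3 by nra.
  have hb' : `|be| * 3 + r <= 1 / 3.
    rewrite -(ler_pM2r k0); lra.
  have bx : `|x * be| <= 2 * `|be| by rewrite normrM ler_wpM2r// ltW.
  move: hb' bx; rewrite ler_norml => hb' /andP[bx1 bx2].
  have := ler_norm be; have := ler_norm (- be); rewrite normrN => b1 b2.
  move: h1; rewrite ltr_norml => /andP[w1a w1b].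
  have a0 : 0 <= 3^-1 - w1 + (x * be - be) by lra.
  have a1 : 0 <= 3^-1 + w1 - x * be by lra.
  have a2 : 0 <= 3^-1 + be by lra.
  have abc : 3^-1 - w1 + (x * be - be) + (3^-1 + w1 - x * be) + (3^-1 + be) = 1 by field.
  have := convex3 cO O0 O1 OP a0 a1 a2 abc; congr Om; congr pair => /=.
    by rewrite /z1; field.
  by rewrite /z2 /be; field.
have Oz : Om (z1, z2) by rewrite -[z1]add0r -[z2]add0r; apply: ball; rewrite normr0.
have sT : similarity 1 (simil (1 : R) 1 0 z1 z2).
  by exists 1, 0, z1, z2; split=> //; rewrite expr1n expr0n/= addr0.
have TE w : simil (1 : R) 1 0 z1 z2 w = (w.1 + z1, w.2 + z2).
  by rewrite /simil !mul1r !mul0r subr0 add0r.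
exists (simil 1 1 0 z1 z2); split=> //; split.
- by move/continuousP : (similarity_continuous sT); apply.
- by have [] := A2convex_similarity sT AO.
- move=> w; rewrite /eball/= subr0 TE => wr; have [h1 h2] := enorm_ge_coords w.
  by apply: ball; [exact: le_lt_trans h1 wr|exact: le_lt_trans h2 wr].
(* Both the translated point and the centroid lie in the disc of radius 2, whence the radius 4. *)
- move=> w; rewrite /= TE /eball/= subr0 => Ow.
  have -> : w = (w.1 + z1, w.2 + z2) + - (z1, z2).
    by apply: injective_projections; rewrite /= addrK.
  apply: le_lt_trans (enorm_triangle _ _) _.
  have -> : enorm (- (z1, z2)) = enorm (z1, z2) by rewrite /enorm/= !sqrrN.
  by have := O2 _ Ow; have := O2 _ Oz; lra.
Qed.

(** A point over [0, 1] faces a point of the axis in Om. A point to the left is joined to (1, 0), a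
    point to the right to (0, 0); the segment crosses the line x = 0 or x = 1 at a height reduced by
    a factor less than 3, because |x| < 2. *)
Lemma normalised_height Om (m : R) : normalised Om ->
  (forall x y y', Om (x, y) -> Om (x, y') -> `|y - y'| < m) ->
  forall x y, Om (x, y) -> `|y| <= 3 * m.
Proof.
move=> [AO O0 O1 O2] hm x y Oxy.
have [_ /convex_setP cO _ _] := AO.
have m0 : 0 < m by apply: le_lt_trans (hm _ _ _ O0 O0).
have xb : `|x| < 2 by apply: le_lt_trans (O2 _ Oxy); exact: (enorm_ge_coords (x, y)).1.
move: xb; rewrite ltr_norml => /andP[xb1 xb2].
have [x0|x0] := ltrP x 0.
  have x1 : 0 < 1 - x by lra.
  have t01 : 0 <= (1 - x)^-1 <= 1.
    by rewrite invr_ge0 (ltW x1)/= invf_le1//; lra.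
  have := cO _ _ _ t01 Oxy O1; rewrite /= mulr0 addr0 mulr1.
  rewrite (_ : _ + _ = 0); last by field; rewrite gt_eqF.
  move=> /hm/(_ O0); rewrite subr0 normrM gtr0_norm ?invr_gt0// ltr_pdivrMl//.
  by nra.
have [x1|x1] := lerP x 1.
  have t01 : 0 <= x <= 1 by rewrite x0.
  have := cO _ _ _ t01 O1 O0; rewrite /= !mulr0 addr0 mulr1 addr0.
  by move=> /hm/(_ Oxy); rewrite distrC subr0; lra.
have x1' : 0 < x by lra.
have t01 : 0 <= x^-1 <= 1 by rewrite invr_ge0 (ltW x1')/= invf_le1//; lra.
have := cO _ _ _ t01 Oxy O0; rewrite /= !mulr0 !addr0 mulVf ?gt_eqF//.
move=> /hm/(_ O1); rewrite subr0 normrM gtr0_norm ?invr_gt0// ltr_pdivrMl//.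
by nra.
Qed.

(** The supremum of the vertical chords need not be attained; a chord longer than the supremum
    divided by 1 + e replaces a maximal one. *)
Lemma normalised_chord Om (e : R) : 0 < e -> normalised Om ->
  (exists M, forall x y y', Om (x, y) -> Om (x, y') -> `|y - y'| < M) ->
  exists x y m, [/\ 0 < m, Om (x, y), Om (x, y + m) &
    forall x y y', Om (x, y) -> Om (x, y') -> `|y - y'| < (1 + e) * m].
Proof.
move=> e0 [AO O0 O1 O2] [M hM]; have [oO _ _ _] := AO.
have [d [d0 dx]] := nbhs_box (open_nbhs_nbhs (conj oO O0)); rewrite /= in dx.
pose S : set R := [set m | 0 <= m /\ exists x y, Om (x, y) /\ Om (x, y + m)].
have Sd : S d.
  split; first exact: ltW.
  by exists 0, 0; split=> //; apply: dx; split; rewrite /= in_itv/=; apply/andP; split; lra.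
have hS : has_sup S.
  split; first by exists d.
  exists M => m [m0 [x [y [Oy Oy']]]]; have := hM _ _ _ Oy' Oy.
  by rewrite addrAC subrr add0r ger0_norm// => /ltW.
have dS : d <= sup S by apply: sup_upper_bound.
have s0 : 0 < sup S by exact: lt_le_trans dS.
have ep : 0 < sup S - sup S / (1 + e).
  by rewrite subr_gt0 ltr_pdivrMr ?ltr_pMr; lra.
have [m [m0 [x [y [Oy Oy']]]] hm] := sup_adherent ep hS.
rewrite subKr in hm.
have hm' : sup S < (1 + e) * m by rewrite mulrC -ltr_pdivrMr//; lra.
exists x, y, m; split=> //.
  by apply: lt_trans hm; rewrite divr_gt0//; lra.
have W x' y1 y2 : y1 <= y2 -> Om (x', y1) -> Om (x', y2) -> `|y1 - y2| < (1 + e) * m.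
  move=> y12 O1' O2'; apply: le_lt_trans hm'; apply: sup_upper_bound => //.
  rewrite distrC ger0_norm ?subr_ge0//; split; first by rewrite subr_ge0.
  by exists x', y1; rewrite addrC subrK.
move=> x' y1 y2 Oy1 Oy2; have [h|/ltW h] := leP y1 y2; first exact: (W x').
by rewrite distrC; exact: (W x').
Qed.

(** One of the points (0, 0), (1, 0) lies at horizontal distance at least 1/2 from the chord, on the
    side given by the sign [sg]. In the triangle that it spans with the chord, the sections at
    distance at most e/2 from the chord are shrunk by 1 - t with t <= e. Heights are at most 6 m, so
    each end moves by at most 6 e m and m (1 - 12 e) is left. *)
Lemma normalised_rectangle Om (e m x0 y0 : R) : 0 < e < 12^-1 -> normalised Om ->
  0 < m -> Om (x0, y0) -> Om (x0, y0 + m) ->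
  (forall x y y', Om (x, y) -> Om (x, y') -> `|y - y'| < (1 + e) * m) ->
  exists a b, `[a, a + e / 2] `*` `[b, b + m * (1 - 12 * e)] `<=` Om.
Proof.
move=> /andP[e0 e1] NO m0 Oy Oy' hm.
have [AO O0 O1 O2] := NO; have [_ /convex_setP cO _ _] := AO.
have hgt x y : Om (x, y) -> `|y| <= 6 * m.
  by move=> /(normalised_height NO hm); nra.
have key (be sg : R) : Om (be, 0) -> 2^-1 <= sg * (be - x0) -> (sg = 1 \/ sg = -1) ->
    forall x y, 0 <= sg * (x - x0) <= e / 2 ->
    y0 + 6 * e * m <= y <= y0 + m - 6 * e * m -> Om (x, y).
  move=> Ob hb hsg x y /andP[x1 x2] /andP[y1 y2].
  have bx : 0 < sg * (be - x0) by lra.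
  pose t := (sg * (x - x0)) / (sg * (be - x0)).
  have t0 : 0 <= t by rewrite divr_ge0// ltW.
  have te : t <= e by rewrite ler_pdivrMr//; nra.
  have t1 : 0 < 1 - t by lra.
  have xE : x - x0 = t * (be - x0).
    rewrite /t; have sg0 : sg != 0 by case: hsg => ->; rewrite ?oppr_eq0 oner_eq0.
    by field; move: bx => /lt0r_neq0; rewrite mulf_eq0 negb_or => /andP[-> ->].
  have hy0 := hgt _ _ Oy; have hy1 := hgt _ _ Oy'.
  move: hy0 hy1; rewrite !ler_norml => /andP[ya yb] /andP[yc yd].
  pose w := y / (1 - t).
  have wE : w * (1 - t) = y by rewrite /w divfK// gt_eqF.
  have w1 : y0 <= w by rewrite /w ler_pdivlMr//; nra.
  have w2 : w <= y0 + m by rewrite /w ler_pdivrMr//; nra.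
  have s01 : 0 <= (w - y0) / m <= 1.
    by rewrite divr_ge0 ?subr_ge0 ?(ltW m0)//= ler_pdivrMr//; lra.
  have Ow := cO _ _ _ s01 Oy' Oy.
  have t01 : 0 <= t <= 1 by apply/andP; split; lra.
  have := cO _ _ _ t01 Ob Ow; congr Om; congr pair => /=.
    by rewrite (_ : x = x0 + t * (be - x0)); [field; rewrite gt_eqF|lra].
  rewrite mulr0 add0r -wE mulrC; congr (_ * _); field; rewrite gt_eqF//.
have [x0h|x0h] := lerP x0 2^-1.
  exists x0, (y0 + 6 * e * m) => -[x y] [/=]; rewrite !in_itv/= => /andP[h1 h2] /andP[h3 h4].
  apply: (key 1 1) => //; rewrite ?mul1r; [lra|by left|apply/andP; split; lra|].
  by apply/andP; split; lra.
exists (x0 - e / 2), (y0 + 6 * e * m) => -[x y] [/=]; rewrite !in_itv/= => /andP[h1 h2] /andP[h3 h4].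
apply: (key 0 (-1)) => //; rewrite ?mulN1r; [lra|by right|apply/andP; split; lra|].
by apply/andP; split; lra.
Qed.

Lemma Fpq_thin p q (eta : R) : (1 <= q)%E -> (q <= 2%:E)%E -> (2%:E <= p)%E ->
  0 < eta < 1 -> exists2 k, 0 < k & forall Om, normalised Om ->
    (forall x y y', Om (x, y) -> Om (x, y') -> `|y - y'| < k) ->
    ((1 - eta)%:E * Fpq p q usquare <= Fpq p q Om)%E.
Proof.
move=> q1 q2 p2 /andP[eta0 eta1].
(* Heights below e^2 against a width of e/2 make the inverse width negligible: it contributes 2 m /
   e <= 2 e. All relative errors together stay below 60 e. *)
pose e := eta / 60; exists (e ^+ 2); first by rewrite exprn_gt0// divr_gt0.
have e0 : 0 < e by rewrite divr_gt0.
have ee : eta = 60 * e by rewrite /e; field.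
move=> Om NO hk; have [AO _ _ _] := NO.
have [x0 [y0 [m [m0 Oy Oy' hm]]]] := normalised_chord e0 NO (ex_intro _ _ hk).
have e12 : 0 < e < 12^-1 by clear - e0 eta1 ee; apply/andP; split; lra.
have [a [b rect]] := normalised_rectangle e12 NO m0 Oy Oy' hm.
have mk : m < e ^+ 2.
  have := hk _ _ _ Oy' Oy; rewrite addrAC subrr add0r gtr0_norm//.
have oO := A2convex_open AO; have O0 := A2convex_neq0 AO.
have oQ := @open_usquare R; have Q0 := @usquare0 R.
have s0 : 0 < Num.sqrt 2 :> R by rewrite sqrtr_gt0.
have e1m : 0 < (1 + e) * m by rewrite mulr_gt0// addr_gt0.
have e12' : 0 < 1 - 12 * e by clear - e12; move/andP : e12 => [? ?]; lra.
have hp := lambda_root_thin p2 e1m oO O0 hm.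
have ab : a < a + e / 2 by rewrite ltrDl divr_gt0.
have bb : b < b + m * (1 - 12 * e) by rewrite ltrDl mulr_gt0.
have hq := lambda_root_rectangle q1 q2 ab bb rect.
rewrite !(addrAC _ _ (- _)) !subrr !add0r in hq.
set c1 := (_ * _)^-1 in hp; set c2 := _ / _ in hq.
have c10 : 0 < c1 by rewrite invr_gt0 mulr_gt0.
have c20 : 0 < c2.
  by rewrite divr_gt0// addr_gt0// invr_gt0; rewrite ?divr_gt0 ?mulr_gt0.
have := Fpq_compare c10 c20 oO O0 oQ Q0 hp hq.
apply: le_trans; apply: lee_wpmul2r; first exact: Fpq_ge0.
rewrite lee_fin.
(* Here the sqrt 2 of the bound for p >= 2 cancels against that of the bound for q <= 2. *)
have -> : c1 / c2 = ((1 + e) * (2 * m / e + (1 - 12 * e)^-1))^-1.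
  rewrite /c1 /c2; field; rewrite !gt_eqF//=.
  - by rewrite addr_gt0.
  - by rewrite addr_gt0// !mulr_gt0.
set D := (1 - 12 * e)^-1.
have DE : D * (1 - 12 * e) = 1 by rewrite /D mulVf// gt_eqF.
have D0 : 0 < D by rewrite invr_gt0.
have e24 : 60 * e < 1 by rewrite -ee.
have D1 : D <= 1 + 24 * e by clear - DE D0 e24 e0; nra.
have me : 2 * m / e <= 2 * e by rewrite ler_pdivrMr//; clear - mk; nra.
have me0 : 0 <= 2 * m / e by rewrite divr_ge0 ?mulr_ge0// ltW.
set X := 2 * m / e in me me0 *.
have den : (1 + e) * (X + D) <= 1 + eta by rewrite ee; clear - me me0 D1 D0 e24 e0; nra.
have den0 : 0 < (1 + e) * (X + D) by clear - e0 me0 D0; nra.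
rewrite -[leLHS]invrK lef_pV2 ?posrE// ?invr_gt0 ?subr_gt0//.
apply: (le_trans den); have et : 0 < 1 - eta by rewrite subr_gt0.
rewrite -(ler_pM2r et) mulVf ?gt_eqF//; clear - eta0; nra.
Qed.

End thin_or_fat.

(** * Compactness *)

Section blaschke.
Context {R : realType}.
Implicit Types (A B K Om : set (R * R)) (r d h : R).

Definition grid h (i j : nat) : R * R := (- 4 + i%:R * h, - 4 + j%:R * h).

Lemma enorm_scale (k : R) (w : R * R) : 0 <= k -> enorm (k * w.1, k * w.2) = k * enorm w.
Proof.
move=> k0; rewrite /enorm/= !exprMn -mulrDr sqrtrM ?sqr_ge0// sqrtr_sqr.
by rewrite ger0_norm.
Qed.

(** The point is the convex combination of x and ((1 + d)/d) w with weights 1/(1 + d) and d/(1 + d),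
    and the second point lies in the disc. So shrinking A by 1 + d leaves a margin r d / (1 + d)
    inside A. *)
Lemma convex_ball A r d (x w : R * R) : convex_set (M := (R * R)%type) A -> eball 0 r `<=` A ->
  0 < d -> A x -> enorm w < r * (d / (1 + d)) ->
  A (x.1 / (1 + d) + w.1, x.2 / (1 + d) + w.2).
Proof.
move=> /convex_setP cA rA d0 Ax wr.
have d1 : 0 < 1 + d by lra.
have d1n : 1 + d != 0 by rewrite gt_eqF.
have dn : d != 0 by rewrite gt_eqF.
have t01 : 0 <= (1 + d)^-1 <= 1 by rewrite invr_ge0 (ltW d1)/= invf_le1//; lra.
pose k := (1 + d) / d; have k0 : 0 < k by rewrite divr_gt0.
have Aw : A (k * w.1, k * w.2).
  apply: rA; rewrite /eball/= subr0 enorm_scale ?(ltW k0)// -ltr_pdivlMl//.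
  by rewrite mulrC /k invf_div.
have := cA _ _ _ t01 Ax Aw; congr A; congr pair => /=; rewrite /k; field; exact/andP.
Qed.

(* The point [x / (1 + d)] has distance at least [3 h] to the complement of [A], so the
   corners of its grid cell lie in [A], hence in [B]. *)
Lemma grid_inclusion A B r d h (N : nat) : convex_set (M := (R * R)%type) A ->
  convex_set (M := (R * R)%type) B -> eball 0 r `<=` A -> A `<=` eball 0 4 ->
  0 < d -> 0 < h -> 3 * h <= r * (d / (1 + d)) -> 8 <= N%:R * h ->
  (forall i j : 'I_N, A (grid h i j) -> B (grid h i j)) ->
  forall x, A x -> B (x.1 / (1 + d), x.2 / (1 + d)).
Proof.
move=> cA cB rA A4 d0 h0 hr Nh AB x Ax.
set y1 := x.1 / (1 + d); set y2 := x.2 / (1 + d).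
have ball w1 w2 : `|w1| <= h -> `|w2| <= h -> A (y1 + w1, y2 + w2).
  move=> h1 h2; apply: (@convex_ball A r d x (w1, w2)) => //.
  by apply: le_lt_trans (enorm_le_sum _) _ => /=; lra.
have A0 := ball 0 0; rewrite normr0 !addr0 in A0.
have {}A0 := A0 (ltW h0) (ltW h0).
have box (z : R * R) : A z -> `|z.1| < 4 /\ `|z.2| < 4.
  move=> /A4; rewrite /eball/= subr0 => z4; have [h1 h2] := enorm_ge_coords z.
  by split; [exact: le_lt_trans h1 z4|exact: le_lt_trans h2 z4].
have cell y : `|y| < 4 -> exists i : nat, - 4 + i%:R * h <= y < - 4 + i.+1%:R * h.
  rewrite ltr_norml => /andP[ya yb].
  have : 0 <= (y + 4) / h by rewrite divr_ge0 ?(ltW h0)//; lra.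
  move=> /truncn_itv; set i := Num.truncn _ => /andP[i1 i2]; exists i.
  by rewrite ler_pdivlMr// in i1; rewrite ltr_pdivrMr// in i2; apply/andP; split; lra.
have [/cell[i /andP[i1 i2]] /cell[j /andP[j1 j2]]] := box _ A0.
rewrite /= in i1 i2 j1 j2.
rewrite -[in X in _ < X](addn1 i) natrD in i2.
rewrite -[in X in _ < X](addn1 j) natrD in j2.
have corner (i' j' : nat) : (i' = i \/ i' = i.+1) -> (j' = j \/ j' = j.+1) -> B (grid h i' j').
  move=> hi hj.
  have Aij : A (grid h i' j').
    rewrite /grid (_ : - 4 + i'%:R * h = y1 + (- 4 + i'%:R * h - y1)); last by ring.
    rewrite (_ : - 4 + j'%:R * h = y2 + (- 4 + j'%:R * h - y2)); last by ring.
    apply: ball.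
      by case: hi => ->; rewrite -?[i.+1]addn1 ?natrD ler_norml; apply/andP; split; lra.
    by case: hj => ->; rewrite -?[j.+1]addn1 ?natrD ler_norml; apply/andP; split; lra.
  have [b1 b2] := box _ Aij; rewrite /= !ltr_norml in b1 b2.
  (* The corners belong to A, so their coordinates are below 4, and N h >= 8 makes their indices
     range in ['I_N]. *)
  have bound (n : nat) : - 4 + n%:R * h < 4 -> (n < N)%N.
    move=> hn; rewrite ltnNge; apply/negP => Nn.
    have : N%:R * h <= n%:R * h by rewrite ler_pM2r// ler_nat.
    by lra.
  have iN : (i' < N)%N by apply: bound; case/andP : b1.
  have jN : (j' < N)%N by apply: bound; case/andP : b2.
  exact: (AB (Ordinal iN) (Ordinal jN) Aij).
move/convex_setP in cB.
(* Weights of a bilinear interpolation: first along the two horizontal sides of the cell, then along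
   the vertical segment joining them. *)
pose t := 1 - (y1 - (- 4 + i%:R * h)) / h.
pose s := 1 - (y2 - (- 4 + j%:R * h)) / h.
have t01 : 0 <= t <= 1.
  rewrite /t; set u := _ / h.
  have : 0 <= u <= 1 by rewrite /u ler_pdivrMr// divr_ge0 ?(ltW h0)//=; lra.
  by move=> /andP[? ?]; apply/andP; split; lra.
have s01 : 0 <= s <= 1.
  rewrite /s; set u := _ / h.
  have : 0 <= u <= 1 by rewrite /u ler_pdivrMr// divr_ge0 ?(ltW h0)//=; lra.
  by move=> /andP[? ?]; apply/andP; split; lra.
have row (j' : nat) : (j' = j \/ j' = j.+1) -> B (y1, - 4 + j'%:R * h).
  move=> hj; have := cB _ _ _ t01 (corner i j' (or_introl erefl) hj) (corner i.+1 j' (or_intror erefl) hj).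
  congr B; congr pair => /=; last by ring.
  by rewrite /t -[i.+1]addn1 natrD; field; rewrite gt_eqF.
have := cB _ _ _ s01 (row j (or_introl erefl)) (row j.+1 (or_intror erefl)).
congr B; congr pair => /=; first by ring.
by rewrite /s -[j.+1]addn1 natrD; field; rewrite gt_eqF.
Qed.

Lemma interior_convex K : convex_set (M := (R * R)%type) K ->
  convex_set (M := (R * R)%type) (interior K).
Proof.
move=> /convex_setP cK; apply/convex_setP => x y t /andP[t0 t1] Kx Ky.
have [e1 [e10 ex]] := nbhs_box Kx; have [e2 [e20 ey]] := nbhs_box Ky.
pose e := Num.min e1 e2.
have e0 : 0 < e by rewrite lt_min e10.
have ee1 : e <= e1 by rewrite /e ge_min lexx.
have ee2 : e <= e2 by rewrite /e ge_min lexx orbT.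
set z := (_, _); apply/nbhs_ballP; exists e => // -[a b] [/=].
rewrite /ball/= !ltr_norml => /andP[a1 a2] /andP[b1 b2].
pose w1 := a - z.1; pose w2 := b - z.2.
have w1b : - e <= w1 <= e by rewrite /w1 /z/=; apply/andP; split; lra.
have w2b : - e <= w2 <= e by rewrite /w2 /z/=; apply/andP; split; lra.
move: w1b w2b => /andP[? ?] /andP[? ?].
have Kx' : K (x.1 + w1, x.2 + w2).
  by apply: ex; split; rewrite /= in_itv/=; apply/andP; split; lra.
have Ky' : K (y.1 + w1, y.2 + w2).
  by apply: ey; split; rewrite /= in_itv/=; apply/andP; split; lra.
have t01 : 0 <= t <= 1 by rewrite t0.
have := cK _ _ _ t01 Kx' Ky'; congr K; congr pair => /=; rewrite /w1 /w2 /z/=; ring.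
Qed.

Lemma eball_nbhs r : 0 < r -> nbhs (0 : R * R) (eball 0 r).
Proof.
move=> r0; apply/nbhs_ballP; exists (r / 2); first by rewrite /= divr_gt0.
move=> [a b] [/=]; rewrite /ball/= !sub0r !normrN => ha hb.
by rewrite /eball/= subr0; apply: le_lt_trans (enorm_le_sum _) _ => /=; lra.
Qed.

(** The ultrafilter limit need not be open. Passing to its interior costs one more factor 1 + d, the
    origin of the square in [Fpq_sandwich]. *)
Lemma dilate_interior K r d x : convex_set (M := (R * R)%type) K -> eball 0 r `<=` K ->
  0 < r -> 0 < d -> K x -> interior K (x.1 / (1 + d), x.2 / (1 + d)).
Proof.
move=> cK rK r0 d0 Kx.
have d1 : 0 < 1 + d by lra.
have rd : 0 < r * (d / (1 + d)) by rewrite mulr_gt0// divr_gt0.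
apply/nbhs_ballP; exists (r * (d / (1 + d)) / 2); first by rewrite /= divr_gt0.
move=> [a b] [/=]; rewrite /ball/= => ha hb.
rewrite -(subrK (x.1 / (1 + d)) a) addrC -(subrK (x.2 / (1 + d)) b) [X in (_, X)]addrC.
apply: (@convex_ball K r d x (a - x.1 / (1 + d), b - x.2 / (1 + d))) => //.
by apply: le_lt_trans (enorm_le_sum _) _ => /=; rewrite distrC [X in _ + X]distrC; lra.
Qed.

Lemma fat_A2convex r Om : 0 < r -> fat r Om -> A2convex Om.
Proof.
move=> r0 [oO cO rO O4].
have mO : measurable (Om : set (plane R)) by exact: open_measurable_plane.
split=> //.
  have [e [e0 ex]] := nbhs_box (eball_nbhs r0); rewrite /= in ex.
  apply: (@lt_le_trans _ _ (lebesgue2 R (`[0 - e, 0 + e] `*` `[0 - e, 0 + e]))).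
    have le1 : 0 - e <= 0 + e by lra.
    by rewrite (box_measure le1 le1) lte_fin mulr_gt0//; lra.
  apply: le_measure; rewrite ?inE//; first exact: measurable_box.
  exact: subset_trans rO.
apply: (@le_lt_trans _ _ (lebesgue2 R (`[-4, 4] `*` `[-4, 4]))).
  apply: le_measure; rewrite ?inE//; first exact: measurable_box.
  move=> x /O4; rewrite /eball/= subr0 => x4; have [h1 h2] := enorm_ge_coords x.
  have := le_lt_trans h1 x4; have := le_lt_trans h2 x4; rewrite !ltr_norml.
  by move=> /andP[? ?] /andP[? ?]; split; rewrite /= in_itv/=; apply/andP; split; lra.
have le1 : (-4 : R) <= 4 by lra.
by rewrite (box_measure le1 le1) ltry.
Qed.

End blaschke.

(** * Ultrafilter limits and a minimiser among fat domains *)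

Section existence.
Context {R : realType}.
Implicit Types (A B K Om : set (R * R)) (r d h : R) (p q : \bar R).

(** The pointwise limit of the indicator functions along U. An ultrafilter decides every point, so
    no subsequence has to be extracted. *)
Definition ulimit (U : set_system nat) (Om_ : nat -> set (R * R)) : set (R * R) :=
  [set x | U [set n | Om_ n x]].

Lemma ulimit_convex (U : set_system nat) (FU : Filter U) (Om_ : nat -> set (R * R)) :
  (forall n, convex_set (M := (R * R)%type) (Om_ n)) ->
  convex_set (M := (R * R)%type) (ulimit U Om_).
Proof.
move=> cO; apply/convex_setP => x y t t01 Ux Uy.
apply: filterS (filterI Ux Uy) => n [/= Ox Oy].
by move: (cO n) => /convex_setP /(_ _ _ _ t01 Ox Oy).
Qed.

(** For each grid point, the indices n for which [Om_ n] agrees with the limit there form a set of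
    U. So does the intersection over the finite grid, and [grid_inclusion] then applies in both
    directions. *)
Lemma ulimit_approx (U : set_system nat) (Om_ : nat -> set (R * R)) r d : UltraFilter U ->
  0 < r -> 0 < d -> (forall n, fat r (Om_ n)) ->
  U [set n | (forall x, ulimit U Om_ x -> Om_ n (x.1 / (1 + d), x.2 / (1 + d))) /\
             (forall x, Om_ n x -> ulimit U Om_ (x.1 / (1 + d), x.2 / (1 + d)))].
Proof.
move=> UU r0 d0 fO; set K := ulimit U Om_.
have FU : ProperFilter U by exact: ultra_proper.
have cK : convex_set (M := (R * R)%type) K by apply: ulimit_convex => n; case: (fO n).
have rK : eball 0 r `<=` K.
  by move=> x xr; apply: filterS filterT => n _; case: (fO n) => _ _ + _; apply.
have K4 : K `<=` eball 0 4.
  by move=> x /filter_ex[n Ox]; case: (fO n) => _ _ _; apply.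
pose h := r * (d / (1 + d)) / 3.
have h0 : 0 < h by rewrite divr_gt0// mulr_gt0// divr_gt0//; lra.
have h3 : 3 * h <= r * (d / (1 + d)) by rewrite /h; lra.
pose N := (Num.truncn (8 / h)).+1.
have Nh : 8 <= N%:R * h.
  have h8 : 0 <= 8 / h by rewrite divr_ge0// ltW.
  by have /andP[_ lt8] := truncn_itv h8; rewrite -ler_pdivrMr//; exact: ltW.
have agree (ij : 'I_N * 'I_N) : U [set n | Om_ n (grid h ij.1 ij.2) <-> K (grid h ij.1 ij.2)].
  have [Kij|nKij] := pselect (K (grid h ij.1 ij.2)).
    by apply: (filterS _ (Kij)) => n /= On; split.
  have [|Uc] := in_ultra_setVsetC [set n | Om_ n (grid h ij.1 ij.2)] UU; first by [].
  by apply: filterS Uc => n /= On; split.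
apply: filterS (filter_forall FU agree) => n /= hn.
have [_ cO rO O4] := fO n.
split.
  apply: (grid_inclusion cK cO rK K4 d0 h0 h3 Nh) => i j Kij.
  exact/(hn (i, j)).
apply: (grid_inclusion cO cK rO O4 d0 h0 h3 Nh) => i j Oij.
exact/(hn (i, j)).
Qed.

Lemma dilation_similarity (s : R) : 0 < s -> similarity s (simil s 1 0 0 0).
Proof. by move=> s0; exists 1, 0, 0, 0; split=> //; rewrite expr1n expr0n/= addr0. Qed.

Lemma dilationE (s : R) (x : R * R) : simil s 1 0 0 0 x = (s * x.1, s * x.2).
Proof. by rewrite /simil !mul0r !mul1r subr0 add0r !addr0. Qed.

(** The numerator uses the inclusion of a shrunk Om in Om', at cost (1 + d)^2, the denominator that
    of a shrunk Om' in Om, at cost 1 + d. *)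
Lemma Fpq_sandwich p q Om Om' d : (1 <= p)%E -> (1 <= q)%E -> 0 < d ->
  A2convex Om -> A2convex Om' ->
  (forall x, Om' x -> Om (x.1 / (1 + d), x.2 / (1 + d))) ->
  (forall x, Om x -> Om' (x.1 / (1 + d) ^+ 2, x.2 / (1 + d) ^+ 2)) ->
  (((1 + d) ^- 3)%:E * Fpq p q Om' <= Fpq p q Om)%E.
Proof.
move=> p1 q1 d0 AO AO' h1 h2.
have d1 : 0 < 1 + d by lra.
have d1n : 1 + d != 0 by rewrite gt_eqF.
have i1 : 0 < (1 + d) ^- 2 by rewrite invr_gt0 exprn_gt0.
have i2 : 0 < 1 + d by [].
have oO := A2convex_open AO; have oO' := A2convex_open AO'.
have O0 := A2convex_neq0 AO; have O0' := A2convex_neq0 AO'.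
rewrite (_ : (1 + d) ^- 3 = (1 + d) ^- 2 / (1 + d)); last by field.
have s1 := dilation_similarity i1; have s2 := dilation_similarity i2.
apply: Fpq_compare => //.
  rewrite -(lambda_root_similarity Om' p1 s1).
  apply: lambda_root_anti => // x Ox /=; rewrite dilationE.
  by rewrite ![_ ^- 2 * _]mulrC; exact: h2.
have A2 := A2convex_similarity s2 AO'.
rewrite -(lambda_root_similarity Om' q1 s2).
apply: lambda_root_anti => //; [exact: A2convex_open|exact: A2convex_neq0|].
move=> x /=; rewrite dilationE => /h1 /=.
by rewrite ![(1 + d) * _]mulrC !mulfK//; case: x.
Qed.

Lemma le_of_perturbed (x y : \bar R) : (0 <= y)%E ->
  (forall d : R, 0 < d < 1 -> (((1 + d) ^- 3)%:E * x <= y + d%:E)%E) -> (x <= y)%E.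
Proof.
case: y => [y| |]//; last by move=> _ _; rewrite leey.
rewrite lee_fin => y0; case: x => [x| |] H; [|exfalso|exact: leNye]; last first.
  have h : 0 < (2^-1 : R) < 1 by apply/andP; split; lra.
  have := H _ h; rewrite gt0_muley ?lte_fin ?invr_gt0 ?exprn_gt0 ?addr_gt0//.
rewrite lee_fin leNgt; apply/negP => yx.
(* From (1 + d)^3 <= 1 + 7 d and d^2 <= d, the product (1 + 7 d)(y + d) is at most y + k d; d is
   chosen so that k d is at most half of x - y. *)
pose k := 8 + 7 * y; have k0 : 0 < k by rewrite /k; lra.
pose d := Num.min 2^-1 ((x - y) / (2 * k)).
have d0 : 0 < d by rewrite lt_min divr_gt0 ?subr_gt0 ?mulr_gt0// andbT; lra.
have d2 : d <= 2^-1 by rewrite /d ge_min lexx.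
have dk : d * (2 * k) <= x - y.
  by rewrite -ler_pdivlMr ?mulr_gt0// /d ge_min lexx orbT.
have d01 : 0 < d < 1 by rewrite d0/=; lra.
have := H d d01; rewrite -EFinM -EFinD lee_fin ler_pdivrMl ?exprn_gt0 ?addr_gt0//.
have c3 : (1 + d) ^+ 3 <= 1 + 7 * d by rewrite !exprS expr0; clear - d0 d2; nra.
move=> h.
have : x <= (1 + 7 * d) * (y + d).
  by apply: le_trans h _; rewrite ler_wpM2r// addr_ge0// ltW.
have : d * d <= d by clear - d0 d2; nra.
rewrite /k in dk; clear - dk yx d0 y0; nra.
Qed.

Lemma open_eball r : open (eball (0 : R * R) r).
Proof.
have := @open_lt R r; move/continuousP : (continuous_enorm_pair (@continuous_fst2 R) (@continuous_snd2 R)).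
move=> /[apply]; congr open; apply/seteqP; split => x; rewrite /eball/= subr0; by case: x.
Qed.

Lemma A2convex_usquare : A2convex (usquare : set (R * R)).
Proof.
apply: (@fat_A2convex _ 2^-1); first by rewrite invr_gt0.
split.
- exact: open_usquare.
- apply/convex_setP => x y t /andP[t0 t1] [x1 x2] [y1 y2].
  have h (a b : R) : `|a| < 2^-1 -> `|b| < 2^-1 -> `|t * a + (1 - t) * b| < 2^-1.
    rewrite !ltr_norml => /andP[a1 a2] /andP[b1 b2].
    by have [->|tn] := eqVneq t 1; apply/andP; split; nra.
  by split; exact: h.
- move=> x; rewrite /eball/= subr0 => xr; have [h1 h2] := enorm_ge_coords x.
  by split; [exact: le_lt_trans h1 xr|exact: le_lt_trans h2 xr].
- move=> x [x1 x2]; rewrite /eball/= subr0.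
  by apply: le_lt_trans (enorm_le_sum x) _; lra.
Qed.

Lemma fat_minimiser p q r : (1 <= p)%E -> (1 <= q)%E -> 0 < r ->
  exists Om', A2convex Om' /\ forall Om, fat r Om -> (Fpq p q Om' <= Fpq p q Om)%E.
Proof.
move=> p1 q1 r0.
(* Without fat domains the bound is vacuous and the square serves as a default. *)
have [[Om1 fO1]|noO] := pselect (exists Om, fat r Om); last first.
  exists usquare; split; first exact: A2convex_usquare.
  by move=> Om fO; exfalso; apply: noO; exists Om.
pose I := ereal_inf [set Fpq p q Om | Om in fat r].
have I0 : (0 <= I)%E.
  apply: le_ereal_inf_tmp => _ [Om fO <-]; have AO := fat_A2convex r0 fO.
  by apply: Fpq_ge0; [exact: A2convex_open|exact: A2convex_neq0].
have /choice[Om_ hO] : forall n : nat, exists Om, fat r Om /\ (Fpq p q Om <= I + (n.+1%:R^-1)%:E)%E.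
  move=> n; have n0 : 0 < (n.+1%:R : R)^-1 by rewrite invr_gt0.
  case: (boolP (I \is a fin_num)) => [If|].
    by have [_ [Om fO <-] /ltW h] := lb_ereal_inf_adherent n0 If; exists Om.
  by case: (I) I0 => // _ _; exists Om1; split=> //; rewrite leey.
have fO n : fat r (Om_ n) by have [] := hO n.
have [U [UU sU]] := ultraFilterLemma eventually_filter.
have FU : ProperFilter U by exact: ultra_proper.
set K := ulimit U Om_.
have cK : convex_set (M := (R * R)%type) K by apply: ulimit_convex => n; case: (fO n).
have rK : eball 0 r `<=` K.
  by move=> x xr; apply: filterS filterT => n _; case: (fO n) => _ _ + _; apply.
have K4 : K `<=` eball 0 4.
  by move=> x /filter_ex[n Ox]; case: (fO n) => _ _ _; apply.
have oball : open (eball (0 : R * R) r) by exact: open_eball.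
have fK : fat r (interior K).
  split; first exact: open_interior.
  - exact: interior_convex.
  - by move=> x xr; apply: filterS rK _; exact: open_nbhs_nbhs.
  - by apply: subset_trans K4; exact: interior_subset.
have AK := fat_A2convex r0 fK.
exists (interior K); split=> // Om fOm.
apply: (@le_trans _ _ I); last by apply: ereal_inf_lbound; exists Om.
apply: le_of_perturbed => // d /andP[d0 d1].
have Ud := ulimit_approx UU r0 d0 fO.
have [M hM] : exists M : nat, forall n, (M <= n)%N -> (n.+1%:R)^-1 <= d.
  exists (Num.truncn d^-1) => n Mn; rewrite invf_ple ?posrE//; apply: ltW.
  have di : 0 <= d^-1 by rewrite invr_ge0 ltW.
  have /andP[_ h] := truncn_itv di.
  by apply: lt_le_trans h _; rewrite ler_nat ltnS.
have UM : U [set n | (M <= n)%N] by apply: sU; exists M.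
(* For a given d a single index suffices, with [Om_ n] close to K and of energy within d of the
   infimum. *)
have [n [/= [hn1 hn2] Mn]] := filter_ex (filterI Ud UM).
have [_ In] := hO n.
apply: (@le_trans _ _ (Fpq p q (Om_ n))); last first.
  by apply: (le_trans In); rewrite leeD2l// lee_fin; exact: hM.
apply: Fpq_sandwich => //.
- exact: fat_A2convex r0 (fO n).
- by move=> x /interior_subset; exact: hn1.
- move=> x /hn2 /(dilate_interior cK rK r0 d0)/=.
  by rewrite -!mulrA -!invfM -!expr2.
Qed.

End existence.

(** * From the fat class to all convex domains *)

Section minimiser.
Context {R : realType}.

Lemma lt_scale_near1 (x y : \bar R) : (0 <= x)%E -> (x < y)%E ->
  exists2 eta : R, 0 < eta < 1 & (x < (1 - eta)%:E * y)%E.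
Proof.
case: x => [x| |]//; case: y => [y| |]//; rewrite ?lee_fin ?lte_fin; last first.
  move=> x0 _; exists 2^-1; first by apply/andP; split; lra.
  by rewrite gt0_muley ?ltry// lte_fin; lra.
move=> x0 xy; have y0 : 0 < y by exact: le_lt_trans xy.
(* With this value (1 - eta) y is the midpoint of x and y. *)
exists ((y - x) / (2 * y)).
  rewrite divr_gt0 ?subr_gt0 ?mulr_gt0//= ltr_pdivrMr ?mulr_gt0//; lra.
rewrite -EFinM lte_fin mulrBl mul1r -mulrA invfM -mulrA mulVf ?gt_eqF// mulr1; lra.
Qed.

(** An energy below (1 - eta) F(Q) rules out the thin alternative. In the other one the domain is
    fat after two similarities, neither of which changes F. *)
Lemma minimiser_below_square (p q : \bar R) (eta : R) :
  (1 <= p)%E -> (1 <= q)%E -> (q <= 2%:E)%E -> (2%:E <= p)%E -> 0 < eta < 1 ->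
  exists2 Om', A2convex Om' & forall Om, A2convex Om ->
    (Fpq p q Om < (1 - eta)%:E * Fpq p q usquare)%E -> (Fpq p q Om' <= Fpq p q Om)%E.
Proof.
move=> p1 q1 q2 p2 eta01.
have [k k0 thin] := Fpq_thin q1 q2 p2 eta01.
have r0 : 0 < k / (3 * (k + 6)) by rewrite divr_gt0// mulr_gt0// addr_gt0.
have [Om' [AO' min]] := fat_minimiser p1 q1 r0.
exists Om' => // Om AO.
have [s [T [sT nO]]] := A2convex_normalise AO.
rewrite -(Fpq_similarity Om p1 q1 sT) ltNge => /negP lt.
have [/(thin _ nO)//|[T' [sT' fO]]] := fat_or_thin k0 nO.
by rewrite -(Fpq_similarity (T @^-1` Om) p1 q1 sT'); exact: min.
Qed.

End minimiser.

Local Open Scope ereal_scope.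

Theorem theorem3p8 (R : realType) (p q : \bar R)
  (hq1 : 1 <= q) (hqp : q < p) (hq2 : q <= 2%:E) (h2p : 2%:E <= p) :
  exists Omega_star : set (R * R),
    A2convex Omega_star /\
    forall Omega : set (R * R), A2convex Omega ->
      Fpq p q Omega_star <= Fpq p q Omega.
Proof.
have p1 : 1 <= p by rewrite (le_trans hq1)// ltW.
have [sq_min|] := pselect (forall Om : set (R * R), A2convex Om -> Fpq p q usquare <= Fpq p q Om).
  by exists usquare; split=> //; exact: A2convex_usquare.
move=> /existsNP[Om0 /not_implyP[AO0 /negP]]; rewrite -ltNge => lt0.
have F0 : 0 <= Fpq p q Om0 by apply: Fpq_ge0; [exact: A2convex_open|exact: A2convex_neq0].
have [eta eta01 lt_eta] := lt_scale_near1 F0 lt0.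
have [Om' AO' min] := minimiser_below_square p1 hq1 hq2 h2p eta01.
exists Om'; split=> // Om AO.
have [le0|gt0] := leP (Fpq p q Om) (Fpq p q Om0).
  by apply: min => //; exact: le_lt_trans lt_eta.
(* A domain above the level of Om0 is compared through Om0, which lies below the threshold
   itself. *)
by apply: le_trans (ltW gt0); exact: min.
Qed.
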